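(* Let $k\ge 1$ and $v\ge2$ be integers, and let $N(v,k)$ be the number of unimodular equivalence classes of Gorenstein simplices (of any dimension) which are not lattice pyramids and whose $h^*$-polynomial is $$1+t^k+t^{2k}+\cdots+t^{(v-1)k}.$$ Then $$N(v,k)=\sum_{s\ge1}c_s(D_v)\,s!,$$ where $c_s(D_v)$ denotes the number of strict divisor chains $1=M_0<M_1<\cdots<M_s=v$ in $D_v$. In particular, $N(v,k)$ depends only on the divisor lattice $D_v$.
   Context: $D_v$ is the divisor lattice of $v$: the positive divisors of $v$ ordered by divisibility. A strict divisor chain $1=M_0<M_1<\cdots<M_s=v$ is a strictly increasing chain in $D_v$, i.e. $M_{i-1}\mid M_i$ and $M_{i-1}\neq M_i$ for all $i$. A lattice polytope is a convex polytope all of whose vertices have integer coordinates; a lattice simplex is a lattice polytope that is a simplex. A $d$-dimensional lattice simplex is considered in $\mathbb{R}^d$. Two lattice polytopes $\mathcal{P},\mathcal{Q}\subset\mathbb{R}^d$ are unimodularly equivalent if there are a unimodular matrix $U\in\mathbb{Z}^{d\times d}$ and $\mathbf{w}\in\mathbb{Z}^d$ with $\mathcal{Q}=\{\mathbf{x}U+\mathbf{w}:\mathbf{x}\in\mathcal{P}\}$. For a $d$-dimensional lattice polytope $\mathcal{P}\subset\mathbb{R}^d$, put $L_{\mathcal{P}}(m)=|m\mathcal{P}\cap\mathbb{Z}^d|$ for $m\ge1$. The $h^*$-polynomial $h^*(\mathcal{P},t)$ is the polynomial (of degree at most $d$) defined by $1+\sum_{m\ge1}L_{\mathcal{P}}(m)t^m=h^*(\mathcal{P},t)/(1-t)^{d+1}$.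 The lattice pyramid over $\mathcal{P}\subset\mathbb{R}^d$ is $\mathrm{Pyr}(\mathcal{P})=\mathrm{conv}(\mathcal{P}\times\{0\},(0,\ldots,0,1))\subset\mathbb{R}^{d+1}$. A lattice polytope is called a lattice pyramid if it is (up to unimodular equivalence) obtained by successively taking lattice pyramids (at least once) over a lower-dimensional lattice polytope. A lattice polytope $\mathcal{P}\subset\mathbb{R}^d$ is reflexive if the origin is in its interior and its dual polytope is again a lattice polytope. $\mathcal{P}$ is Gorenstein if, for some positive integer $r$, $r\mathcal{P}$ is unimodularly equivalent to a reflexive polytope. *)

(* Defs.v *)
From HB Require Import structures.
From mathcomp Require Import all_boot all_order all_algebra.
From mathcomp Require Import finmap.
From mathcomp Require Import all_classical all_reals all_analysis.

Set Implicit Arguments.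
Unset Strict Implicit.
Unset Printing Implicit Defensive.

Import Order.TTheory GRing.Theory Num.Theory.
Import numFieldNormedType.Exports.

Local Open Scope classical_set_scope.
Local Open Scope ring_scope.

(* Points of R^d are row vectors; a polytope is the set of its points. *)

Definition conv_hull (R : realType) (d : nat) (A : set 'rV[R]_d) : set 'rV[R]_d :=
  smallest (fun B : set (convex_lmodType 'rV[R]_d) => convex_set B) A.

Definition dilate (R : realType) (d : nat) (c : R) (P : set 'rV[R]_d) :
    set 'rV[R]_d :=
  [set c *: x | x in P].

Definition int_point (R : realType) (d : nat) (z : 'rV[int]_d) : 'rV[R]_d :=
  map_mx intr z.

Definition is_polytope (R : realType) (d : nat) (P : set 'rV[R]_d) : Prop :=
  exists2 V : set 'rV[R]_d, finite_set V & P = conv_hull V.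

Definition is_vertex (R : realType) (d : nat) (P : set 'rV[R]_d)
    (x : 'rV[R]_d) : Prop :=
  P x /\ forall (y z : 'rV[R]_d) (t : R), P y -> P z -> 0 < t < 1 ->
    x = t *: y + (1 - t) *: z -> y = x /\ z = x.

Definition is_lattice_polytope (R : realType) (d : nat) (P : set 'rV[R]_d) :
    Prop :=
  is_polytope P /\ (is_vertex P `<=` range (@int_point R d)).

Definition affinely_independent (R : realType) (n d : nat) (V : 'M[R]_(n, d)) :
    Prop :=
  forall a : 'rV[R]_n, \sum_i a 0 i = 0 -> a *m V = 0 -> a = 0.

(* Full-dimensional simplices: d + 1 affinely independent vertices in R^d. *)
Definition is_simplex (R : realType) (d : nat) (P : set 'rV[R]_d) : Prop :=
  exists2 V : 'M[R]_(d.+1, d), affinely_independent V &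
    P = conv_hull (range (fun i => row i V)).

Definition is_lattice_simplex (R : realType) (d : nat) (P : set 'rV[R]_d) :
    Prop :=
  is_lattice_polytope P /\ is_simplex P.

Definition unimod_equiv (R : realType) (d : nat) (P Q : set 'rV[R]_d) : Prop :=
  exists (U : 'M[int]_d) (w : 'rV[int]_d),
    U \in unitmx /\ Q = [set x *m map_mx intr U + int_point R w | x in P].

(* L_P(m), the number of integer points of mP. *)
Definition ehrhart (R : realType) (d : nat) (P : set 'rV[R]_d) (m : nat) : nat :=
  #|` fset_set [set z : 'rV[int]_d | dilate m%:R P (int_point R z)] |.

(* Coefficients of the Ehrhart series: the constant term is 1 by convention. *)
Definition ehrhart_coef (R : realType) (d : nat) (P : set 'rV[R]_d) (m : nat) :
    nat :=
  if m is 0 then 1 else ehrhart P m.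

(* The coefficientwise form of the identity of formal power series
   h(t) = (1 - t)^(d+1) * (1 + sum_(m >= 1) L_P(m) t^m). *)
Definition is_hstar (R : realType) (d : nat) (P : set 'rV[R]_d)
    (h : {poly int}) : Prop :=
  (size h <= d.+1)%N /\
  forall n : nat,
    h`_n = \sum_(i < n.+1)
             ((1 - 'X) ^+ d.+1 : {poly int})`_i * (ehrhart_coef P (n - i))%:Z.

Definition Pyr (R : realType) (d : nat) (P : set 'rV[R]_d) :
    set 'rV[R]_(d + 1) :=
  conv_hull ([set row_mx x (0 : 'rV[R]_1) | x in P] `|`
             [set row_mx (0 : 'rV[R]_d) (const_mx 1 : 'rV[R]_1)]).

Inductive iterated_pyramid (R : realType) :
    forall d : nat, set 'rV[R]_d -> Prop :=
| IterPyr1 (d : nat) (P : set 'rV[R]_d) :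
    is_lattice_polytope P -> iterated_pyramid (Pyr P)
| IterPyrS (d : nat) (P : set 'rV[R]_d) :
    iterated_pyramid P -> iterated_pyramid (Pyr P).

Definition is_lattice_pyramid (R : realType) (d : nat) (P : set 'rV[R]_d) :
    Prop :=
  exists2 Q : set 'rV[R]_d, iterated_pyramid Q & unimod_equiv Q P.

Definition dual_polytope (R : realType) (d : nat) (P : set 'rV[R]_d) :
    set 'rV[R]_d :=
  [set y | forall x, P x -> \sum_i x 0 i * y 0 i <= 1].

Definition is_reflexive (R : realType) (d : nat) (P : set 'rV[R]_d) : Prop :=
  [/\ is_lattice_polytope P, interior P 0
    & is_lattice_polytope (dual_polytope P)].

Definition is_gorenstein (R : realType) (d : nat) (P : set 'rV[R]_d) : Prop :=
  exists (r : nat) (Q : set 'rV[R]_d),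
    [/\ (0 < r)%N, is_reflexive Q & unimod_equiv (dilate r%:R P) Q].

(* 1 + t^k + t^(2k) + ... + t^((v-1)k) *)
Definition hpoly (v k : nat) : {poly int} := \sum_(i < v) 'X^(i * k).

Definition admissible (R : realType) (v k d : nat) (P : set 'rV[R]_d) : Prop :=
  [/\ is_lattice_simplex P, is_gorenstein P, ~ is_lattice_pyramid P
    & is_hstar P (hpoly v k)].

(* All dimensions are collected in one sigma type; N(v, k) is the cardinality
   of the set gorenstein_classes R v k. *)
Definition unimod_class (R : realType) (d : nat) (P : set 'rV[R]_d) :
    set {e : nat & set 'rV[R]_e} :=
  [set existT (fun e : nat => set 'rV[R]_e) d Q | Q in unimod_equiv P].

Definition gorenstein_classes (R : realType) (v k : nat) :
    set (set {e : nat & set 'rV[R]_e}) :=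
  [set C | exists (d : nat) (P : set 'rV[R]_d),
             admissible v k P /\ C = unimod_class P].
Arguments gorenstein_classes : clear implicits.

(* The divisor lattice D_v; its order is divisibility of the values. *)
Definition divlat (v : nat) : finType := seq_sub (divisors v).

Definition divlat_le (v : nat) (a b : divlat v) : bool := (ssval a %| ssval b)%N.

Definition is_strict_chain (v s : nat) (M : {ffun 'I_s.+1 -> divlat v}) : bool :=
  [&& ssval (M ord0) == 1%N,
      ssval (M ord_max) == v
    & [forall i : 'I_s,
         divlat_le (M (widen_ord (leqnSn s) i)) (M (lift ord0 i)) &&
         (M (widen_ord (leqnSn s) i) != M (lift ord0 i))]].

Definition num_chains (v s : nat) : nat :=
  #|[pred M : {ffun 'I_s.+1 -> divlat v} | is_strict_chain M]|.

Definition divlat_iso (v v' : nat) : Prop :=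
  exists2 f : divlat v -> divlat v', bijective f &
    forall a b, divlat_le (f a) (f b) = divlat_le a b.

(* Main.v *)
Require Import Defs.
From HB Require Import structures.
From mathcomp Require Import all_boot all_order all_algebra.
From mathcomp Require Import finmap.
From mathcomp Require Import all_classical all_reals all_analysis.
From mathcomp Require Import perm ring lra zify.

(** Write a lattice point of the cone over a lattice simplex with [d + 1] vertices
    in barycentric coordinates. Modulo 1 these vectors form a finite subgroup [G]
    of [(R / Z) ^ (d + 1)], represented in the box [[0, 1) ^ (d + 1)], and the sum
    of the coordinates of a box point is an integer, its height. The group
    determines the simplex up to equivalence and order of the vertices
    ([lattice_matrix_unimodular]); the coefficient of [t ^ m] in the h*-polynomial
    is the number of box points of height [m] ([hstar_coef]); and the simplex is a
    lattice pyramid exactly if some coordinate vanishes on [G]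
    ([pyramid_integral_column], [integral_column_pyramid]). It remains to find the
    groups of order [v] without a vanishing coordinate whose heights are
    [0, k, ..., (v - 1) k], each attained once. Number their elements by height.

    Reduction modulo 1 can only lower heights, so the index of a sum is at most the
    sum of the indices, with equality only if no coordinate carries. Suppose that
    the elements below [u] form a subgroup, and that [u] has order [m] modulo it.
    The elements [a u + g] with [a < m] and [g < u] are distinct, and their heights
    are at most those that the notation suggests; hence the bound is attained and
    the elements below [m u] form a subgroup again ([closed_below_step]). The
    subgroups so obtained give a divisor chain [1 = M 0 < ... < M s = v]. The
    absence of carries leaves a coordinate only two possible values at [M r], zero
    or the inverse of the order of its image on the next subgroup ([column_val]).
    Consequently two coordinates that are first nonzero at the same [M j] agree;
    they form the block [j]. If [x j] denotes the coordinates in this block, then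
    modulo 1 the multiple [(M (j + 1) / M j) x j] is [x (p j)] for a block
    [p j > j], or zero, in which case [p j] is defined to be [s]
    ([column_parent]). The chain and the parent function [p] are the code of the
    simplex ([box_system_code]).

    The code determines the coordinates as functions on [G] ([colv]), the heights
    determine how often each of them occurs ([card_block]), and the set of these
    functions gives the code back ([code_unique]). Conversely, the relations
    between [x j] and [x (p j)], together with equality in each block, define a
    group for every code. The integral parts of the relations are the digits of
    the index in the mixed radix system of the chain ([block_box_family]), and an
    explicit integral matrix realizes the group by a simplex ([code_realization]).
    This simplex is Gorenstein because one of its lattice points has coordinates
    [1 / q i] where [q i] is the order of the [i]-th coordinate on [G]
    ([gorenstein_of_inverse_coordinates]). Hence the classes correspond to the
    codes. As the block [j] can choose its parent among [s - j] values, a chain of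
    length [s] carries [s!] parent functions ([card_parents]), and the number of
    chains depends on the order of the divisor lattice alone
    ([num_chains_iso]). *)

Set Implicit Arguments.
Unset Strict Implicit.
Unset Printing Implicit Defensive.

Import Order.TTheory GRing.Theory Num.Theory.
Import numFieldNormedType.Exports.

(** * Divisor chains with a parent function *)

Section CodeArithmetic.
Local Open Scope nat_scope.

(** The functions only matter up to [s]; the index [s] is the root of the tree
    defined by the parent function [p], and the indices below it are the blocks. *)
Definition is_code (v s : nat) (M p : nat -> nat) : Prop :=
  [/\ M 0 = 1, M s = v,
      forall j, j < s -> (M j %| M j.+1) /\ M j < M j.+1
    & forall j, j < s -> j < p j <= s].

Definition radix (M : nat -> nat) (j : nat) : nat := M j.+1 %/ M j.

(** The digits of [N] in the mixed radix system with place values [M j]. *)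
Definition digit (M : nat -> nat) (j N : nat) : nat := (N %% M j.+1) %/ M j.

Variables (v s : nat) (M p : nat -> nat).
Hypothesis code : is_code v s M p.

Lemma code_M_gt0 j : j <= s -> 0 < M j.
Proof.
case: code => M0 _ step _.
by case: j => [_|j js]; [rewrite M0|have [_] := step j js; apply: leq_trans].
Qed.

Lemma code_MS j : j < s -> M j.+1 = radix M j * M j.
Proof. by case: code => _ _ step _ js; rewrite divnK //; case: (step j js). Qed.

Lemma code_radix_gt1 j : j < s -> 1 < radix M j.
Proof.
move=> js; have [_ _ /(_ j js) [_ lt] _] := code.
by move: lt; rewrite code_MS // -{1}(mul1n (M j)) ltn_pmul2r // code_M_gt0 // ltnW.
Qed.

Lemma code_M_dvd i j : i <= j -> j <= s -> M i %| M j.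
Proof.
case: code => _ _ step _; elim: j => [|j IH]; first by rewrite leqn0 => /eqP ->.
rewrite leq_eqVlt => /orP[/eqP -> //|ij] js.
by apply: dvdn_trans (IH ij (ltnW js)) _; case: (step j js).
Qed.

Lemma code_M_le i j : i <= j -> j <= s -> M i <= M j.
Proof. by move=> ij js; apply: dvdn_leq; [apply: code_M_gt0|apply: code_M_dvd]. Qed.

Lemma code_M_lt i j : i < j -> j <= s -> M i < M j.
Proof.
move=> ij js; apply: leq_trans (code_M_le ij js).
by case: code => _ _ /(_ i (leq_trans ij js)) [].
Qed.

Lemma digit_lt j N : j < s -> digit M j N < radix M j.
Proof.
move=> js; rewrite ltn_divLR; last by rewrite code_M_gt0 // ltnW.
by rewrite -code_MS // ltn_mod code_M_gt0.
Qed.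

Lemma sum_digits r N : r <= s -> \sum_(j < r) digit M j N * M j = N %% M r.
Proof.
elim: r => [_|r IH rs]; first by case: code => -> *; rewrite big_ord0 modn1.
rewrite big_ord_recr /= IH 1?ltnW // [RHS](divn_eq _ (M r)) addnC.
by rewrite modn_dvdm // code_M_dvd.
Qed.

Lemma mixed_radix_lt (d : nat -> nat) r :
  r <= s -> (forall l, l < r -> d l < radix M l) ->
  \sum_(l < r) d l * M l < M r.
Proof.
elim: r => [|r IH] rs dlt; first by rewrite big_ord0 code_M_gt0.
rewrite big_ord_recr /= code_MS //.
apply: (@leq_trans (M r + d r * M r)).
  by rewrite ltn_add2r IH // 1?ltnW // => l lr; apply: dlt; apply: ltnW.
by rewrite -mulSn leq_mul2r dlt ?orbT.
Qed.

Lemma digit_mixed_radix (d : nat -> nat) j :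
  (forall l, l < s -> d l < radix M l) -> j < s ->
  digit M j (\sum_(l < s) d l * M l) = d j.
Proof.
move=> dlt js; have Mj0 : 0 < M j by rewrite code_M_gt0 // ltnW.
have trunc r : j < r -> r <= s ->
    \sum_(l < r) d l * M l = \sum_(l < j.+1) d l * M l %[mod M j.+1].
  elim: r => // r IH; rewrite ltnS leq_eqVlt => /orP[/eqP -> //|jr] rs.
  rewrite big_ord_recr /= -modnDmr.
  have /eqP -> : M j.+1 %| d r * M r by rewrite dvdn_mull // code_M_dvd // ltnW.
  by rewrite addn0 IH // ltnW.
rewrite /digit trunc // modn_small; last first.
  by apply: mixed_radix_lt => // l lj; apply: dlt; apply: leq_trans lj js.
rewrite big_ord_recr /= addnC divnMDl // divn_small ?addn0 //.
apply: mixed_radix_lt => [|l lj]; first exact: ltnW.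
by apply: dlt; apply: ltn_trans lj js.
Qed.

Lemma sum_M_lt j : j <= s -> \sum_(l < j) M l < M j.
Proof.
elim: j => [|j IH] js; first by rewrite big_ord0 code_M_gt0.
have := code_radix_gt1 js; have := IH (ltnW js).
rewrite big_ord_recr /= (code_MS js); nia.
Qed.

(** Children precede their parent and place values at least double. *)
Lemma parent_sum_lt j : j < s -> \sum_(l < s | p l == j) M l < M j.
Proof.
move=> js; apply: leq_ltn_trans (sum_M_lt (ltnW js)).
rewrite -(big_mkord (fun l => p l == j)) -(big_mkord xpredT).
rewrite (big_cat_nat (n := j)) ?(ltnW js) //=.
rewrite [X in _ + X]big_nat_cond [X in _ + X]big_pred0 ?addn0.
  rewrite [leqLHS]big_mkcond; apply: leq_sum => l _; by case: ifP.
move=> l; apply/negP => /andP[/andP[jl ls] /eqP pl].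
by case: code => _ _ _ /(_ l ls); rewrite pl ltnNge jl.
Qed.

Lemma parent_gt j : j < s -> j < p j.
Proof. by case: code => _ _ _ /[apply] /andP[]. Qed.

Lemma parent_le j : j < s -> p j <= s.
Proof. by case: code => _ _ _ /[apply] /andP[]. Qed.

Lemma parent_ind (P : nat -> Prop) :
  P s -> (forall j, j < s -> P (p j) -> P j) -> forall j, j <= s -> P j.
Proof.
move=> Ps PS j; have [n] := ubnP (s - j); elim: n j => // n IH j jn js.
move: (js); rewrite leq_eqVlt => /orP[/eqP -> //|jlt].
apply: PS => //; apply: IH; last exact: parent_le.
by have := parent_gt jlt; have := parent_le jlt; lia.
Qed.

(** Recursion from the root downwards. A parent is larger than its child, so [s]
    unfoldings reach the root. *)
Fixpoint root_fold_rec (T : Type) (x0 : T) (step : nat -> T -> T) (fuel j : nat) : T :=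
  if fuel is f.+1 then
    if j < s then step j (root_fold_rec x0 step f (p j)) else x0
  else x0.

Definition root_fold (T : Type) (x0 : T) (step : nat -> T -> T) (j : nat) : T :=
  root_fold_rec x0 step s j.

Lemma root_fold_root (T : Type) (x0 : T) (step : nat -> T -> T) :
  root_fold x0 step s = x0.
Proof. by rewrite /root_fold; case: {1}s => //= f; rewrite ltnn. Qed.

Lemma root_fold_step (T : Type) (x0 : T) (step : nat -> T -> T) j :
  j < s -> root_fold x0 step j = step j (root_fold x0 step (p j)).
Proof.
have fuel f f' i : s - i <= f -> s - i <= f' ->
    root_fold_rec x0 step f i = root_fold_rec x0 step f' i.
  elim: f f' i => [|f IH] [|f'] i //=.
  - by move=> ? _; case: ifP => // ?; lia.
  - by move=> _ ?; case: ifP => // ?; lia.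
  move=> h h'; case: ifP => // si; congr (step _ _).
  by apply: IH; have := parent_gt si; lia.
move=> js; rewrite /root_fold.
rewrite (fuel s s.+1 j) ?leq_subr //=; last by lia.
by rewrite js.
Qed.

End CodeArithmetic.

Section Columns.
Local Open Scope ring_scope.
Variable R : realFieldType.

(** The value at the [N]-th box point of the coordinates in the [j]-th block. *)
Definition colv s M p j N : R :=
  root_fold s p 0 (fun l x => ((digit M l N)%:R + x) / (radix M l)%:R) j.

(** The number of coordinates in the [j]-th block; it is forced by the heights
    of the box points. *)
Definition block_size (k s : nat) (M p : nat -> nat) (j : nat) : nat :=
  (k * (M j.+1 - \sum_(l < s | p l == j) M l))%N.

Variables (v s : nat) (M p : nat -> nat).
Hypothesis code : is_code v s M p.

Lemma colv_root N : colv s M p s N = 0.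
Proof. exact: root_fold_root. Qed.

Lemma colv_step j N : (j < s)%N ->
  colv s M p j N = ((digit M j N)%:R + colv s M p (p j) N) / (radix M j)%:R.
Proof. by move=> js; rewrite /colv (root_fold_step code). Qed.

Lemma radix_gt0 j : (j < s)%N -> 0 < (radix M j)%:R :> R.
Proof. by move=> js; rewrite ltr0n; have := code_radix_gt1 code js; lia. Qed.

Lemma radix_neq0 j : (j < s)%N -> (radix M j)%:R != 0 :> R.
Proof. by move=> js; rewrite gt_eqF // radix_gt0. Qed.

Lemma radix_colv j N : (j < s)%N ->
  (radix M j)%:R * colv s M p j N = (digit M j N)%:R + colv s M p (p j) N.
Proof. by move=> js; rewrite (colv_step _ js) mulrC divfK // radix_neq0. Qed.

Lemma colv_bound j N : (j <= s)%N -> 0 <= colv s M p j N < 1.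
Proof.
elim/(parent_ind code): j / => [|j js /andP[c0 c1]]; first by rewrite colv_root lexx ltr01.
rewrite (colv_step _ js) divr_ge0 ?addr_ge0 ?ler0n //=.
rewrite ltr_pdivrMr ?radix_gt0 // mul1r.
have : ((digit M j N)%:R + 1 <= (radix M j)%:R :> R).
  by rewrite natr1 ler_nat (digit_lt code).
by move: c1; lra.
Qed.

Lemma digit_small j N : (N < M j)%N -> digit M j N = 0%N.
Proof.
by move=> Nj; rewrite /digit divn_small //; apply: leq_ltn_trans (leq_mod _ _) Nj.
Qed.

Lemma colv_eq0 j N : (j <= s)%N -> (N < M j)%N -> colv s M p j N = 0.
Proof.
move=> js; elim/(parent_ind code): j / js => [|j js IH] Nj; first by rewrite colv_root.
rewrite (colv_step _ js) digit_small // IH ?addr0 ?mul0r //.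
by apply: leq_trans Nj _; apply: (code_M_le code (ltnW (parent_gt code js)) (parent_le code js)).
Qed.

Lemma colv_M j : (j < s)%N -> colv s M p j (M j) = (radix M j)%:R^-1.
Proof.
move=> js; rewrite (colv_step _ js) colv_eq0 ?(parent_le code) //; last first.
  exact: (code_M_lt code (parent_gt code js) (parent_le code js)).
have lt : (M j < M j.+1)%N by apply: (code_M_lt code).
rewrite /digit modn_small // divnn (code_M_gt0 code (ltnW js)).
by rewrite addr0 mul1r.
Qed.

Lemma colv_M_neq0 j : (j < s)%N -> colv s M p j (M j) != 0.
Proof. by move=> js; rewrite colv_M // invr_eq0 radix_neq0. Qed.

(** The relations between children and parents determine all values from the root
    downwards. *)
Lemma colv_of_digits (x : nat -> R) (d : nat -> nat) :
  x s = 0 -> (forall j, (j < s)%N -> (d j < radix M j)%N) ->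
  (forall j, (j < s)%N -> (radix M j)%:R * x j = (d j)%:R + x (p j)) ->
  forall j, (j <= s)%N ->
  colv s M p j (\sum_(l < s) d l * M l)%N = x j.
Proof.
move=> xs dlt rel j js.
elim/(parent_ind code): j / js => [|j js IH]; first by rewrite colv_root xs.
rewrite (colv_step _ js) IH (digit_mixed_radix code) // -rel //.
by rewrite mulrC mulKf // radix_neq0.
Qed.

Lemma block_size_ge k j : (j < s)%N -> (2 * k <= block_size k s M p j)%N.
Proof.
move=> js; rewrite mulnC leq_mul2l; apply/orP; right.
have := code_MS code js; have := code_radix_gt1 code js.
by have := parent_sum_lt code js; have := code_M_gt0 code (ltnW js); nia.
Qed.

(** The block sizes are chosen so that the telescoping sum over children
    leaves the positional value of the digits. *)
Lemma sum_block_colv k N : (N < v)%N ->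
  \sum_(j < s) (block_size k s M p j)%:R * colv s M p j N = (k * N)%:R.
Proof.
move=> Nv; have Ms : M s = v by case: code.
have Nsum : N = (\sum_(j < s) digit M j N * M j)%N.
  by rewrite (sum_digits code) // modn_small // Ms.
rewrite [in RHS]Nsum natrM natr_sum mulr_sumr.
have szE j : (j < s)%N -> (block_size k s M p j)%:R =
    k%:R * ((M j.+1)%:R - \sum_(l < s | p l == j) (M l)%:R) :> R.
  move=> js; rewrite natrM natrB ?natr_sum //.
  have := parent_sum_lt code js; have := code_MS code js.
  by have := code_radix_gt1 code js; nia.
transitivity (\sum_(j < s) (k%:R * ((M j.+1)%:R * colv s M p j N)) -
   \sum_(j < s) \sum_(l < s | p l == j) k%:R * ((M l)%:R * colv s M p (p l) N)).
  rewrite -sumrB; apply: eq_bigr => j _.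
  rewrite szE // mulrBr mulrBl mulrA; congr (_ - _).
  rewrite mulr_sumr mulr_suml; apply: eq_bigr => l /eqP ->.
  by rewrite mulrA.
rewrite (exchange_big_dep xpredT) //= -sumrB; apply: eq_bigr => j _.
have js := ltn_ord j.
have -> : \sum_(i < s | p j == i) k%:R * ((M j)%:R * colv s M p (p j) N) =
    k%:R * ((M j)%:R * colv s M p (p j) N).
  have := parent_le code js; rewrite leq_eqVlt => /orP[/eqP ->|pj].
    by rewrite colv_root !mulr0 big1.
  by rewrite (big_pred1 (Ordinal pj)).
rewrite (code_MS code js) !natrM -!mulrBr; congr (_ * _).
by rewrite [_%:R * (M j)%:R]mulrC -mulrA radix_colv //; ring.
Qed.

End Columns.

Section CodeUniqueness.
Local Open Scope ring_scope.
Variables (R : realFieldType) (v s s' : nat) (M p M' p' : nat -> nat).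
Hypotheses (code : is_code v s M p) (code' : is_code v s' M' p').
Hypothesis sub : forall j, (j < s)%N -> exists2 j', (j' < s')%N &
  forall N, (N < v)%N -> colv R s M p j N = colv R s' M' p' j' N.

(** A column vanishes below its place value and not at it. *)
Lemma colv_eq_M j j' : (j < s)%N -> (j' < s')%N ->
  (forall N, (N < v)%N -> colv R s M p j N = colv R s' M' p' j' N) -> M j = M' j'.
Proof.
move=> js js' eqc.
have Mv : (M j < v)%N.
  by case: (code) => _ <- _ _; apply: (code_M_lt code).
have Mv' : (M' j' < v)%N.
  by case: (code') => _ <- _ _; apply: (code_M_lt code').
case: (ltngtP (M j) (M' j')) => // lt.
- have := colv_M_neq0 R code js; rewrite eqc // (colv_eq0 _ code') ?eqxx //.
  exact: ltnW.
- have := colv_M_neq0 R code' js'; rewrite -eqc // (colv_eq0 _ code) ?eqxx //.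
  exact: ltnW.
Qed.

Lemma code_M_sub j : (j < s)%N -> exists2 j', (j' < s')%N & M j = M' j'.
Proof.
by move=> js; have [j' js' e] := sub js; exists j' => //; apply: colv_eq_M.
Qed.

End CodeUniqueness.

Section CodeFromColumns.
Local Open Scope ring_scope.

Lemma code_sorted v s M p : is_code v s M p ->
  sorted ltn [seq M j | j <- iota 0 s].
Proof.
move=> code; apply/(sortedP 0%N) => i; rewrite size_map size_iota => is'.
rewrite !(nth_map 0%N) ?size_iota ?nth_iota //; try exact: ltnW.
by rewrite !add0n; apply: (code_M_lt code (ltnSn i)); apply: ltnW.
Qed.

(** The smallest index at which the [j]-th column does not vanish is [M j], and
    the fractional part of [radix M j] times this column is the column of its
    parent, so the set of columns remembers the chain and the parent function. *)
Lemma code_unique (R : realFieldType) v s s' M p M' p' :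
  is_code v s M p -> is_code v s' M' p' ->
  (forall j, (j < s)%N -> exists2 j', (j' < s')%N &
     forall N, (N < v)%N -> colv R s M p j N = colv R s' M' p' j' N) ->
  (forall j', (j' < s')%N -> exists2 j, (j < s)%N &
     forall N, (N < v)%N -> colv R s' M' p' j' N = colv R s M p j N) ->
  [/\ s = s', forall j, (j <= s)%N -> M j = M' j
    & forall j, (j < s)%N -> p j = p' j].
Proof.
move=> code code' sub sub'.
have eqM : [seq M j | j <- iota 0 s] = [seq M' j | j <- iota 0 s'].
  apply: (irr_sorted_eq ltn_trans ltnn (code_sorted code) (code_sorted code')).
  move=> x; apply/mapP/mapP => -[j]; rewrite mem_iota add0n => /= js ->.
    have [j' js' e] := code_M_sub code code' sub js.
    by exists j' => //; rewrite mem_iota.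
  have [j' js' e] := code_M_sub code' code sub' js.
  by exists j' => //; rewrite mem_iota.
have es : s = s' by have := congr1 size eqM; rewrite !size_map !size_iota.
subst s'.
have eM j : (j < s)%N -> M j = M' j.
  move=> js; have := congr1 (fun t => nth 0%N t j) eqM.
  by rewrite !(nth_map 0%N) ?size_iota // !nth_iota.
have eM' j : (j <= s)%N -> M j = M' j.
  rewrite leq_eqVlt => /orP[/eqP ->|]; last exact: eM.
  by case: code => _ -> _ _; case: code' => _ -> _ _.
have ecol j N : (j < s)%N -> (N < v)%N -> colv R s M p j N = colv R s M' p' j N.
  move=> js Nv; have [j' js' e] := sub j js; rewrite e //.
  have := colv_eq_M code code' js js' e; rewrite (eM j js) => MM.
  have [jj|jj|->//] := ltngtP j j'.
    by have := code_M_lt code' jj (ltnW js'); rewrite MM ltnn.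
  by have := code_M_lt code' jj (ltnW js); rewrite MM ltnn.
split=> // j js.
have pcol N : (N < v)%N -> colv R s M p (p j) N = colv R s M' p' (p' j) N.
  move=> Nv; have h := radix_colv R code N js; have h' := radix_colv R code' N js.
  move: h h'; rewrite /radix /digit -!eM' ?(ltnW js) // -ecol // => -> /addrI.
  by [].
have := parent_le code js; rewrite leq_eqVlt => /orP[/eqP pj|pj];
  have := parent_le code' js; rewrite leq_eqVlt => /orP[/eqP pj'|pj'].
- by rewrite pj pj'.
- have := colv_M_neq0 R code' pj'; rewrite -pcol ?pj ?colv_root ?eqxx //.
  by have [_ <- _ _] := code'; apply: (code_M_lt code').
- have := colv_M_neq0 R code pj; rewrite pcol ?pj' ?colv_root ?eqxx //.
  by have [_ <- _ _] := code; apply: (code_M_lt code).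
have := colv_eq_M code code' pj pj' pcol; rewrite (eM _ pj) => MM.
have [jj|jj|//] := ltngtP (p j) (p' j).
  by have := code_M_lt code' jj (ltnW pj'); rewrite MM ltnn.
by have := code_M_lt code' jj (ltnW pj); rewrite MM ltnn.
Qed.

End CodeFromColumns.

(** * The chain of subgroups of a box system *)

Section IntegerAux.
Local Open Scope ring_scope.
Variable R : realType.

Lemma int_num_eq0 (x : R) : x \is a Num.int -> -1 < x < 1 -> x = 0.
Proof.
move=> /intrP[z ->]; rewrite -[-1]/((-1)%:~R) -[1]/(1%:~R) !ltr_int => zb.
by have -> : z = 0 by lia.
Qed.

Lemma int_num_ge0 (x : R) : x \is a Num.int -> -1 < x -> 0 <= x.
Proof.
move=> /intrP[z ->]; rewrite -[-1]/((-1)%:~R) -[0]/(0%:~R) ltr_int ler_int; lia.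
Qed.

Lemma nat_num_int n : (n%:R : R) \is a Num.int.
Proof. exact: rpred_nat. Qed.

End IntegerAux.

Section BoxSystem.
Local Open Scope ring_scope.
Variables (R : realType) (v k n : nat) (F : nat -> 'I_n -> R).
(* [op N N'] is the index of the box point congruent to the sum of the points
   with indices [N] and [N']. *)
Variable op : nat -> nat -> nat.
Hypothesis k_gt0 : (0 < k)%N.
Hypothesis F_bound : forall N i, (N < v)%N -> 0 <= F N i < 1.
Hypothesis F_height : forall N, (N < v)%N -> \sum_i F N i = (k * N)%:R.
Hypothesis op_lt : forall N N', (N < v)%N -> (N' < v)%N -> (op N N' < v)%N.
Hypothesis op_congr : forall N N' i, (N < v)%N -> (N' < v)%N ->
  F N i + F N' i - F (op N N') i \is a Num.int.

(** Congruent points of the unit box coincide, and the height determines the index. *)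
Lemma box_inj N N' : (N < v)%N -> (N' < v)%N ->
  (forall i, F N i - F N' i \is a Num.int) -> N = N'.
Proof.
move=> Nv Nv' h; have e i : F N i = F N' i.
  apply/eqP; rewrite -subr_eq0; apply/eqP/int_num_eq0 => //.
  by have := F_bound i Nv; have := F_bound i Nv'; lra.
have := F_height Nv; rewrite (eq_bigr _ (fun i _ => e i)) F_height // => /eqP.
by rewrite eqr_nat eqn_pmul2l // => /eqP.
Qed.

Lemma op_carry N N' i : (N < v)%N -> (N' < v)%N ->
  F (op N N') i <= F N i + F N' i.
Proof.
move=> Nv Nv'; rewrite -subr_ge0; apply: int_num_ge0; first exact: op_congr.
have := F_bound i Nv; have := F_bound i Nv'; have := F_bound i (op_lt Nv Nv').
by lra.
Qed.

(** Reducing coordinates modulo 1 can only lower the height. *)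
Lemma op_le N N' : (N < v)%N -> (N' < v)%N -> (op N N' <= N + N')%N.
Proof.
move=> Nv Nv'; rewrite -(leq_pmul2l k_gt0) -(ler_nat R) mulnDr natrD.
rewrite -!F_height ?op_lt // -big_split /=.
by apply: ler_sum => i _; apply: op_carry.
Qed.

(** A carry in any coordinate would lower the height. *)
Lemma op_no_carry N N' i : (N < v)%N -> (N' < v)%N -> op N N' = (N + N')%N ->
  F (N + N')%N i = F N i + F N' i.
Proof.
move=> Nv Nv' e; have ov := op_lt Nv Nv'.
have /eqP : \sum_i (F N i + F N' i - F (op N N') i) = 0.
  by rewrite sumrB big_split /= !F_height // e mulnDr natrD subrr.
rewrite psumr_eq0; last by move=> l _; rewrite subr_ge0 op_carry.
by move=> /allP /(_ i (mem_index_enum _)); rewrite /= subr_eq0 e => /eqP.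
Qed.

Lemma box_zero i : (0 < v)%N -> F 0%N i = 0.
Proof.
move=> v0; have /eqP := F_height v0; rewrite muln0 psumr_eq0; last first.
  by move=> l _; case/andP: (F_bound l v0).
by move=> /allP /(_ i (mem_index_enum _)) /eqP.
Qed.

(** The first [u] elements form a subgroup: in a finite group closure under
    addition is enough. *)
Definition closed_below u :=
  forall N N', (N < u)%N -> (N' < u)%N -> (op N N' < u)%N.

(** Adding [g] is injective, hence a permutation of the subgroup. *)
Lemma closed_below_divide u g g' : (u <= v)%N -> closed_below u ->
  (g < u)%N -> (g' < u)%N -> exists2 h, (h < u)%N & op g h = g'.
Proof.
move=> uv cu gu gu'.
pose f (x : 'I_u) : 'I_u := Ordinal (cu g x gu (ltn_ord x)).
have f_inj : injective f.
  move=> x x' /(congr1 val) /= e; apply: val_inj => /=.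
  have gv := leq_trans gu uv; have xv := leq_trans (ltn_ord x) uv.
  have xv' := leq_trans (ltn_ord x') uv.
  apply: box_inj => // i.
  have -> : F x i - F x' i = (F g i + F x i - F (op g x) i)
      - (F g i + F x' i - F (op g x') i) by rewrite e; ring.
  by rewrite rpredB ?op_congr.
have /injF_bij[f' _ ff'] := f_inj.
exists (f' (Ordinal gu')); first exact: ltn_ord.
exact: (congr1 val (ff' (Ordinal gu'))).
Qed.

(** Let [0, u) be a subgroup.  The coset representatives a u + g have height at
    most k (a u + g); as distinct elements have distinct heights, this bound is
    attained, so no carry occurs below the order of u modulo the subgroup. *)
Lemma closed_below_step u : (0 < u)%N -> (u < v)%N -> closed_below u ->
  exists m y, [/\ (1 < m)%N /\ (m * u <= v)%N, (y < u)%N, closed_below (m * u),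
    (forall a g i, (a < m)%N -> (g < u)%N ->
       F (a * u + g)%N i = a%:R * F u i + F g i)
    & forall i, m%:R * F u i - F y i \is a Num.int].
Proof.
move=> u0 uv cu; have v0 : (0 < v)%N by apply: leq_ltn_trans uv.
pose P a := (a * u + u <= v)%N /\ forall g i, (g < u)%N ->
  F (a * u + g)%N i = a%:R * F u i + F g i.
have P0 : P 0%N.
  by split=> [|g i gu]; rewrite mul0n add0n ?(ltnW uv) // mul0r add0r.
have Pmul a i : P a -> F (a * u)%N i = a%:R * F u i.
  by case=> _ /(_ 0%N i u0); rewrite addn0 box_zero // addr0.
have Plt a : P a -> (a * u < v)%N by case=> h _; lia.
have PS a : (forall a', (a' <= a)%N -> P a') -> (u <= op (a * u) u)%N -> P a.+1.
  move=> Pa; set t := op _ _ => ut.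
  have Paa := Pa a (leqnn a); have auv := Plt a Paa.
  have tle : (t <= a.+1 * u)%N by rewrite mulSn addnC op_le.
  have tv : (t < v)%N by apply: op_lt.
  (* A smaller index would make a nonzero multiple of [u] congruent to an
     element of the subgroup. *)
  have tE : t = (a.+1 * u)%N.
    apply/eqP; rewrite eqn_leq tle /= leqNgt; apply/negP => tlt.
    have a'a : (t %/ u <= a)%N by rewrite -ltnS ltn_divLR.
    have a'0 : (0 < t %/ u)%N by rewrite divn_gt0.
    have gu : (t %% u < u)%N by rewrite ltn_mod.
    pose b := (a.+1 - t %/ u)%N.
    have Pb : P b by apply: Pa; rewrite /b; lia.
    have : (b * u = t %% u)%N.
      apply: box_inj => [||i]; [exact: Plt|exact: ltn_trans gu uv|].
      rewrite Pmul // /b natrB; last by lia.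
      have /= := op_congr i auv uv; rewrite -/t {1}(divn_eq t u).
      have [_ ->] // := Pa _ a'a; rewrite Pmul //.
      by apply: etrans; congr (_ \is a Num.int); rewrite -natr1; ring.
    have : (0 < b)%N by rewrite /b; lia.
    by move=> b0 bg; have := leq_pmull u b0; rewrite bg leqNgt gu.
  have Ft i : F t i = a.+1%:R * F u i.
    have e : t = (a * u + u)%N by rewrite tE mulSn addnC.
    by rewrite [in LHS]e op_no_carry // Pmul // -natr1 mulrDl mul1r.
  have Pg g : (g < u)%N ->
      (t + g < v)%N /\ forall i, F (t + g)%N i = a.+1%:R * F u i + F g i.
    elim/ltn_ind: g => g IH gu; have gv := ltn_trans gu uv.
    have tgE : op t g = (t + g)%N.
      apply/eqP; rewrite eqn_leq op_le //= leqNgt; apply/negP => lt.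
      have [tt|tt] := ltnP (op t g) t.
        set t' := op t g in tt lt *.
        have a'a : (t' %/ u <= a)%N by rewrite -ltnS ltn_divLR // -tE.
        have gu' : (t' %% u < u)%N by rewrite ltn_mod.
        have [h hu hE] := closed_below_divide (ltnW uv) cu gu gu'.
        pose b := (a.+1 - t' %/ u)%N.
        have b0 : (0 < b)%N by rewrite /b; lia.
        have bv : (b * u < v)%N.
          by apply: leq_ltn_trans tv; rewrite tE leq_mul // leq_subr.
        have Fb i : F (b * u)%N i = b%:R * F u i.
          have : (b <= a.+1)%N by apply: leq_subr.
          rewrite leq_eqVlt => /orP[/eqP ->|ba]; first by rewrite -tE Ft.
          by apply: Pmul; apply: Pa.
        have : (b * u = h)%N.
          apply: box_inj => // [|i]; first exact: ltn_trans hu uv.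
          have h1 := op_congr i tv gv; have h2 := op_congr i gv (ltn_trans hu uv).
          move: h1; rewrite -/t' {1}(divn_eq t' u).
          have [_ ->] // := Pa _ a'a; rewrite Ft => h1.
          have := rpredB h1 h2; rewrite hE Fb /b natrB; last by lia.
          by apply: etrans; congr (_ \is a Num.int); ring.
        by move=> bh; have := leq_pmull u b0; rewrite bh leqNgt hu.
      have tE' : op t g = (t + (op t g - t))%N by lia.
      have [||_ FI] := IH (op t g - t)%N; [by lia|by lia|].
      suff : g = (op t g - t)%N by lia.
      apply: box_inj => // [|i]; first by lia.
      have := op_congr i tv gv; rewrite {1}tE' FI Ft.
      by apply: etrans; congr (_ \is a Num.int); ring.
    split=> [|i]; first by rewrite -tgE; apply: op_lt.
    by rewrite op_no_carry // Ft.
  split; last by move=> g i gu; rewrite -tE; case: (Pg g gu).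
  by have [|h _] := Pg u.-1; [lia|rewrite -tE; lia].
(* The indices are bounded by [v], so some multiple of [u] returns to the
   subgroup; [m] is the first one. *)
have [a0 Qa0] : exists a, (op (a * u) u < u)%N.
  apply: contrapT => noQ; have allP a : forall a', (a' <= a)%N -> P a'.
    elim: a => [|a IH] a'; first by rewrite leqn0 => /eqP ->.
    rewrite leq_eqVlt => /orP[/eqP ->|]; last exact: IH.
    apply: PS => //; rewrite leqNgt; apply/negP => Q; apply: noQ.
    by exists a.
  by have := Plt v (allP v v (leqnn v)); rewrite ltnNge leq_pmulr.
have exQ : exists a, (op (a * u) u < u)%N by exists a0.
have [a Qa amin] := ex_minnP exQ; clear a0 Qa0 exQ.
have Pa a' : (a' <= a)%N -> P a'.
  elim/ltn_ind: a' => -[//|a'] IH a'a.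
  apply: PS => [b ba'|]; first by apply: IH; lia.
  by rewrite leqNgt; apply/negP => /amin; lia.
have Paa := Pa a (leqnn a).
set y := op _ _ in Qa.
have yc i : a.+1%:R * F u i - F y i \is a Num.int.
  have := op_congr i (Plt a Paa) uv; rewrite -/y Pmul //.
  by apply: etrans; congr (_ \is a Num.int); rewrite -natr1; ring.
have muv : (a.+1 * u <= v)%N by case: Paa; rewrite mulSn addnC.
have addE a' g i : (a' < a.+1)%N -> (g < u)%N ->
    F (a' * u + g)%N i = a'%:R * F u i + F g i.
  by move=> a'a gu; case: (Pa a' a'a) => _ ->.
exists a.+1, y; split => //.
  split=> //; rewrite ltnS lt0n; apply/eqP => a0.
  have yE : y = u.
    apply: box_inj => // [|i]; first exact: ltn_trans Qa uv.
    have := yc i; rewrite a0 mul1r -rpredN.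
    by apply: etrans; congr (_ \is a Num.int); ring.
  by rewrite yE ltnn in Qa.
move=> N N' Nmu Nmu'.
have := divn_eq N u; have := divn_eq N' u.
set b := (N %/ u)%N; set g := (N %% u)%N; set b' := (N' %/ u)%N; set g' := (N' %% u)%N.
move=> NE' NE; have ba : (b < a.+1)%N by rewrite ltn_divLR.
have ba' : (b' < a.+1)%N by rewrite ltn_divLR.
have gu : (g < u)%N by rewrite ltn_mod.
have gu' : (g' < u)%N by rewrite ltn_mod.
have gv := ltn_trans gu uv; have gv' := ltn_trans gu' uv.
have Nv := leq_trans Nmu muv; have Nv' := leq_trans Nmu' muv.
pose g1 := op g g'; have g1u : (g1 < u)%N by apply: cu.
have g1v := ltn_trans g1u uv.
have opE T : (T < v)%N -> (forall i, F N i + F N' i - F T i \is a Num.int) ->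
    op N N' = T.
  move=> Tv h; apply: box_inj => // [|i]; first exact: op_lt.
  have := rpredB (h i) (op_congr i Nv Nv').
  by apply: etrans; congr (_ \is a Num.int); ring.
have lt_mu c h : (c < a.+1)%N -> (h < u)%N -> (c * u + h < a.+1 * u)%N.
  by move=> ca hu; apply: (@leq_trans (c.+1 * u)); [rewrite mulSn; lia|rewrite leq_mul2r ca orbT].
have [bb|bb] := ltnP (b + b')%N a.+1.
  rewrite (opE ((b + b') * u + g1)%N); first exact: lt_mu.
    by apply: leq_trans muv; apply: lt_mu.
  move=> i; have := op_congr i gv gv'; rewrite -/g1 NE NE' !addE // natrD.
  by apply: etrans; congr (_ \is a Num.int); ring.
have yv : (y < v)%N by apply: ltn_trans Qa uv.
have g2u : (op y g1 < u)%N by apply: cu.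
have cm : (b + b' - a.+1 < a.+1)%N by lia.
rewrite (opE ((b + b' - a.+1) * u + op y g1)%N); first exact: lt_mu.
  by apply: leq_trans muv; apply: lt_mu.
move=> i; have h1 := op_congr i gv gv'; have h2 := op_congr i yv g1v.
have := rpredD (rpredD h1 h2) (yc i); rewrite -/g1 NE NE' !addE // natrB // natrD.
by apply: etrans; congr (_ \is a Num.int); ring.
Qed.

(** The order of [u] modulo the subgroup is [u' %/ u], and [y] is the element of
    the subgroup congruent to that multiple of [u]. *)
Definition chain_step (u u' y : nat) : Prop :=
  [/\ (u %| u')%N /\ (u < u')%N, (y < u)%N,
    (forall a g i, (a < u' %/ u)%N -> (g < u)%N ->
       F (a * u + g)%N i = a%:R * F u i + F g i)
    & forall i, (u' %/ u)%:R * F u i - F y i \is a Num.int].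

Lemma box_chain_from u : (0 < u)%N -> (u <= v)%N -> closed_below u ->
  exists s (M y : nat -> nat), [/\ M 0%N = u, M s = v
    & forall r, (r < s)%N -> chain_step (M r) (M r.+1) (y r)].
Proof.
have [N] := ubnP (v - u); elim: N u => // N IH u uN u0 uv cu.
move: uv; rewrite leq_eqVlt => /orP[/eqP e|uv].
  by exists 0%N, (fun _ => u), (fun _ => 0%N); split.
have [m [y [[m1 muv] yu cmu addE yc]]] := closed_below_step u0 uv cu.
have um : (u < m * u)%N by rewrite -{1}(mul1n u) ltn_pmul2r.
have mu0 : (0 < m * u)%N by exact: ltn_trans um.
have muN : (v - m * u < N)%N by lia.
have [s [M [Y [M0 Ms step]]]] := IH _ muN mu0 muv cmu.
exists s.+1, (fun r => if r is r'.+1 then M r' else u),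
  (fun r => if r is r'.+1 then Y r' else y); split=> // -[|r] rs; last exact: step.
rewrite M0; split=> //; first by rewrite dvdn_mull.
- by move=> a g i; rewrite mulnK // => am gu; apply: addE.
- by move=> i; rewrite mulnK.
Qed.

Lemma box_chain : (0 < v)%N ->
  exists s (M y : nat -> nat), [/\ M 0%N = 1%N, M s = v
    & forall r, (r < s)%N -> chain_step (M r) (M r.+1) (y r)].
Proof.
move=> v0; apply: box_chain_from => // -[|//] [|//] _ _.
by have := op_le v0 v0; rewrite leqn0 => /eqP ->.
Qed.

End BoxSystem.

(** * The values of a single coordinate *)

Section ColumnAnalysis.
Local Open Scope ring_scope.
Variables (R : realType) (v s : nat) (M y : nat -> nat).
(* At this stage only the chain is known; [succn] is a default parent function. *)
Hypothesis code : is_code v s M succn.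
Hypothesis y_lt : forall r, (r < s)%N -> (y r < M r)%N.

(** A coordinate along a chain of subgroups with no carry below the orders;
    [y r] is congruent to [radix M r] times [M r]. *)
Definition column (f : nat -> R) : Prop :=
  [/\ f 0%N = 0, forall N, (N < v)%N -> 0 <= f N < 1,
      forall r a h, (r < s)%N -> (a < radix M r)%N -> (h < M r)%N ->
        f (a * M r + h)%N = a%:R * f (M r) + f h
    & forall r, (r < s)%N -> (radix M r)%:R * f (M r) - f (y r) \is a Num.int].

Lemma code_M_le_v r : (r <= s)%N -> (M r <= v)%N.
Proof. by move=> rs; have [_ <- _ _] := code; apply: (code_M_le code). Qed.

Lemma code_M_lt_v r : (r < s)%N -> (M r < v)%N.
Proof. by move=> rs; have [_ <- _ _] := code; apply: (code_M_lt code). Qed.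

Variable f : nat -> R.
Hypothesis f_col : column f.

Lemma column0 : f 0%N = 0. Proof. by case: f_col. Qed.

Lemma column_bound N : (N < v)%N -> 0 <= f N < 1.
Proof. by case: f_col => _ h _ _; apply: h. Qed.

Lemma columnD r N : (r < s)%N -> (N < M r.+1)%N ->
  f N = (N %/ M r)%:R * f (M r) + f (N %% M r)%N.
Proof.
case: f_col => _ _ h _ rs NM; have M0 := code_M_gt0 code (ltnW rs).
rewrite {1}(divn_eq N (M r)) h //; last by rewrite ltn_mod.
by rewrite ltn_divLR // -(code_MS code).
Qed.

(** The values on the elements below [M r] form a cyclic group modulo 1; this is
    its order. *)
Definition image_order (r : nat) : nat := \prod_(l < r | f (M l) != 0) radix M l.

Lemma image_order_gt0 r : (r <= s)%N -> (0 < image_order r)%N.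
Proof.
move=> rs; apply: prodn_cond_gt0 => l _.
by apply: ltnW; apply: (code_radix_gt1 code); apply: leq_trans rs.
Qed.

Lemma image_orderS r :
  image_order r.+1 = (image_order r * (if f (M r) != 0%R then radix M r else 1))%N.
Proof. by rewrite /image_order big_mkcond /= big_ord_recr -big_mkcond. Qed.

(** Let [n] be the order of the image below [M r] and [m] the radix. The top value
    [1 - 1 / n] and [m - 1] times [f (M r)] add up below 1 without carry, so
    [m f (M r) < 2 / n]; being a multiple of [1 / n], it is [0] or [1 / n]. *)
Lemma column_M_val r :
  (r < s)%N -> (forall N, (N < M r)%N -> (image_order r)%:R * f N \is a Num.int) ->
  (exists2 N, (N < M r)%N & f N = 1 - (image_order r)%:R^-1) ->
  f (M r) = 0 \/ (image_order r * radix M r)%:R * f (M r) = 1.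
Proof.
move=> rs dint [N NM fN]; have m1 := code_radix_gt1 code rs.
have d0 := image_order_gt0 (ltnW rs).
have d0R : 0 < (image_order r)%:R :> R by rewrite ltr0n.
set m := radix M r in m1 *; set d : R := (image_order r)%:R in d0R *.
have m1R : 2 <= m%:R :> R by rewrite ler_nat.
have /andP[x0 x1] := column_bound (code_M_lt_v rs); set x := f (M r) in x0 x1 *.
have top : (m%:R - 1) * x + (1 - d^-1) < 1.
  have lt : (m.-1 * M r + N < M r.+1)%N.
    by rewrite (code_MS code rs) -/m; move: NM m1; clear; nia.
  have := column_bound (leq_trans lt (code_M_le_v rs)).
  case: f_col => _ _ + _ => -> //; last by rewrite -/m; lia.
  by rewrite fN -subn1 natrB ?(ltnW m1) // => /andP[].
have dx : d * x * (m%:R - 1) < 1.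
  have : (m%:R - 1) * x < d^-1 by move: top; lra.
  by rewrite -(ltr_pM2l d0R) mulfV ?gt_eqF // mulrA mulrAC.
have dx0 : 0 <= d * x by rewrite mulr_ge0 // ltW.
have : (image_order r * m)%:R * x \is a Num.int.
  case: f_col => _ _ _ /(_ r rs); rewrite -/m -/x => h.
  have -> : (image_order r * m)%:R * x = d * (m%:R * x - f (y r)) + d * f (y r).
    by rewrite natrM -/d; ring.
  by rewrite rpredD ?dint ?y_lt // rpredM // nat_num_int.
have ub : (image_order r * m)%:R * x < 2 by rewrite natrM -/d; move: dx dx0 m1R; nra.
have lb : 0 <= (image_order r * m)%:R * x by rewrite mulr_ge0.
move=> /intrP[z zE]; move: lb ub; rewrite zE.
rewrite -[0]/(0%:~R) -[2]/(2%:~R) ler_int ltr_int => lb ub.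
have [z0|z1] : z = 0 \/ z = 1 by lia.
  left; have /eqP := zE; rewrite z0 mulf_eq0 pnatr_eq0 muln_eq0 => /orP[|/eqP //].
  by case/orP => /eqP; lia.
by right; rewrite z1.
Qed.

(** Both outcomes of [column_M_val] carry the order and the top value of the image
    over to the next subgroup. *)
Lemma column_den r : (r <= s)%N ->
  (forall N, (N < M r)%N -> (image_order r)%:R * f N \is a Num.int) /\
  (exists2 N, (N < M r)%N & f N = 1 - (image_order r)%:R^-1).
Proof.
elim: r => [_|r IH rs].
  have -> : M 0%N = 1%N by case: code.
  rewrite /image_order big_ord0; split=> [[|//] _|].
    by rewrite column0 mulr0 rpred0.
  by exists 0%N => //; rewrite column0 invr1 subrr.
have [dint [N NM fN]] := IH (ltnW rs).
have m1 := code_radix_gt1 code rs; have d0 := image_order_gt0 (ltnW rs).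
have Mr0 := code_M_gt0 code (ltnW rs).
have d0R : (image_order r)%:R != 0 :> R by rewrite pnatr_eq0; lia.
have m0R : (radix M r)%:R != 0 :> R by rewrite pnatr_eq0; lia.
have [x0|x1] := column_M_val rs dint (ex_intro2 _ _ N NM fN).
  rewrite image_orderS x0 eqxx muln1; split=> [K KM|].
    by rewrite (columnD rs) // x0 mulr0 add0r dint // ltn_mod.
  exists N => //; apply: leq_trans NM _; apply: (code_M_le code) => //.
have xn0 : f (M r) != 0.
  by apply/eqP => x0; move: x1; rewrite x0 mulr0 => /eqP; rewrite eq_sym oner_eq0.
have xE : f (M r) = (image_order r * radix M r)%:R^-1.
  by apply: (mulfI _ (x := (image_order r * radix M r)%:R)); rewrite ?x1 ?mulfV // natrM mulf_neq0.
rewrite image_orderS xn0; split=> [K KM|].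
  rewrite (columnD rs) // mulrDr mulrCA x1 mulr1 rpredD ?nat_num_int //.
  by rewrite natrM mulrAC rpredM ?nat_num_int // dint // ltn_mod.
exists ((radix M r).-1 * M r + N)%N.
  by rewrite (code_MS code rs); move: NM m1; clear; nia.
case: f_col => _ _ + _ => -> //; last by lia.
rewrite fN xE natrM -subn1 natrB ?(ltnW m1) //.
by field; rewrite d0R m0R.
Qed.

Lemma column_val r : (r < s)%N ->
  f (M r) = 0 \/ (image_order r * radix M r)%:R * f (M r) = 1.
Proof. by move=> rs; have [h1 h2] := column_den (ltnW rs); apply: column_M_val. Qed.

Lemma image_order_dvd q r : (q <= r)%N -> (image_order q %| image_order r)%N.
Proof.
elim: r => [|r IH]; first by rewrite leqn0 => /eqP ->.
rewrite leq_eqVlt => /orP[/eqP -> //|qr].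
by rewrite image_orderS dvdn_mulr // IH.
Qed.

Lemma image_order_gt1 l r : (l < r)%N -> (r <= s)%N -> f (M l) != 0 -> (1 < image_order r)%N.
Proof.
move=> lr rs fl; have := dvdn_leq (image_order_gt0 rs) (image_order_dvd lr).
rewrite image_orderS fl; have := code_radix_gt1 code (leq_trans lr rs).
have := image_order_gt0 (leq_trans (ltnW lr) rs); nia.
Qed.

(** Once the column is nonzero on the subgroup, the next value is smaller than
    the inverse of the radix, so that the congruence defining it is exact. *)
Lemma column_next l r : (l < r)%N -> (r < s)%N -> f (M l) != 0 ->
  (radix M r)%:R * f (M r) = f (y r).
Proof.
move=> lr rs fl; apply/eqP; rewrite -subr_eq0; apply/eqP.
apply: int_num_eq0; first by case: f_col => _ _ _; apply.
have := column_bound (ltn_trans (y_lt rs) (code_M_lt_v rs)).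
have /andP[x0 _] := column_bound (code_M_lt_v rs).
have d1 := image_order_gt1 lr (ltnW rs) fl.
have m0 : 0 < (radix M r)%:R :> R by rewrite ltr0n; have := code_radix_gt1 code rs; lia.
have d2 : 2 <= (image_order r)%:R :> R by rewrite ler_nat.
have : (radix M r)%:R * f (M r) < 1.
  have [->|] := column_val rs; first by rewrite mulr0 ltr01.
  by rewrite natrM -mulrA; have := mulr_ge0 (ltW m0) x0; nra.
by have := mulr_ge0 (ltW m0) x0; lra.
Qed.

Lemma column_zero j : (j <= s)%N -> (forall l, (l < j)%N -> f (M l) = 0) ->
  forall N, (N < M j)%N -> f N = 0.
Proof.
elim: j => [_ _|j IH js z] N.
  by have -> : M 0%N = 1%N by [case: code]; case: N => // _; apply: column0.
move=> NM; rewrite (columnD js) // z // mulr0 add0r.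
apply: IH; [exact: ltnW|by move=> l lj; apply: z; apply: ltnW|].
by rewrite ltn_mod (code_M_gt0 code (ltnW js)).
Qed.

Lemma image_order_eq1 j : (forall l, (l < j)%N -> f (M l) = 0) -> image_order j = 1%N.
Proof. by move=> z; rewrite /image_order big1 // => l; rewrite z ?eqxx. Qed.

(** The image of a subgroup on which the column vanishes has order 1. *)
Lemma column_first j : (j < s)%N -> (forall l, (l < j)%N -> f (M l) = 0) ->
  f (M j) != 0 -> (radix M j)%:R * f (M j) = 1.
Proof.
move=> js z nz; have [e|] := column_val js; first by rewrite e eqxx in nz.
by rewrite (image_order_eq1 z) mul1n.
Qed.

End ColumnAnalysis.

Section ColumnComparison.
Local Open Scope ring_scope.
Variables (R : realType) (v s : nat) (M y : nat -> nat).
Hypothesis code : is_code v s M succn.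
Hypothesis y_lt : forall r, (r < s)%N -> (y r < M r)%N.

(** Beyond the first nonzero value, [column_next] computes each value from
    earlier ones. *)
Lemma column_ext (f g : nat -> R) j :
  column v s M y f -> column v s M y g -> (j < s)%N ->
  (forall l, (l < j)%N -> f (M l) = 0) -> (forall l, (l < j)%N -> g (M l) = 0) ->
  f (M j) != 0 -> g (M j) != 0 -> forall N, (N < v)%N -> f N = g N.
Proof.
move=> cf cg js zf zg nf ng.
suff H r : (r <= s)%N -> forall N, (N < M r)%N -> f N = g N.
  by have [_ <- _ _] := code; apply: H.
elim: r => [_|r IH rs] N.
  have -> : M 0%N = 1%N by case: code.
  by case: N => // _; rewrite (column0 cf) (column0 cg).
move=> NM; rewrite (columnD code cf rs NM) (columnD code cg rs NM).
rewrite (IH (ltnW rs) (N %% M r)%N) ?ltn_mod ?(code_M_gt0 code (ltnW rs)) //.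
congr (_ * _ + _).
have m0 : (radix M r)%:R != 0 :> R by apply: (radix_neq0 R code).
apply: (mulfI m0).
have [rj|jr|->] := ltngtP r j; first by rewrite zf ?zg.
- rewrite (column_next code y_lt cf jr rs nf) (column_next code y_lt cg jr rs ng).
  by apply: IH; [exact: ltnW|exact: y_lt].
- by rewrite (column_first code y_lt cf) // (column_first code y_lt cg).
Qed.

(** If the column [f] starts at [M j] and its next nonzero value on the chain
    is at [M q], then the radix times [f] is modulo 1 the column starting
    at [M q], or zero if there is no such value and [q] is [s]; the integral
    part is the [j]-th digit. *)
Lemma column_parent (f g : nat -> R) j q :
  column v s M y f -> column v s M y g -> (j < s)%N -> (j < q <= s)%N ->
  (forall l, (l < j)%N -> f (M l) = 0) -> f (M j) != 0 ->
  (forall l, (j < l)%N -> (l < q)%N -> f (M l) = 0) ->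
  (forall l, (l < q)%N -> g (M l) = 0) ->
  (forall r, (q <= r)%N -> (r < s)%N -> f (M q) != 0 /\ g (M q) != 0) ->
  forall N, (N < v)%N -> (radix M j)%:R * f N = (digit M j N)%:R + g N.
Proof.
move=> cf cg js /andP[jq qs] zf nf zf' zg nz.
have m0 r : (r < s)%N -> (radix M r)%:R != 0 :> R by apply: (radix_neq0 R code).
have denf r : (j < r)%N -> (r <= q)%N -> image_order M f r = radix M j.
  elim: r => // r IH; rewrite ltnS leq_eqVlt => /orP[/eqP <-|jr] rq.
    by rewrite image_orderS (image_order_eq1 zf) nf mul1n.
  by rewrite image_orderS (IH jr (ltnW rq)) zf' // eqxx muln1.
suff H r : (r <= s)%N -> forall N, (N < M r)%N ->
    (radix M j)%:R * f N = (digit M j N)%:R + g N.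
  by have [_ <- _ _] := code; apply: H.
elim: r => [_|r IH rs] N.
  have -> : M 0%N = 1%N by case: code.
  case: N => // _; rewrite (column0 cf) (column0 cg) digit_small ?mulr0 ?addr0 //.
  exact: (code_M_gt0 code (ltnW js)).
have Mr0 := code_M_gt0 code (ltnW rs).
move=> NM; rewrite (columnD code cf rs NM) (columnD code cg rs NM).
set a := (N %/ M r)%N; set h := (N %% M r)%N; have hM : (h < M r)%N by rewrite ltn_mod.
have dig : digit M j N = (a * (r == j) + digit M j h)%N.
  have [rj|jr|rj] /= := ltngtP r j.
  - have Mj : (M r.+1 <= M j)%N by apply: (code_M_le code) => //; exact: ltnW.
    rewrite muln0 !digit_small //; last exact: leq_trans NM Mj.
    by apply: leq_trans hM _; apply: (code_M_le code) (ltnW rj) (ltnW js).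
  - rewrite muln0 /digit /h modn_dvdm //; exact: (code_M_dvd code jr (ltnW rs)).
  - rewrite -rj in js *; rewrite (digit_small hM) addn0 muln1 /digit modn_small //.
have key : (radix M j)%:R * f (M r) = (r == j)%:R + g (M r).
  have [rj|jr|->] := ltngtP r j.
  - by rewrite zf // zg ?(ltn_trans rj) // mulr0 addr0.
  - rewrite add0r; have [rq|qr|rq] := ltngtP r q.
    + by rewrite zf' // zg // mulr0.
    + have [nfq ngq] := nz r (ltnW qr) rs; apply: (mulfI (m0 r rs)).
      have yM := y_lt rs; have yv := ltn_trans yM (code_M_lt_v code rs).
      have q_s := ltn_trans qr rs.
      rewrite (column_next code y_lt cg qr rs ngq).
      have fE := column_next code y_lt cf jr rs nf.
      rewrite mulrCA fE.
      apply/eqP; rewrite -subr_eq0; apply/eqP; apply: int_num_eq0.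
        by rewrite (IH (ltnW rs)) // addrK nat_num_int.
      have := column_bound cg yv.
      suff : (radix M j)%:R * f (y r) < 1.
        have := mulr_ge0 (ler0n R (radix M j)) (proj1 (andP (column_bound cf yv))).
        by lra.
      rewrite -fE; have [->|] := column_val code y_lt cf rs.
        by rewrite !mulr0 ltr01.
      have dr : (radix M j * 2 <= image_order M f r)%N.
        apply: leq_trans (dvdn_leq (image_order_gt0 code f (ltnW rs)) (image_order_dvd M f qr)).
        rewrite image_orderS denf // nfq leq_mul2l (code_radix_gt1 code q_s) orbT //.
      have := mulr_ge0 (ler0n R (radix M r)) (proj1 (andP (column_bound cf (code_M_lt_v code rs)))).
      move: dr; rewrite -(ler_nat R) !natrM -mulrA.
      have : 0 < (radix M j)%:R :> R by apply: (radix_gt0 R code).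
      set A := (radix M j)%:R; set B := (image_order M f r)%:R; set X := _ * f _.
      by move=> A0 dr X0 BX; nra.
    + rewrite rq in rs *; have [nfq ngq] := nz q (leqnn q) rs.
      apply: (mulfI (m0 q rs)); rewrite (column_first code y_lt cg) //.
      have [e|] := column_val code y_lt cf rs; first by rewrite e eqxx in nfq.
      by rewrite denf // natrM => e; rewrite -[RHS]e; ring.
  - by rewrite (column_first code y_lt cf) // zg ?addr0.
by rewrite mulrDr mulrCA key (IH (ltnW rs) h hM) dig natrD natrM; ring.
Qed.

End ColumnComparison.

(** * The code of a box system *)

Section Classification.
Local Open Scope ring_scope.
Variables (R : realType) (v k n : nat).

Definition box_system (F : nat -> 'I_n -> R) : Prop :=
  [/\ forall N i, (N < v)%N -> 0 <= F N i < 1,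
      forall N, (N < v)%N -> \sum_i F N i = (k * N)%:R,
      forall N N', (N < v)%N -> (N' < v)%N -> exists2 t, (t < v)%N &
        forall i, F N i + F N' i - F t i \is a Num.int
    & forall i, exists2 N, (N < v)%N & F N i != 0].

Definition has_code (F : nat -> 'I_n -> R) s M p (blk : 'I_n -> nat) : Prop :=
  [/\ is_code v s M p, forall i, (blk i < s)%N,
      forall j, (j < s)%N -> exists i, blk i = j
    & forall N i, (N < v)%N -> F N i = colv R s M p (blk i) N].

(** The block of a coordinate is the place on the chain where the coordinate is
    first nonzero; the parent of the block is the place where it is next nonzero. *)
Lemma box_system_code F : (0 < k)%N -> (0 < v)%N -> box_system F ->
  exists s M p blk, has_code F s M p blk.
Proof.
move=> k0 v0 [Fb Fh Fcl Fnz].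
have [op opP] : {op : nat * nat -> nat & forall q : nat * nat,
    (q.1 < v)%N -> (q.2 < v)%N -> (op q < v)%N /\
    forall i, F q.1 i + F q.2 i - F (op q) i \is a Num.int}.
  apply: (choice (P := fun q t => (q.1 < v)%N -> (q.2 < v)%N -> (t < v)%N /\
    forall i, F q.1 i + F q.2 i - F t i \is a Num.int)) => -[N N'] /=.
  have [Nv|Nv] := boolP (N < v)%N; last by exists 0%N.
  have [Nv'|Nv'] := boolP (N' < v)%N; last by exists 0%N.
  by have [t tv h] := Fcl N N' Nv Nv'; exists t.
have [s [M [y [M0 Ms step]]]] := @box_chain R v k n F (fun a b => op (a, b)) k0
  Fb Fh (fun a b av bv => proj1 (opP (a, b) av bv))
  (fun a b i av bv => proj2 (opP (a, b) av bv) i) v0.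
have code0 : is_code v s M succn.
  split=> //; first by move=> j /step [].
  by move=> j js; rewrite leqnn js.
have ylt r : (r < s)%N -> (y r < M r)%N by move=> /step [].
have Fcol i : column v s M y (fun N => F N i).
  split=> [|N Nv|r a h rs ar hM|r rs]; first exact: (box_zero Fb Fh).
  - exact: Fb.
  - by have [_ _ -> //] := step r rs.
  - by have [_ _ _ ->] := step r rs.
have Mv r : (r < s)%N -> (M r < v)%N by apply: (code_M_lt_v code0).
have [blk blkP] : {blk : 'I_n -> nat & forall i, [/\ (blk i < s)%N,
    F (M (blk i)) i != 0 & forall l, (l < blk i)%N -> F (M l) i = 0]}.
  apply: (choice (P := fun i j => [/\ (j < s)%N, F (M j) i != 0
     & forall l, (l < j)%N -> F (M l) i = 0])) => i.
  have exj : exists j, (j < s)%N && (F (M j) i != 0).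
    apply: contrapT => no; have [N Nv] := Fnz i; apply/negP; rewrite negbK.
    apply/eqP/(column_zero code0 (Fcol i) (leqnn s)); last by rewrite Ms.
    move=> l ls; apply/eqP; apply: contrapT => /negP nz; apply: no.
    by exists l; rewrite ls.
  case: (ex_minnP exj) => j /andP[js nz] jmin; exists j; split=> // l lj.
  apply/eqP; apply: contrapT => /negP nzl.
  have := jmin l; rewrite (ltn_trans lj js) nzl => /(_ isT).
  by rewrite leqNgt lj.
have blk_lt i : (blk i < s)%N by case: (blkP i).
have blk_nz i : F (M (blk i)) i != 0 by case: (blkP i).
have blk_z i l : (l < blk i)%N -> F (M l) i = 0 by case: (blkP i) => _ _; apply.
have blk_zero i N : (N < M (blk i))%N -> F N i = 0.
  exact: (column_zero code0 (Fcol i) (ltnW (blk_lt i)) (@blk_z i)).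
(* At the element [M j] all other blocks contribute exactly the height of
   [y j < M j], which is too little. *)
have blk_surj j : (j < s)%N -> exists i, blk i = j.
  move=> js; apply: contrapT => no.
  have : (radix M j)%:R * \sum_i F (M j) i = \sum_i F (y j) i.
    rewrite mulr_sumr; apply: eq_bigr => i _.
    have yv : (y j < v)%N by apply: ltn_trans (ylt j js) (Mv j js).
    have [bj|jb|e] := ltngtP (blk i) j.
    - exact: (column_next code0 ylt (Fcol i) bj js).
    - rewrite blk_z // mulr0 blk_zero //; apply: ltn_trans (ylt j js) _.
      exact: (code_M_lt code0 jb (ltnW (blk_lt i))).
    - by case: no; exists i.
  rewrite !Fh ?Mv ?(ltn_trans (ylt j js)) ?Mv // -natrM => /eqP; rewrite eqr_nat.
  have := ylt j js; have := code_radix_gt1 code0 js => m1 yM /eqP e.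
  have : (k * (radix M j * M j) = k * y j)%N by rewrite -e mulnCA.
  by move=> /eqP; rewrite eqn_pmul2l // => /eqP; nia.
have same i i' N : blk i = blk i' -> (N < v)%N -> F N i = F N i'.
  move=> e; apply: (column_ext code0 ylt (Fcol i) (Fcol i') (blk_lt i)) => //.
  + exact: blk_z.
  + by rewrite e; apply: blk_z.
  + by rewrite e.
have [p pP] : {p : nat -> nat & forall j i, (j < s)%N -> blk i = j ->
    [/\ (j < p j <= s)%N, forall l, (j < l)%N -> (l < p j)%N -> F (M l) i = 0
      & (p j < s)%N -> F (M (p j)) i != 0]}.
  apply: (choice (P := fun j q => forall i, (j < s)%N -> blk i = j ->
    [/\ (j < q <= s)%N, forall l, (j < l)%N -> (l < q)%N -> F (M l) i = 0
      & (q < s)%N -> F (M q) i != 0])) => j.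
  have [js|sj] := ltnP j s; last by exists 0%N.
  have [i bi] := blk_surj j js.
  have exq : exists q, (j < q)%N && ((q == s) || (q < s)%N && (F (M q) i != 0)).
    by exists s; rewrite js eqxx.
  case: (ex_minnP exq) => q /andP[jq qP] qmin; exists q => i' _ bi'.
  have eF N : (N < v)%N -> F N i' = F N i by apply: same; rewrite bi'.
  split.
  - by rewrite jq /=; case/orP: qP => [/eqP -> //|/andP[/ltnW ->]].
  - move=> l jl lq; have ls : (l < s)%N.
      by case/orP: qP => [/eqP <-|/andP[qs _]] //; apply: ltn_trans qs.
    rewrite eF ?Mv //; apply/eqP; apply: contrapT => /negP nzl.
    have := qmin l; rewrite jl ls nzl orbT => /(_ isT).
    by rewrite leqNgt lq.
  - move=> qs; rewrite eF ?Mv //; case/orP: qP => [/eqP e|/andP[_ //]].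
    by rewrite e ltnn in qs.
have code : is_code v s M p.
  split=> //; first by move=> j /step [].
  by move=> j js; have [i bi] := blk_surj j js; case: (pP j i js bi).
have main j : (j <= s)%N -> forall N i, (N < v)%N -> blk i = j ->
    F N i = colv R s M p j N.
  elim/(parent_ind code): j / => [|j js IH] N i Nv bi.
    by have := blk_lt i; rewrite bi ltnn.
  have [/andP[jp ps] z nz] := pP j i js bi.
  rewrite (colv_step R code) //; apply: (mulfI (radix_neq0 R code js)).
  rewrite [RHS]mulrC divfK ?(radix_neq0 R code js) //.
  move: ps; rewrite leq_eqVlt => /orP[/eqP pjs|ps].
    have c0 : column v s M y (fun=> 0 : R).
      split=> // [N' _|r a h _ _ _|r _]; first by rewrite lexx ltr01.
        by rewrite mulr0 addr0.
      by rewrite mulr0 subr0 rpred0.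
    rewrite pjs colv_root; apply: (column_parent code0 ylt (Fcol i) c0 js (q := s)) Nv => //.
    - by rewrite js leqnn.
    - by move=> l lj; apply: blk_z; rewrite bi.
    - by rewrite -bi.
    - by rewrite -pjs.
    - by move=> r sr; rewrite ltnNge sr.
  have [i' bi'] := blk_surj _ ps.
  rewrite -(IH _ i') //.
  apply: (column_parent code0 ylt (Fcol i) (Fcol i') js (q := p j)) Nv => //.
  - by rewrite jp ltnW.
  - by move=> l lj; apply: blk_z; rewrite bi.
  - by rewrite -bi.
  - by move=> l lp; apply: blk_z; rewrite bi'.
  - by move=> r _ _; split; [exact: nz|rewrite -bi'].
exists s, M, p, blk; split=> // N i Nv; exact: (main _ (ltnW (blk_lt i))).
Qed.

End Classification.

Section BlockSizes.
Local Open Scope ring_scope.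
Variables (R : realType) (v k n s : nat) (M p : nat -> nat) (blk : 'I_n -> nat).
Hypothesis code : is_code v s M p.
Hypothesis blk_lt : forall i, (blk i < s)%N.

Lemma sum_by_block (x : nat -> R) :
  \sum_i x (blk i) = \sum_(j < s) #|[pred i | blk i == j]|%:R * x j.
Proof.
rewrite (partition_big (fun i => Ordinal (blk_lt i)) xpredT) //=.
apply: eq_bigr => j _; rewrite mulr_natl -sumr_const.
by apply: eq_big => [i|i /eqP <- //]; rewrite inE.
Qed.

(** The heights of the elements [M j] form a triangular system for the block
    sizes. *)
Lemma card_block :
  (forall N, (N < v)%N -> \sum_i colv R s M p (blk i) N = (k * N)%:R) ->
  forall j, (j < s)%N -> #|[pred i | blk i == j]| = block_size k s M p j.
Proof.
move=> ht j; elim/ltn_ind: j => j IH js.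
have Mv : (M j < v)%N by have [_ <- _ _] := code; apply: (code_M_lt code).
have := ht _ Mv; rewrite (sum_by_block (fun l => colv R s M p l (M j))).
rewrite -(sum_block_colv R code) //.
move/eqP; rewrite -subr_eq0 -sumrB (bigD1 (Ordinal js)) //= big1 ?addr0; last first.
  move=> l lj; have [lt|gt|e] := ltngtP l j.
  - by rewrite (IH _ lt) ?subrr.
  - rewrite (colv_eq0 R code) ?mulr0 ?subrr //; first exact: ltnW.
    exact: (code_M_lt code gt (ltnW (ltn_ord l))).
  - by case/eqP: lj; apply: val_inj.
rewrite -mulrBl mulf_eq0 (negPf (colv_M_neq0 R code js)) orbF subr_eq0 eqr_nat.
by move/eqP.
Qed.

End BlockSizes.

(** * Hulls of the rows of a matrix *)

Section IntegerMatrices.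
Local Open Scope ring_scope.
Variable R : realType.

Lemma map_intr_mx_inj m n (X Y : 'M[int]_(m, n)) :
  map_mx intr X = map_mx intr Y :> 'M[R]_(m, n) -> X = Y.
Proof.
by move=> e; apply/matrixP => i j; move/matrixP/(_ i j): e; rewrite !mxE => /intr_inj.
Qed.

Lemma map_intr_unitmx n (U : 'M[int]_n) :
  U \in unitmx -> (map_mx intr U : 'M[R]_n) \in unitmx.
Proof. by rewrite !unitmxE det_map_mx; apply: rmorph_unit. Qed.

End IntegerMatrices.

Section RowHulls.
Local Open Scope classical_set_scope.
Local Open Scope ring_scope.
Variable R : realType.

Definition is_convex d (C : set 'rV[R]_d) : Prop :=
  forall (x y : 'rV[R]_d) (t : R), C x -> C y -> 0 <= t <= 1 ->
  C (t *: x + (1 - t) *: y).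

Lemma convex_setP d (C : set 'rV[R]_d) :
  convex_set (C : set (convex_lmodType 'rV[R]_d)) <-> is_convex C.
Proof.
split=> [h x y t Cx Cy /andP[t0 t1]|h x y l].
  by have := h x y (Itv01 t0 t1); rewrite !inE; apply.
by rewrite !inE => Cx Cy; apply: h => //; rewrite ge0 le1.
Qed.

Lemma conv_hull_subset d (A C : set 'rV[R]_d) :
  is_convex C -> A `<=` C -> conv_hull A `<=` C.
Proof. by move=> /convex_setP cC AC; apply: smallest_sub. Qed.

Lemma subset_conv_hull d (A : set 'rV[R]_d) : A `<=` conv_hull A.
Proof. exact: sub_gen_smallest. Qed.

Lemma conv_hull_convex d (A : set 'rV[R]_d) : is_convex (conv_hull A).
Proof.
move=> x y t hx hy t01 C [/convex_setP cC AC].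
have CC : [set M | convex_set (M : set (convex_lmodType 'rV[R]_d)) /\ A `<=` M] C.
  by split=> //; apply/convex_setP.
by apply: cC => //; [apply: hx CC|apply: hy CC].
Qed.

Lemma convex_comb d (C : set 'rV[R]_d) n (x : 'I_n -> 'rV[R]_d) (a : 'I_n -> R) :
  is_convex C -> (forall i, C (x i)) -> (forall i, 0 <= a i) ->
  \sum_i a i = 1 -> C (\sum_i a i *: x i).
Proof.
move=> cC; elim: n x a => [|n IH] x a Cx a0.
  by rewrite big_ord0 => /eqP; rewrite eq_sym oner_eq0.
rewrite !big_ord_recl => a1; set b := \sum_i _ in a1.
have b0 : 0 <= b by apply: sumr_ge0.
have [bz|bn] := eqVneq b 0.
  have az i : a (lift ord0 i) = 0.
    by move/eqP: bz; rewrite psumr_eq0 // => /allP /(_ i (mem_index_enum _)) /eqP.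
  rewrite big1 ?addr0; last by move=> i _; rewrite az scale0r.
  by rewrite bz addr0 in a1; rewrite a1 scale1r.
have -> : \sum_(i < n) a (lift ord0 i) *: x (lift ord0 i) =
    (1 - a ord0) *: \sum_(i < n) (a (lift ord0 i) / b) *: x (lift ord0 i).
  rewrite scaler_sumr; apply: eq_bigr => i _; rewrite scalerA.
  have -> : 1 - a ord0 = b by rewrite -a1; ring.
  by rewrite mulrC divfK.
apply: cC => //.
  apply: IH => [i|i|]; first exact: Cx.
    by rewrite divr_ge0.
  by rewrite -mulr_suml mulfV.
by rewrite a0 /=; move: b0 a1; lra.
Qed.

Definition hull n d (V : 'M[R]_(n, d)) : set 'rV[R]_d :=
  conv_hull (range (fun i => row i V)).

Definition std_simplex n (a : 'rV[R]_n) : Prop :=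
  (forall i, 0 <= a 0 i) /\ \sum_i a 0 i = 1.

Lemma hullP n d (V : 'M[R]_(n, d)) x :
  hull V x <-> exists2 a, std_simplex a & x = a *m V.
Proof.
split; last first.
  case=> a [a0 a1] ->; rewrite mulmx_sum_row.
  apply: convex_comb => //; first exact: conv_hull_convex.
  by move=> i; apply: subset_conv_hull; exists i.
apply: (@conv_hull_subset _ _ [set x | exists2 a, std_simplex a & x = a *m V]).
  move=> _ _ t [a [a0 a1] ->] [b [b0 b1] ->] /andP[t0 t1].
  exists (t *: a + (1 - t) *: b); last by rewrite mulmxDl -!scalemxAl.
  split=> [i|]; first by rewrite !mxE addr_ge0 // mulr_ge0 // subr_ge0.
  under eq_bigr => i _ do rewrite !mxE.
  by rewrite big_split -!mulr_sumr a1 b1 /=; ring.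
move=> _ [i _ <-]; exists (delta_mx 0 i); last by rewrite rowE.
split=> [j|]; first by rewrite mxE ler0n.
rewrite (bigD1 i) //= big1 ?addr0 => [|j /negPf ji]; first by rewrite mxE !eqxx.
by rewrite mxE ji andbF.
Qed.

Lemma row_hull n d (V : 'M[R]_(n, d)) i : hull V (row i V).
Proof. by apply: subset_conv_hull; exists i. Qed.

(** A point that is not a row lies strictly between a row and a point of the hull. *)
Lemma vertex_hull n d (V : 'M[R]_(n, d)) x :
  is_vertex (hull V) x -> exists i, x = row i V.
Proof.
case=> /hullP[a [a0 a1] xE] ext.
have [i ai] : exists i, a 0 i != 0.
  apply: contrapT => no; move: a1; rewrite big1 => [/eqP|i _].
    by rewrite eq_sym oner_eq0.
  by apply/eqP; apply: contrapT => /negP h; apply: no; exists i.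
exists i; have rest : \sum_(j | j != i) a 0 j = 1 - a 0 i.
  by rewrite -a1 [in RHS](bigD1 i) //=; ring.
have xE' : x = a 0 i *: row i V + \sum_(j | j != i) a 0 j *: row j V.
  by rewrite xE mulmx_sum_row (bigD1 i).
have r0 : 0 <= 1 - a 0 i by rewrite -rest; apply: sumr_ge0.
have [e|ne] := eqVneq (a 0 i) 1.
  rewrite xE' e scale1r big1 ?addr0 // => j ji.
  move/eqP: rest; rewrite e subrr psumr_eq0 // => /allP /(_ j (mem_index_enum _)).
  by rewrite ji => /eqP ->; rewrite scale0r.
pose b : 'rV[R]_n := \row_j (if j == i then 0 else a 0 j / (1 - a 0 i)).
have n0 : 1 - a 0 i != 0 by rewrite subr_eq0 eq_sym.
have hb : hull V (b *m V).
  apply/hullP; exists b => //; split=> [j|].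
    by rewrite mxE; case: ifP => // _; rewrite divr_ge0.
  rewrite (bigD1 i) //= mxE eqxx add0r.
  rewrite (eq_bigr (fun j => a 0 j / (1 - a 0 i))) => [|j /negPf ji].
    by rewrite -mulr_suml rest mulfV.
  by rewrite mxE ji.
have [||-> //] := ext _ _ (a 0 i) (@row_hull _ _ V i) hb.
  by rewrite !lt_neqAle eq_sym ai a0 ne /=; move: r0; lra.
rewrite {1}xE'; congr (_ + _); rewrite mulmx_sum_row [in RHS](bigD1 i) //=.
rewrite mxE eqxx scale0r add0r scaler_sumr; apply: eq_bigr => j /negPf ji.
by rewrite mxE ji scalerA mulrC divfK.
Qed.

Lemma hull_polytope n d (V : 'M[R]_(n, d)) : is_polytope (hull V).
Proof. by exists (range (fun i => row i V)) => //; apply: finite_image; apply: finite_finset. Qed.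

Lemma hull_lattice_polytope n d (V : 'M[int]_(n, d)) :
  is_lattice_polytope (hull (map_mx intr V)).
Proof.
split; first exact: hull_polytope.
by move=> x /vertex_hull[i ->]; exists (row i V) => //; rewrite -map_row.
Qed.

Lemma std_simplex_vertex n (a b : 'rV[R]_n) (i : 'I_n) (t : R) :
  std_simplex a -> std_simplex b -> 0 < t < 1 ->
  delta_mx 0 i = t *: a + (1 - t) *: b -> a = delta_mx 0 i.
Proof.
move=> [a0 a1] [b0 _] /andP[t0 t1] e.
have az j : j != i -> a 0 j = 0.
  move=> /negPf ji; move/rowP/(_ j): e; rewrite !mxE ji andbF /= => e.
  have := mulr_ge0 (ltW t0) (a0 j).
  have t1' : 0 <= 1 - t by lra.
  have := mulr_ge0 t1' (b0 j) => h1 h2.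
  have /eqP : t * a 0 j = 0 by lra.
  by rewrite mulf_eq0 gt_eqF //= => /eqP.
apply/rowP => j; rewrite mxE eqxx /=; have [->|/az //] := eqVneq j i.
by move: a1; rewrite (bigD1 i) //= big1 ?addr0 // => l; apply: az.
Qed.

(** Adjoining a first coordinate 1 turns affine combinations into linear ones. *)
Definition homog n d (T : pzRingType) (V : 'M[T]_(n, d)) : 'M[T]_(n, 1 + d) :=
  row_mx (const_mx 1) V.

Lemma mulmx_homog n d (V : 'M[R]_(n, d)) (a : 'rV[R]_n) :
  a *m homog V = row_mx (const_mx (\sum_i a 0 i)) (a *m V).
Proof.
rewrite mul_mx_row; congr row_mx; apply/matrixP => i j; rewrite !mxE ord1.
by apply: eq_bigr => l _; rewrite mxE mulr1.
Qed.

Lemma affinely_independentP d (V : 'M[R]_(1 + d, d)) :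
  affinely_independent V <-> homog V \in unitmx.
Proof.
split=> [h|u a a1 aV].
  rewrite -row_free_unit; apply: inj_row_free => a.
  rewrite mulmx_homog => /eqP; rewrite row_mx_eq0.
  move=> /andP[/eqP/matrixP/(_ 0 0) a0 /eqP aV].
  by apply: h => //; rewrite !mxE in a0.
have : a *m homog V = 0.
  have c0 : const_mx 0 = 0 :> 'rV[R]_1 by apply/matrixP => i j; rewrite !mxE.
  by rewrite mulmx_homog a1 aV c0 row_mx0.
by move/(congr1 (mulmx^~ (invmx (homog V)))); rewrite mulmxK // mul0mx.
Qed.

Lemma homog_barycentric d (V : 'M[R]_(1 + d, d)) x (a b : 'rV[R]_(1 + d)) :
  homog V \in unitmx -> \sum_i a 0 i = \sum_i b 0 i -> x = a *m V -> x = b *m V -> a = b.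
Proof.
move=> u e xa xb; have : a *m homog V = b *m homog V.
  by rewrite !mulmx_homog e -xa -xb.
by move/(congr1 (mulmx^~ (invmx (homog V)))); rewrite !mulmxK.
Qed.

(** Barycentric coordinates are unique, which reduces the claim to the standard
    simplex. *)
Lemma row_vertex d (V : 'M[R]_(1 + d, d)) i :
  homog V \in unitmx -> is_vertex (hull V) (row i V).
Proof.
move=> u; split; first exact: row_hull.
have delta1 : \sum_j (delta_mx 0 i : 'rV[R]_(1 + d)) 0 j = 1.
  rewrite (bigD1 i) //= big1 ?addr0 => [|j /negPf ji]; first by rewrite mxE !eqxx.
  by rewrite mxE ji andbF.
move=> _ _ t /hullP[a sa ->] /hullP[b sb ->] t01 e.
have ab : delta_mx 0 i = t *: a + (1 - t) *: b.
  apply: (homog_barycentric u (x := row i V)); last 2 first.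
  - exact: rowE.
  - by rewrite e mulmxDl -!scalemxAl.
  rewrite delta1; under eq_bigr => j _ do rewrite !mxE.
  by rewrite big_split -!mulr_sumr /=; case: sa sb => _ -> [_ ->]; ring.
split.
  by rewrite rowE (std_simplex_vertex sa sb t01 ab).
have t01' : 0 < 1 - t < 1 by case/andP: t01; lra.
rewrite rowE (std_simplex_vertex sb sa t01' (i := i)) //.
by rewrite ab addrC subKr.
Qed.

Lemma lattice_simplexP d (P : set 'rV[R]_d) :
  is_lattice_simplex P <-> exists2 V : 'M[int]_(1 + d, d),
    homog (map_mx intr V : 'M[R]_(1 + d, d)) \in unitmx & P = hull (map_mx intr V).
Proof.
split=> [[[_ Pv] [V /affinely_independentP u PE]]|[V u ->]]; last first.
  split; first exact: hull_lattice_polytope.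
  by exists (map_mx intr V) => //; apply/affinely_independentP.
have Vint i : exists z : 'rV[int]_d, map_mx intr z = row i V.
  have [|z _ zE] := Pv (row i V); last by exists z.
  by rewrite PE; apply: row_vertex.
have [Z ZE] := choice Vint.
have VE : V = map_mx intr (\matrix_i Z i).
  by apply/row_matrixP => i; rewrite -map_row rowK -ZE.
by exists (\matrix_i Z i); rewrite -VE.
Qed.

(** On both sides the rows are the vertices. *)
Lemma hull_rows_perm d (V V' : 'M[R]_(1 + d, d)) :
  homog V \in unitmx -> homog V' \in unitmx -> hull V = hull V' ->
  exists sigma : 'I_(1 + d) -> 'I_(1 + d), forall i, row i V' = row (sigma i) V.
Proof.
move=> u u' e; have h i : exists j, row i V' = row j V.
  by have := row_vertex i u'; rewrite -e => /vertex_hull.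
by have [sigma sE] := choice h; exists sigma.
Qed.

Lemma eq_hull n n' d (V : 'M[R]_(n, d)) (V' : 'M[R]_(n', d)) :
  (forall i, exists j, row i V = row j V') -> (forall j, exists i, row j V' = row i V) ->
  hull V = hull V'.
Proof.
move=> h h'; congr conv_hull; apply/seteqP; split=> _ [i _ <-].
  by have [j ->] := h i; exists j.
by have [j ->] := h' i; exists j.
Qed.

Definition affine_image n d (T : pzRingType) (V : 'M[T]_(n, d))
    (U : 'M[T]_d) (w : 'rV[T]_d) : 'M[T]_(n, d) :=
  V *m U + const_mx 1 *m w.

Lemma image_hull n d (V : 'M[R]_(n, d)) U w :
  [set x *m U + w | x in hull V] = hull (affine_image V U w).
Proof.
have aE a : std_simplex a -> a *m V *m U + w = a *m affine_image V U w.
  move=> [_ a1]; rewrite /affine_image mulmxDr !mulmxA; congr (_ + _).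
  apply/rowP => j; rewrite mxE big_ord1 !mxE.
  by under eq_bigr => l _ do rewrite mxE mulr1; rewrite a1 mul1r.
apply/seteqP; split=> [_ [_ /hullP[a sa ->] <-]|_ /hullP[a sa ->]].
  by rewrite aE //; apply/hullP; exists a.
by exists (a *m V); [apply/hullP; exists a|rewrite aE].
Qed.

Lemma map_affine_image n d (V : 'M[int]_(n, d)) U w :
  map_mx intr (affine_image V U w) =
  affine_image (map_mx intr V : 'M[R]_(n, d)) (map_mx intr U) (map_mx intr w).
Proof. by rewrite map_mxD !map_mxM map_const_mx. Qed.

Lemma unimod_equiv_refl d (P : set 'rV[R]_d) : unimod_equiv P P.
Proof.
exists 1%:M, 0; rewrite unitmx1; split=> //.
rewrite map_mx1 /int_point map_mx0.
apply/seteqP; split=> [x Px|_ [x Px <-]]; last by rewrite mulmx1 addr0.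
by exists x => //; rewrite mulmx1 addr0.
Qed.

Lemma unimod_equiv_trans d (P Q S : set 'rV[R]_d) :
  unimod_equiv P Q -> unimod_equiv Q S -> unimod_equiv P S.
Proof.
move=> [U [w [uU ->]]] [U' [w' [uU' ->]]].
exists (U *m U'), (w *m U' + w'); split; first by rewrite unitmx_mul uU.
rewrite /int_point map_mxM map_mxD map_mxM.
apply/seteqP; split=> [_ [_ [x Px <-] <-]|_ [x Px <-]].
  by exists x => //; rewrite mulmxDl mulmxA addrA.
exists (x *m map_mx intr U + map_mx intr w); first by exists x.
by rewrite mulmxDl mulmxA addrA.
Qed.

Lemma unimod_equiv_sym d (P Q : set 'rV[R]_d) :
  unimod_equiv P Q -> unimod_equiv Q P.
Proof.
move=> [U [w [uU ->]]]; exists (invmx U), (- (w *m invmx U)).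
split; first by rewrite unitmx_inv.
have UV : map_mx intr U *m map_mx intr (invmx U) = 1%:M :> 'M[R]_d.
  by rewrite -map_mxM mulmxV // map_mx1.
have xE (x : 'rV[R]_d) : (x *m map_mx intr U + int_point R w) *m map_mx intr (invmx U)
    + int_point R (- (w *m invmx U)) = x.
  by rewrite /int_point mulmxDl -mulmxA UV mulmx1 map_mxN map_mxM addrK.
apply/seteqP; split=> [x Px|_ [_ [x Px <-] <-]]; last by rewrite xE.
by exists (x *m map_mx intr U + int_point R w); [exists x|rewrite xE].
Qed.

(** Polytopes in one class have the same dimension only up to an equality of
    indices; phrasing invariance with a predicate avoids casts. *)
Lemma unimod_class_invariant (Phi : forall d, set 'rV[R]_d -> Prop) d e
    (P : set 'rV[R]_d) (Q : set 'rV[R]_e) :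
  (forall c (A B : set 'rV[R]_c), unimod_equiv A B -> Phi c A -> Phi c B) ->
  unimod_class P = unimod_class Q -> Phi d P -> Phi e Q.
Proof.
move=> inv h PhiP; have : unimod_class Q (existT _ e Q).
  by exists Q => //; apply: unimod_equiv_refl.
rewrite -h => -[S PS SQ]; have PhiS := inv _ _ _ PS PhiP.
pose Psi (x : {c : nat & set 'rV[R]_c}) := Phi (projT1 x) (projT2 x).
have : Psi (existT (fun c => set 'rV[R]_c) d S) by [].
by rewrite SQ.
Qed.

Lemma unimod_class_eqP d (P Q : set 'rV[R]_d) :
  unimod_equiv P Q -> unimod_class P = unimod_class Q.
Proof.
move=> PQ; apply/seteqP; split=> _ [S h <-]; exists S => //.
  exact: unimod_equiv_trans (unimod_equiv_sym PQ) h.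
exact: unimod_equiv_trans PQ h.
Qed.

End RowHulls.

(** * Barycentric coordinates of lattice points and the Ehrhart series *)

Section Barycentric.
Local Open Scope ring_scope.
Variables (R : realType) (n : nat) (A : 'M[int]_n).
Let AR : 'M[R]_n := map_mx intr A.
Hypothesis uA : AR \in unitmx.

(** Coordinates with respect to the rows of [A]. When [A] is [homog V] and [w] has
    first coordinate [m], these are [m] times the barycentric coordinates of the
    point of the simplex over which [w] lies. *)
Definition bary (w : 'rV[int]_n) : 'rV[R]_n := map_mx intr w *m invmx AR.

(** The half-open parallelepiped spanned by the rows. *)
Definition in_box (w : 'rV[int]_n) : Prop := forall i, 0 <= bary w 0 i < 1.

Lemma baryK w : bary w *m AR = map_mx intr w.
Proof. by rewrite /bary mulmxKV. Qed.

Lemma baryD w w' : bary (w + w') = bary w + bary w'.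
Proof. by rewrite /bary map_mxD mulmxDl. Qed.

Lemma baryN w : bary (- w) = - bary w.
Proof. by rewrite /bary map_mxN mulNmx. Qed.

Lemma bary_mul (a : 'rV[int]_n) : bary (a *m A) = map_mx intr a.
Proof. by rewrite /bary map_mxM -mulmxA mulmxV // mulmx1. Qed.

Lemma bary_row i : bary (row i A) = delta_mx 0 i.
Proof. by rewrite rowE bary_mul map_delta_mx. Qed.

Lemma baryE w (a : 'rV[R]_n) : a *m AR = map_mx intr w -> bary w = a.
Proof. by move=> e; rewrite /bary -e mulmxK. Qed.

Lemma bary_inj w w' : bary w = bary w' -> w = w'.
Proof.
by move=> /(congr1 (mulmx^~ AR)); rewrite !baryK => /map_intr_mx_inj.
Qed.

(** Subtract the rows with the integral parts of the coordinates as coefficients. *)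
Lemma box_reduce w : exists2 b, in_box b &
  exists a : 'rV[int]_n, bary w = bary b + map_mx intr a.
Proof.
pose a : 'rV[int]_n := \row_i Num.floor (bary w 0 i).
exists (w - a *m A); last by exists a; rewrite baryD baryN bary_mul subrK.
move=> i; rewrite baryD baryN bary_mul /a; move: (bary w) => x; rewrite !mxE.
by have := floorD1_gt (x 0 i); have := floor_le (x 0 i); rewrite intrD; lra.
Qed.

End Barycentric.

Section LatticePointCounts.
Local Open Scope classical_set_scope.
Local Open Scope ring_scope.

Definition count_set (T : choiceType) (S : set T) : nat := #|` fset_set S|.

Lemma count_set_card_eq (T U : choiceType) (S : set T) (S' : set U) :
  finite_set S -> (S #= S')%card -> count_set S = count_set S'.
Proof.
move=> /finite_setP[m Sm] SS'; rewrite /count_set (card_fset_set Sm).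
by rewrite (@card_fset_set _ S' m) //; apply: card_eq_trans Sm; rewrite card_eq_sym.
Qed.

Lemma count_set_image (T U : choiceType) (f : T -> U) (S : set T) :
  finite_set S -> injective f -> count_set (f @` S) = count_set S.
Proof.
move=> fS inj; apply: esym; apply: count_set_card_eq => //.
by rewrite card_eq_sym; apply: inj_card_eq => x y _ _; apply: inj.
Qed.

Lemma count_set_disjointU (T : choiceType) (S S' : set T) :
  finite_set S -> finite_set S' -> S `&` S' = set0 ->
  count_set (S `|` S') = (count_set S + count_set S')%N.
Proof.
move=> fS fS' dis; rewrite /count_set fset_setU // cardfsU -fset_setI // dis.
by rewrite fset_set0 cardfs0 subn0.
Qed.

Lemma count_set1 (T : choiceType) (x : T) : count_set [set x] = 1%N.
Proof. by rewrite /count_set fset_set1 cardfs1. Qed.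

Lemma count_set0 (T : choiceType) : count_set (set0 : set T) = 0%N.
Proof. by rewrite /count_set fset_set0 cardfs0. Qed.

Lemma count_set_eq1 (T : choiceType) (S : set T) :
  finite_set S -> count_set S = 1%N -> exists x, S = [set x].
Proof.
move=> fS /eqP/cardfs1P[x xE]; exists x.
by rewrite -(fset_setK fS) xE set_fset1.
Qed.

Lemma count_set_eq0 (T : choiceType) (S : set T) :
  finite_set S -> count_set S = 0%N -> S = set0.
Proof.
by move=> fS /eqP; rewrite cardfs_eq0 => /eqP e; rewrite -(fset_setK fS) e set_fset0.
Qed.

Lemma finite_bounded_int_vectors n (N : nat) :
  finite_set [set w : 'rV[int]_n | forall i, `|w 0 i| <= N%:Z].
Proof.
pose f (x : 'rV['I_(2 * N).+1]_n) : 'rV[int]_n := \row_i ((x 0 i : nat)%:Z - N%:Z).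
apply: (@sub_finite_set _ _ (range f)); last first.
  by apply: finite_image; apply: finite_finset.
move=> w wN; exists (\row_i inord (absz (w 0 i + N%:Z))) => //.
apply/rowP => i; rewrite !mxE inordK; have := wN i; lia.
Qed.

End LatticePointCounts.

Lemma homog_col0 (T : pzRingType) n d (V : 'M[T]_(n, d)) i :
  homog V i (0 : 'I_(1 + d))%R = 1%R.
Proof. by rewrite mxE; case: splitP => // j _; rewrite mxE. Qed.

Section Ehrhart.
Local Open Scope classical_set_scope.
Local Open Scope ring_scope.
Variables (R : realType) (d : nat) (V : 'M[int]_(1 + d, d)).
Let A : 'M[int]_(1 + d) := homog V.
Let AR : 'M[R]_(1 + d) := map_mx intr A.
Hypothesis uA : AR \in unitmx.

Lemma map_homog : AR = homog (map_mx intr V).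
Proof. by rewrite /AR /A /homog map_row_mx map_const_mx. Qed.

Lemma sum_bary w : \sum_i bary R A w 0 i = (w 0 0)%:~R.
Proof.
have /rowP/(_ 0) := baryK uA w; rewrite [RHS]mxE => <-.
rewrite -/AR map_homog mxE; apply: eq_bigr => i _.
by rewrite homog_col0 mulr1.
Qed.

(** The lattice points of height [m] in the cone over the simplex, restricted to
    the box in the first [j] directions. *)
Definition cone_points (j m : nat) : set 'rV[int]_(1 + d) :=
  [set w : 'rV[int]_(1 + d) | w 0 0 = m%:Z /\
    forall i, 0 <= bary R A w 0 i /\ ((i < j)%N -> bary R A w 0 i < 1)].

Lemma finite_cone_points j m : finite_set (cone_points j m).
Proof.
pose N := (\sum_i \sum_l absz (A i l))%N.
apply: sub_finite_set (finite_bounded_int_vectors (1 + d) (m * N)) => w [w0 wb] l /=.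
have bm i : bary R A w 0 i <= m%:R.
  have := sum_bary w; rewrite w0 -pmulrn => <-.
  by rewrite (bigD1 i) //= lerDl sumr_ge0 // => j' _; case: (wb j').
rewrite -(ler_int R) -[X in _ <= X]pmulrn intr_norm.
have -> : (w 0 l)%:~R = \sum_i bary R A w 0 i * (A i l)%:~R :> R.
  have /rowP/(_ l) := baryK uA w; rewrite [RHS]mxE => <-; rewrite mxE.
  by apply: eq_bigr => i _; congr (_ * _); rewrite mxE.
apply: le_trans (ler_norm_sum _ _ _) _; rewrite natrM natr_sum mulr_sumr.
apply: ler_sum => i _; rewrite normrM ger0_norm; last by case: (wb i).
apply: ler_pM => //; first by case: (wb i).
rewrite -intr_norm -abszE -pmulrn ler_nat (bigD1 l) //=; exact: leq_addr.
Qed.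

(** Adding the [j]-th row is a bijection from the points of height [m] onto those
    points of height [m.+1] whose [j]-th coordinate is at least 1. *)
Lemma cone_points_step (j : 'I_(1 + d)) m :
  count_set (cone_points j m.+1) =
  (count_set (cone_points j.+1 m.+1) + count_set (cone_points j m))%N.
Proof.
have Aj0 (w : 'rV[int]_(1 + d)) : (w + row j A) 0 0 = w 0 0 + 1.
  by rewrite mxE [X in _ + X]mxE homog_col0.
have baryR w i : bary R A (w + row j A) 0 i = bary R A w 0 i + (i == j)%:R.
  by rewrite baryD bary_row // mxE [X in _ + X]mxE eqxx.
rewrite -[count_set (cone_points j m)](@count_set_image _ _ (fun w => w + row j A)).
- rewrite -count_set_disjointU; last 1 first.
  + rewrite -subset0 => w [[_ wb] [w' [_ wb'] e]].
    have [_ /(_ (ltnSn j))] := wb j; rewrite -e baryR eqxx.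
    by have [h _] := wb' j; move: h => /=; lra.
  + congr count_set; apply/seteqP; split=> [w [w0 wb]|w [[w0 wb]|[w' [w0 wb] <-]]].
    * have [lt|ge] := ltP (bary R A w 0 j) 1.
        left; split=> // i; have [h1 h2] := wb i; split=> //.
        rewrite ltnS leq_eqVlt => /orP[/eqP e|]; last exact: h2.
        by have -> : i = j by apply: val_inj.
      right; exists (w - row j A); last by rewrite subrK.
      have eb i : bary R A (w - row j A) 0 i = bary R A w 0 i - (i == j)%:R.
        by rewrite -{2}(subrK (row j A) w) baryR addrK.
      split; first by have := Aj0 (w - row j A); rewrite subrK w0; lia.
      move=> i; rewrite eb; have [h1 h2] := wb i.
      have [->|_] := eqVneq i j; first by rewrite ltnn; split=> //; move: ge => /=; lra.
      by rewrite subr0.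
    * split=> // i; have [h1 h2] := wb i; split=> // ij; apply: h2; exact: ltnW.
    * split; first by rewrite Aj0 w0; lia.
      move=> i; rewrite baryR; have [h1 h2] := wb i.
      have [->|_] := eqVneq i j; last by rewrite addr0.
      by rewrite ltnn; split=> //; rewrite addr_ge0 //; case: (wb j).
  + exact: finite_cone_points.
  + by apply: finite_image; apply: finite_cone_points.
- exact: finite_cone_points.
- exact: addIr.
Qed.

Lemma cone_points0 j : cone_points j 0 = [set 0].
Proof.
apply/seteqP; split=> [w [w0 wb]|_ ->] /=.
  apply: (bary_inj uA); apply/rowP => i.
  have : \sum_i bary R A w 0 i == 0 by rewrite sum_bary w0.
  rewrite psumr_eq0; last by move=> l _; case: (wb l).
  move=> /allP /(_ i (mem_index_enum _)) /eqP ->.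
  by rewrite /bary map_mx0 mul0mx mxE.
split; first by rewrite mxE.
by move=> i; rewrite /bary map_mx0 mul0mx mxE lexx ltr01.
Qed.

(** The lattice points of the [m]-th dilate are the points of height [m] of the
    cone. *)
Lemma ehrhart_coef_cone m :
  ehrhart_coef (hull (map_mx intr V : 'M[R]_(1 + d, d))) m = count_set (cone_points 0 m).
Proof.
case: m => [|m]; first by rewrite cone_points0 count_set1.
set P := hull _; set S := [set z : 'rV[int]_d | dilate m.+1%:R P (int_point R z)].
pose hz (z : 'rV[int]_d) : 'rV[int]_(1 + d) := row_mx (const_mx m.+1%:Z) z.
have m0 : m.+1%:R != 0 :> R by rewrite pnatr_eq0.
have map_hz z : map_mx intr (hz z) = row_mx (const_mx m.+1%:R) (int_point R z) :> 'rV[R]__.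
  by rewrite map_row_mx map_const_mx.
have hzw (w : 'rV[int]_(1 + d)) : w 0 0 = m.+1%:Z -> hz (rsubmx w) = w.
  move=> w0; rewrite -[RHS]hsubmxK; congr row_mx; apply/matrixP => i j.
  by rewrite !mxE !ord1 -w0; congr (w _ _); apply: val_inj.
have memS z : S z <-> cone_points 0 m.+1 (hz z).
  split=> [[x /hullP[a [a0 a1] ->] e]|[z0 zb]].
    have bE : bary R A (hz z) = m.+1%:R *: a.
      apply: (baryE uA); rewrite -/AR map_homog mulmx_homog map_hz.
      rewrite -scalemxAl e; congr row_mx; apply/matrixP => i j; rewrite !mxE.
      by under eq_bigr => l _ do rewrite mxE; rewrite -mulr_sumr a1 mulr1.
    split; last by move=> i; rewrite bE mxE mulr_ge0.
    by rewrite mxE; case: splitP => // j _; rewrite mxE.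
  have sb := sum_bary (hz z); rewrite z0 -pmulrn in sb.
  have := baryK uA (hz z); rewrite -/AR map_homog mulmx_homog map_hz.
  move=> /eq_row_mx[_ bV].
  exists (m.+1%:R^-1 *: bary R A (hz z) *m map_mx intr V); last first.
    by rewrite -scalemxAl bV scalerA mulfV // scale1r.
  apply/hullP; exists (m.+1%:R^-1 *: bary R A (hz z)) => //; split=> [i|].
    by rewrite mxE mulr_ge0 ?invr_ge0 //; case: (zb i).
  under eq_bigr => i _ do rewrite mxE.
  by rewrite -mulr_sumr sb mulVf.
have SE : hz @` S = cone_points 0 m.+1.
  apply/seteqP; split=> [_ [z /memS ? <-] //|w wc].
  have e := hzw w (proj1 wc); exists (rsubmx w) => //.
  by apply/memS; rewrite e.
rewrite /ehrhart_coef /ehrhart -/(count_set S) -SE count_set_image //.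
  apply: sub_finite_set (finite_image rsubmx (finite_cone_points 0 m.+1)).
  by move=> z /memS h; exists (hz z) => //; rewrite row_mxKr.
by move=> z z' /eq_row_mx[].
Qed.

Lemma conv_mul_1subX (c : {poly int}) (e : nat -> int) n :
  \sum_(i < n.+1) ((1 - 'X) * c)`_i * e (n - i)%N =
  \sum_(i < n.+1) c`_i * e (n - i)%N -
  (if n is n'.+1 then \sum_(i < n'.+1) c`_i * e (n' - i)%N else 0).
Proof.
under eq_bigr => i _ do rewrite mulrBl mul1r coefB coefXM mulrBl.
rewrite sumrB; congr (_ - _); case: n => [|n].
  by rewrite big_ord1 mul0r.
rewrite big_ord_recl /= mul0r add0r; apply: eq_bigr => i _.
by rewrite subSS.
Qed.

(** Each factor [1 - t] restricts one more coordinate to the box. *)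
Lemma ehrhart_cone j n : (j <= 1 + d)%N ->
  \sum_(i < n.+1) ((1 - 'X) ^+ j : {poly int})`_i *
     (ehrhart_coef (hull (map_mx intr V : 'M[R]_(1 + d, d))) (n - i))%:Z
  = (count_set (cone_points j n))%:Z.
Proof.
elim: j n => [|j IH] n jd.
  rewrite expr0 big_ord_recl coef1 mul1r subn0 ehrhart_coef_cone big1 ?addr0 //.
  by move=> i _; rewrite coef1 /= mul0r.
rewrite exprS (conv_mul_1subX _ (fun m => (ehrhart_coef _ m)%:Z)) IH 1?ltnW //.
case: n => [|n]; first by rewrite !cone_points0 subr0.
rewrite IH 1?ltnW // (cone_points_step (Ordinal jd)) PoszD addrK //.
Qed.

Lemma hstar_coef (h : {poly int}) :
  is_hstar (hull (map_mx intr V : 'M[R]_(1 + d, d))) h <->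
  (size h <= d.+1)%N /\ forall m, h`_m = (count_set (cone_points (1 + d) m))%:Z.
Proof.
split=> -[sz hE]; split=> // m; first by rewrite hE (@ehrhart_cone (1 + d)).
by rewrite hE -ehrhart_cone.
Qed.

Lemma cone_points_box m w : cone_points (1 + d) m w <->
  w 0 0 = m%:Z /\ in_box R A w.
Proof.
split=> -[w0 wb]; split=> // i; first by have [-> /(_ (ltn_ord i)) ->] := wb i.
by have /andP[] := wb i.
Qed.

Lemma in_box_height w : in_box R A w -> exists2 m : nat, w 0 0 = m%:Z & (m < 1 + d)%N.
Proof.
move=> wb; have sb := sum_bary w.
have : 0 <= w 0 0.
  by rewrite -(ler_int R) -sb sumr_ge0 // => i _; case/andP: (wb i).
case: (w 0 0) sb => // m sb _; exists m => //.
rewrite -(ltr_nat R) [X in X < _](_ : _ = (Posz m)%:~R) // -sb.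
apply: (@lt_le_trans _ _ (\sum_(i < 1 + d) 1)); last first.
  by rewrite sumr_const card_ord.
apply: ltr_sum; first by apply/hasP; exists 0; rewrite // mem_index_enum.
by move=> i _; case/andP: (wb i).
Qed.

Section BoxFamily.
Variables (v k : nat).
Hypothesis k_gt0 : (0 < k)%N.

(** The rows of [F] are the barycentric coordinates of the box points, listed
    by height. *)
Definition box_family (F : nat -> 'I_(1 + d) -> R) : Prop :=
  [/\ forall N i, (N < v)%N -> 0 <= F N i < 1,
      forall N, (N < v)%N -> exists2 w : 'rV[int]_(1 + d), w 0 0 = (k * N)%:Z
        & forall i, bary R A w 0 i = F N i
    & forall w, in_box R A w -> exists2 N, (N < v)%N &
        forall i, bary R A w 0 i = F N i].

Lemma coef_hpoly m : (hpoly v k)`_m = ((k %| m) && (m %/ k < v))%N%:R.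
Proof.
rewrite coef_sum; under eq_bigr => i _ do rewrite coefXn.
have [/andP[km mv]|no] := boolP ((k %| m) && (m %/ k < v))%N.
  rewrite (bigD1 (Ordinal mv)) //= divnK // eqxx big1 ?addr0 // => i ne.
  apply/eqP; rewrite pnatr_eq0 eqb0; apply: contraNneq ne => e.
  by apply/eqP/val_inj; rewrite /= e mulnK.
rewrite big1 // => i _; apply/eqP; rewrite pnatr_eq0 eqb0; apply: contraNneq no.
by move=> ->; rewrite dvdn_mull //= mulnK.
Qed.

Lemma hstar_box_family :
  is_hstar (hull (map_mx intr V : 'M[R]_(1 + d, d))) (hpoly v k) ->
  exists F, box_family F.
Proof.
move/hstar_coef => [_ hE].
have cnt m : count_set (cone_points (1 + d) m) = ((k %| m) && (m %/ k < v))%N.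
  by have := hE m; rewrite coef_hpoly -natz => /eqP; rewrite eqr_nat => /eqP.
have exw N : exists w : 'rV[int]_(1 + d), (N < v)%N ->
    cone_points (1 + d) (k * N) = [set w].
  have [Nv|] := boolP (N < v)%N; last by exists 0.
  have [|w wE] := count_set_eq1 (finite_cone_points (1 + d) (k * N)).
    by rewrite cnt dvdn_mulr // mulKn // Nv.
  by exists w.
have [W WE] := choice exw.
have Wbox N : (N < v)%N -> cone_points (1 + d) (k * N) (W N).
  by move=> Nv; rewrite (WE N Nv).
exists (fun N i => bary R A (W N) 0 i); split.
- by move=> N i /Wbox /cone_points_box[_]; apply.
- by move=> N /Wbox /cone_points_box[w0 _]; exists (W N).
move=> w wb; have [m w0 _] := in_box_height wb.
have wc : cone_points (1 + d) m w by apply/cone_points_box.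
have /andP[km mv] : ((k %| m) && (m %/ k < v))%N.
  rewrite -[X in is_true X]negbK; apply/negP => /negPf no.
  have := count_set_eq0 (finite_cone_points (1 + d) m).
  by rewrite cnt no => /(_ erefl) e; rewrite e in wc.
exists (m %/ k)%N => // i.
by move: wc; rewrite -{1}(divnK km) mulnC (WE _ mv) => ->.
Qed.

Lemma box_family_hstar F : (0 < v)%N -> box_family F ->
  is_hstar (hull (map_mx intr V : 'M[R]_(1 + d, d))) (hpoly v k).
Proof.
move=> v0 [Fb Fw Fall].
have ht w N : (N < v)%N -> (forall i, bary R A w 0 i = F N i) -> w 0 0 = (k * N)%:Z.
  move=> Nv e; have [w' w0' e'] := Fw N Nv; rewrite -w0'; suff -> : w = w' by [].
  by apply: (bary_inj uA); apply/rowP => i; rewrite e e'.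
have Fbox w N : (N < v)%N -> (forall i, bary R A w 0 i = F N i) -> in_box R A w.
  by move=> Nv e i; rewrite e; apply: Fb.
apply/hstar_coef; split.
  (* The height of a box point is less than the number of vertices. *)
  have [w w0 e] := Fw v.-1 ltac:(lia).
  have [|m] := @in_box_height w; first by apply: (Fbox _ v.-1) => //; lia.
  rewrite w0 => -[<-] lt; apply/leq_sizeP => j dj.
  rewrite coef_hpoly; case: andP => // -[kj jv].
  have := divnK kj; move: lt jv dj; set q := (j %/ k)%N => lt jv dj jE.
  by exfalso; move: lt; rewrite ltnNge => /negP; apply; nia.
move=> m; rewrite coef_hpoly; have [/andP[km mv]|no] := boolP ((k %| m) && _)%N.
  have [w w0 e] := Fw _ mv; rewrite mulnC divnK // in w0.
  rewrite (_ : cone_points _ m = [set w]) ?count_set1 //.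
  apply/seteqP; split=> [w' /cone_points_box[w0' wb']|_ ->]; last first.
    by apply/cone_points_box; split=> //; apply: Fbox mv e.
  have [N Nv e'] := Fall w' wb'; apply: (bary_inj uA); apply/rowP => i.
  rewrite e e'; congr (F _ _); have := ht _ _ Nv e'; rewrite w0' => -[->].
  by rewrite mulKn.
rewrite (_ : cone_points _ m = set0) ?count_set0 //.
rewrite -subset0 => w /cone_points_box[w0 wb]; have [N Nv e] := Fall w wb.
move: no; have := ht _ _ Nv e; rewrite w0 => -[->].
by rewrite dvdn_mulr // mulKn // Nv.
Qed.

Lemma box_family_height F N : box_family F -> (N < v)%N -> \sum_i F N i = (k * N)%:R.
Proof.
move=> [_ Fw _] Nv; have [w w0 e] := Fw N Nv.
by have := sum_bary w; rewrite w0 -pmulrn => <-; apply: eq_bigr.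
Qed.

Lemma box_family_closed F N N' : box_family F -> (N < v)%N -> (N' < v)%N ->
  exists2 t, (t < v)%N & forall i, F N i + F N' i - F t i \is a Num.int.
Proof.
move=> [_ Fw Fall] Nv Nv'; have [w _ e] := Fw N Nv; have [w' _ e'] := Fw N' Nv'.
have [b bb [a bE]] := box_reduce uA (w + w').
have [t tv te] := Fall b bb; exists t => // i.
have /rowP/(_ i) := bE; rewrite baryD mxE [in X in _ = X -> _]mxE e e' te.
by move=> ->; rewrite addrAC subrr add0r mxE rpred_int_num.
Qed.

End BoxFamily.

End Ehrhart.

(** * Lattice pyramids *)

Section Pyramids.
Local Open Scope classical_set_scope.
Local Open Scope ring_scope.
Variable R : realType.

(** For a pyramid the last coordinate has these properties, which survive
    unimodular equivalence. *)
Definition apex_functional d (P : set 'rV[R]_d) (u : 'cV[int]_d) (c : int) : Prop :=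
  let l (x : 'rV[R]_d) := (x *m map_mx intr u) 0 0 + c%:~R in
  [/\ forall x, P x -> 0 <= l x <= 1,
      forall x y, P x -> P y -> l x = 1 -> l y = 1 -> x = y
    & exists2 x, P x & l x = 1].

Lemma Pyr_apex_functional d (P : set 'rV[R]_d) :
  exists u, apex_functional (Pyr P) u 0.
Proof.
pose u : 'cV[int]_(d + 1) := delta_mx (rshift d 0) 0.
pose apex : 'rV[R]_(d + 1) := row_mx 0 (const_mx 1).
have lE (x : 'rV[R]_(d + 1)) : (x *m map_mx intr u) 0 0 + 0%:~R = x 0 (rshift d 0).
  by rewrite addr0 /u map_delta_mx -colE mxE.
exists u.
pose C : set 'rV[R]_(d + 1) :=
  [set x : 'rV[R]_(d + 1) | 0 <= x 0 (rshift d 0) <= 1 /\ (x 0 (rshift d 0) = 1 -> x = apex)].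
have sub : Pyr P `<=` C.
  apply: conv_hull_subset.
    move=> x y t; rewrite /C /= => -[xb xa] [yb ya] /andP[t0 t1].
    have -> : (t *: x + (1 - t) *: y) 0 (rshift d 0) =
      t * x 0 (rshift d 0) + (1 - t) * y 0 (rshift d 0) by rewrite !mxE.
    move: (x 0 _) (y 0 _) xb xa yb ya => a b /andP[a0 a1] xa /andP[b0 b1] ya.
    split; first by apply/andP; split; nra.
    move=> e; have [tz|tz] := eqVneq t 0.
      by rewrite tz scale0r add0r subr0 scale1r ya //; move: e; rewrite tz; lra.
    have [to|to] := eqVneq t 1.
      by rewrite to scale1r subrr scale0r addr0 xa //; move: e; rewrite to; lra.
    have tp : 0 < t by rewrite lt_neqAle eq_sym tz.
    have tp' : 0 < 1 - t by rewrite subr_gt0 lt_neqAle to.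
    have a1' : a = 1 by nra.
    have b1' : b = 1 by nra.
    by rewrite xa // ya // -scalerDl addrC subrK scale1r.
  move=> _ [[x Px <-]|->]; rewrite /C /= ?row_mxEr ?mxE.
    by rewrite lexx ler01; split=> // /eqP; rewrite eq_sym oner_eq0.
  by rewrite lexx ler01.
split=> [x|x y|].
- by move=> /sub[h _]; rewrite /= lE.
- move=> /sub[_ xa] /sub[_ ya] ex ey.
  by rewrite (xa (etrans (esym (lE x)) ex)) (ya (etrans (esym (lE y)) ey)).
- exists apex; first by apply: subset_conv_hull; right.
  by rewrite lE row_mxEr mxE.
Qed.

Lemma iterated_pyramid_apex d (P : set 'rV[R]_d) :
  iterated_pyramid P -> exists u, apex_functional P u 0.
Proof. by case=> {}d {}P _; apply: Pyr_apex_functional. Qed.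

Lemma lattice_pyramid_apex d (P : set 'rV[R]_d) :
  is_lattice_pyramid P -> exists u c, apex_functional P u c.
Proof.
move=> [Q /iterated_pyramid_apex[u [h1 h2 [x0 Qx0 h3]]] /unimod_equiv_sym].
move=> [U [w [uU QE]]].
exists (U *m u), ((w *m u) 0 0).
have lE (x : 'rV[R]_d) : (x *m map_mx intr (U *m u)) 0 0 + ((w *m u) 0 0)%:~R =
    ((x *m map_mx intr U + int_point R w) *m map_mx intr u) 0 0 + 0%:~R.
  rewrite addr0 /int_point mulmxDl -mulmxA -!map_mxM.
  by rewrite [RHS]mxE; congr (_ + _); rewrite [RHS]mxE.
have Qx x : P x -> Q (x *m map_mx intr U + int_point R w).
  by move=> Px; rewrite QE; exists x.
have inj x y : x *m map_mx intr U + int_point R w = y *m map_mx intr U + int_point R w ->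
    x = y :> 'rV[R]_d.
  move=> /addIr /(congr1 (mulmx^~ (map_mx intr (invmx U)))).
  by rewrite -!mulmxA -!map_mxM mulmxV // map_mx1 !mulmx1.
split.
- by move=> x Px; rewrite lE; apply: h1; apply: Qx.
- by move=> x y Px Py; rewrite !lE => ex ey; apply: inj; apply: h2; rewrite ?Qx //; apply: Qx.
- by move: Qx0 h3; rewrite QE => -[x Px <-] e; exists x => //; rewrite lE.
Qed.

Variables (d : nat) (V : 'M[int]_(1 + d, d)).
Let A : 'M[int]_(1 + d) := homog V.
Hypothesis uA : (map_mx intr A : 'M[R]_(1 + d)) \in unitmx.
Let P : set 'rV[R]_d := hull (map_mx intr V).

Lemma homog_mul_col m (u : 'cV[int]_d) (c : int) (W : 'M[int]_(m, d)) :
  homog W *m col_mx (const_mx c) u = W *m u + const_mx c.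
Proof.
rewrite mul_row_col addrC; congr (_ + _); apply/matrixP => i j.
by rewrite !mxE big_ord1 !mxE mul1r.
Qed.

(** The functional is 0 or 1 at every vertex and 1 at exactly one of them, so it is
    a barycentric coordinate. *)
Lemma pyramid_integral_column :
  is_lattice_pyramid P ->
  exists j, forall w, bary R A w 0 j \is a Num.int.
Proof.
move=> /lattice_pyramid_apex[u [c [h1 h2 [x0 Px0 h3]]]].
pose l i : int := (V *m u) i 0 + c.
have lE i : (row i (map_mx intr V) *m map_mx intr u) 0 0 + c%:~R = (l i)%:~R :> R.
  by rewrite /l intrD; congr (_ + _); rewrite -row_mul -map_mxM [LHS]mxE [LHS]mxE.
have l01 i : l i = 0 \/ l i = 1.
  have := h1 _ (row_hull i : P _); rewrite lE -[0]/(0%:~R) -[1]/(1%:~R) !ler_int; lia.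
have [j lj] : exists j, l j = 1.
  apply: contrapT => no; have l0 i : l i = 0.
    by have [//|e] := l01 i; case: no; exists i.
  move: Px0 h3 => /hullP[a [a0 a1] ->].
  suff -> : (a *m map_mx intr V *m map_mx intr u) 0 0 + c%:~R = 0 :> R.
    by move/eqP; rewrite eq_sym oner_eq0.
  have cE : c%:~R = \sum_i a 0 i * c%:~R :> R by rewrite -mulr_suml a1 mul1r.
  rewrite -mulmxA -map_mxM mxE cE -big_split big1 //= => i _.
  by rewrite [X in _ * X]mxE -mulrDr -intrD -/(l i) l0 mulr0.
have lD i : l i = (i == j)%:R.
  have [->//|ij] := eqVneq i j; have [//|li] := l01 i.
  have rij : row i (map_mx intr V) = row j (map_mx intr V) :> 'rV[R]_d.
    by apply: h2; rewrite ?lE ?li ?lj //; apply: row_hull.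
  exfalso; have := bary_row uA i; have := bary_row uA j.
  have -> : row i A = row j A.
    apply/rowP => m; rewrite !mxE; case: splitP => q _; rewrite ?mxE //.
    by move/rowP/(_ q): rij; rewrite !mxE => /intr_inj.
  by move=> -> /rowP /(_ i); rewrite !mxE !eqxx (negPf ij) => /eqP; rewrite eq_sym oner_eq0.
exists j => w.
have At : map_mx intr A *m map_mx intr (col_mx (const_mx c) u) = delta_mx j 0 :> 'cV[R]__.
  rewrite -map_mxM homog_mul_col; apply/matrixP => i i'; rewrite ord1 mxE.
  have -> : (V *m u + const_mx c) i 0 = l i by rewrite mxE [X in _ + X]mxE.
  by rewrite lD mxE eqxx andbT; case: (i == j).
have : bary R A w *m delta_mx j 0 = map_mx intr (w *m col_mx (const_mx c) u) :> 'M[R]_1.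
  by rewrite -At mulmxA baryK // map_mxM.
move/matrixP/(_ 0 0); rewrite -colE mxE => ->.
by rewrite mxE rpred_int_num.
Qed.

(** The Smith normal form of a primitive column is a unit times the first basis
    vector. *)
Lemma primitive_completion n (u : 'cV[int]_n) (x : 'rV[int]_n) (j : 'I_n) :
  (x *m u) 0 0 = 1 -> exists2 U : 'M[int]_n, U \in unitmx & U *m delta_mx j 0 = u.
Proof.
case: n u x j => [|n] u x j xu1; first by case: j.
have [L uL [S uS [s _ uE]]] := int_Smith_normal_form u.
pose g : int := s`_0 * S 0 0.
have uE' : u = g *: (L *m delta_mx 0 0).
  rewrite uE -mulmxA scalemxAr; congr (L *m _); apply/matrixP => i i'.
  rewrite !ord1 !mxE big_ord1 !mxE eqxx andbT /g; case: i => -[|i] /= _.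
    by rewrite mulr1n mulr1.
  by rewrite mulr0n mul0r mulr0.
have ug : g \is a GRing.unit.
  apply/unitrP; exists ((x *m (L *m (delta_mx 0 0 : 'cV[int]_n.+1))) 0 0).
  move: xu1; rewrite uE' -scalemxAr mxE => e; split=> //.
  by rewrite mulrC.
exists (g *: L *m tperm_mx 0 j).
  by rewrite unitmx_mul unitmxZ // uL unitmx_perm.
rewrite -colE -xcolE; apply/matrixP => i i'.
by rewrite uE' -colE !mxE tpermR.
Qed.

End Pyramids.

Section PyramidOfIntegralColumn.
Local Open Scope classical_set_scope.
Local Open Scope ring_scope.
Variables (R : realType) (d : nat) (W : 'M[int]_(1 + (d + 1), d + 1)) (i : 'I_(1 + (d + 1))).

Lemma Pyr_hull :
  row i W = row_mx 0 (const_mx 1) ->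
  (forall j, j != i -> W j (rshift d 0) = 0) ->
  Pyr (hull (map_mx intr (row' i (lsubmx W)) : 'M[R]__)) = hull (map_mx intr W).
Proof.
move=> Wi Wj.
have rowi : row i (map_mx intr W) = row_mx 0 (const_mx 1) :> 'rV[R]_(d + 1).
  rewrite -map_row Wi map_row_mx map_mx0 map_const_mx.
  by congr row_mx.
have rowj j : row (lift i j) (map_mx intr W) =
    row_mx (row j (map_mx intr (row' i (lsubmx W)))) 0 :> 'rV[R]_(d + 1).
  apply/rowP => q; rewrite !mxE; case: splitP => l lE; rewrite !mxE.
    by congr (_ _ _)%:~R; apply: val_inj.
  have -> : q = rshift d 0 by apply: val_inj; rewrite /= lE ord1.
  by rewrite Wj ?mulr0z // eq_sym neq_lift.
apply/seteqP; split; apply: conv_hull_subset; try exact: conv_hull_convex.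
  move=> _ [[x Px <-]|->]; last by rewrite -rowi; apply: row_hull.
  apply: (@conv_hull_subset _ _ _ [set x | hull (map_mx intr W) (row_mx x (0 : 'rV[R]_1))]) Px.
    move=> y z t hy hz t01; have := conv_hull_convex hy hz t01.
    by rewrite !scale_row_mx !scaler0 add_row_mx addr0.
  by move=> _ [j _ <-]; rewrite /= -rowj; apply: row_hull.
move=> _ [j _ <-]; apply: subset_conv_hull.
case: (unliftP i j) => [j' ->|->]; last by right.
by left; exists (row j' (map_mx intr (row' i (lsubmx W)))); [apply: row_hull|rewrite rowj].
Qed.

End PyramidOfIntegralColumn.

Section IntegralColumnPyramid.
Local Open Scope classical_set_scope.
Local Open Scope ring_scope.
Variable R : realType.

(** A barycentric coordinate that is integral on lattice points is the last
    coordinate in a suitable lattice basis. *)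
Lemma integral_column_pyramid d (V : 'M[int]_(1 + d, d)) i :
  (map_mx intr (homog V) : 'M[R]_(1 + d)) \in unitmx -> (0 < d)%N ->
  (forall w, bary R (homog V) w 0 i \is a Num.int) ->
  is_lattice_pyramid (hull (map_mx intr V : 'M[R]_(1 + d, d))).
Proof.
move=> uA d0 bint; have [d' dE] : exists d', d = (d' + 1)%N by exists d.-1; lia.
clear d0; subst d; rename d' into d.
set A := homog V in uA bint.
pose t : 'cV[int]_(1 + (d + 1)) :=
  \col_q Num.floor (bary R A (delta_mx 0 q) 0 i).
have tE : map_mx intr t = invmx (map_mx intr A) *m delta_mx i 0 :> 'cV[R]__.
  apply/matrixP => q z; rewrite ord1 -colE [RHS]mxE [LHS]mxE [t _ _]mxE floorK //.
  by rewrite /bary map_delta_mx -rowE mxE.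
have At : A *m t = delta_mx i 0.
  have : map_mx intr (A *m t) = map_mx intr (delta_mx i 0) :> 'cV[R]__.
    by rewrite map_mxM tE mulmxA mulmxV // mul1mx map_delta_mx.
  exact: map_intr_mx_inj.
pose u := dsubmx t; pose c := usubmx t 0 0.
have Vu j : (row j V *m u) 0 0 + c = (j == i)%:R.
  have := congr1 (fun X : 'cV[int]__ => X j 0) At; rewrite [RHS]mxE eqxx andbT => <-.
  rewrite -[t]vsubmxK -[usubmx t](_ : const_mx c = _); last first.
    by apply/matrixP => a b; rewrite !ord1 mxE.
  rewrite /A homog_mul_col -row_mul mxE [RHS]mxE; congr (_ + _).
  by rewrite mxE.
have Vsub j j' : ((row j V - row j' V) *m u) 0 0 = (j == i)%:R - (j' == i)%:R.
  rewrite mulmxBl -(Vu j) -(Vu j') [LHS]mxE [X in _ + X = _]mxE.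
  by rewrite opprD addrACA subrr addr0.
have [j0 j0i] : exists j, i != j.
  by exists (lift i (rshift d 0)); apply: neq_lift.
have prim : ((row i V - row j0 V) *m u) 0 0 = 1.
  by rewrite Vsub eqxx eq_sym (negPf j0i) subr0.
have [U uU Ue] := primitive_completion (rshift d 0) prim.
pose e : 'rV[int]_(d + 1) := row_mx 0 (const_mx 1).
pose W := affine_image V U (e - row i V *m U).
have rowW j : row j W = (row j V - row i V) *m U + e.
  rewrite /W /affine_image linearD /= row_mul mulmxBl -addrA; congr (_ + _).
  rewrite [RHS]addrC; apply/rowP => q; rewrite mxE mxE big_ord1 [const_mx _ _ _]mxE mul1r.
  by [].
exists (hull (map_mx intr W)); last first.
  apply: unimod_equiv_sym; exists U, (e - row i V *m U); split=> //.
  by rewrite /int_point image_hull -map_affine_image.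
rewrite -(@Pyr_hull R d W i).
- by apply: IterPyr1; apply: hull_lattice_polytope.
- by rewrite rowW subrr mul0mx add0r.
move=> j ji; have -> : W j (rshift d 0) = row j W 0 (rshift d 0) by rewrite [RHS]mxE.
rewrite rowW [LHS]mxE (_ : e 0 (rshift d 0) = 1); last by rewrite row_mxEr mxE.
have -> : ((row j V - row i V) *m U) 0 (rshift d 0) = ((row j V - row i V) *m u) 0 0.
  by rewrite -Ue mulmxA -colE [RHS]mxE.
by rewrite Vsub eqxx (negPf ji) /= sub0r addNr.
Qed.

End IntegralColumnPyramid.

(** * Gorenstein simplices *)

Section Gorenstein.
Local Open Scope classical_set_scope.
Local Open Scope ring_scope.
Variables (R : realType) (d : nat) (V : 'M[int]_(1 + d, d)).
Let A : 'M[int]_(1 + d) := homog V.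
Let AR : 'M[R]_(1 + d) := map_mx intr A.
Hypothesis uA : AR \in unitmx.
Let VR : 'M[R]_(1 + d, d) := map_mx intr V.

(* The point [w0] will become the origin, [r] is its height and [X] has the
   vertices of the translated dilate as rows. *)
Variables (q : 'I_(1 + d) -> nat) (w0 : 'rV[int]_(1 + d)).
Hypothesis q_gt0 : forall i, (0 < q i)%N.
Hypothesis q_int : forall w i, (q i)%:R * bary R A w 0 i \is a Num.int.
Hypothesis w0_bary : forall i, bary R A w0 0 i = (q i)%:R^-1.

Let qinv : 'rV[R]_(1 + d) := \row_i (q i)%:R^-1.
Let r : nat := absz (w0 0 0).
Let z0 : 'rV[R]_d := map_mx intr (rsubmx w0).
Let B1 : 'M[R]_(d, 1 + d) := dsubmx (invmx AR).
Let X : 'M[R]_(1 + d, d) := affine_image VR r%:R%:M (- z0).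
Let facet : 'M[R]_(1 + d, d) := \matrix_(i, l) (- (q i)%:R * B1 l i).
Let Q : set 'rV[R]_d := hull X.

Lemma q_gt0R i : 0 < (q i)%:R :> R. Proof. by rewrite ltr0n. Qed.

Lemma qinv_eq : bary R A w0 = qinv.
Proof. by apply/rowP => i; rewrite w0_bary mxE. Qed.

Lemma sum_qinv : \sum_i qinv 0 i = r%:R.
Proof.
have s := sum_bary uA w0; rewrite qinv_eq in s.
have : 0 <= w0 0 0.
  by rewrite -(ler_int R) -s sumr_ge0 // => i _; rewrite mxE invr_ge0.
by rewrite s /r; case: (w0 0 0).
Qed.

Lemma r_gt0 : 0 < r%:R :> R.
Proof.
rewrite -sum_qinv (bigD1 0) //= ltr_wpDr ?sumr_ge0 // => [i _|].
  by rewrite mxE invr_ge0.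
by rewrite mxE invr_gt0 q_gt0R.
Qed.

Lemma simplex_rows : X = r%:R *: VR - const_mx 1 *m z0.
Proof. by rewrite /X /affine_image mul_mx_scalar mulmxN. Qed.

Lemma mul_const1 n (a : 'rV[R]_n) : a *m const_mx 1 = (\sum_i a 0 i)%:M :> 'M[R]_1.
Proof.
apply/matrixP => i j; rewrite !ord1 !mxE eqxx mulr1n.
by apply: eq_bigr => l _; rewrite mxE mulr1.
Qed.

Lemma homogE : AR = homog VR. Proof. exact: map_homog. Qed.

Lemma qinvV : qinv *m VR = z0.
Proof.
have := baryK uA w0; rewrite qinv_eq -/AR homogE mulmx_homog.
by rewrite -[in X in _ = X -> _](hsubmxK w0) map_row_mx => /eq_row_mx[].
Qed.

Lemma inv_homog : B1 *m const_mx 1 = 0 :> 'cV[R]_d /\ B1 *m VR = 1%:M.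
Proof.
have := mulVmx uA; rewrite -/AR [X in _ *m X]homogE -[invmx _]vsubmxK -/B1.
rewrite mul_col_row [1%:M](@scalar_mx_block _ 1 d) => /eq_block_mx[_ _ h1 h2].
by [].
Qed.

Lemma V_B1 : VR *m B1 = 1%:M - const_mx 1 *m usubmx (invmx AR).
Proof.
have := mulmxV uA; rewrite -/AR [X in X *m _]homogE -{1}[invmx _]vsubmxK.
by rewrite mul_row_col => <-; rewrite addrC addKr.
Qed.

Lemma X_B1 : X *m B1 = r%:R%:M - const_mx 1 *m qinv.
Proof.
rewrite simplex_rows mulmxBl -scalemxAl V_B1 scalerBr scalemx1 -mulmxA -qinvV -mulmxA V_B1.
rewrite [qinv *m _]mulmxBr mulmx1 [qinv *m (_ *m _)]mulmxA mul_const1 sum_qinv.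
by rewrite mul_scalar_mx mulmxBr scalemxAr opprB addrA subrK.
Qed.

(** The inequalities say that the coordinates of the point shifted back by [w0] are
    nonnegative. *)
Lemma simplex_halfspaces x :
  Q x <-> forall i, 0 <= (x *m B1) 0 i + qinv 0 i.
Proof.
have [B1c B1V] := inv_homog; have r0 := r_gt0.
split=> [/hullP[a [a0 a1] ->] i|h].
  rewrite -mulmxA X_B1 mulmxBr mul_mx_scalar mulmxA mul_const1 a1 mul1mx.
  by rewrite -[X in 0 <= X](_ : (r%:R *: a) 0 i = _) ?mxE ?mulr_ge0 // subrK.
apply/hullP; exists (r%:R^-1 *: (x *m B1 + qinv)).
  split=> [i|]; first by rewrite mxE [X in _ * X]mxE mulr_ge0 ?invr_ge0.
  have -> : \sum_i (r%:R^-1 *: (x *m B1 + qinv)) 0 i =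
      r%:R^-1 * (\sum_i (x *m B1) 0 i + \sum_i qinv 0 i).
    by rewrite -big_split mulr_sumr; apply: eq_bigr => i _; rewrite mxE [X in _ * X]mxE.
  have -> : \sum_i (x *m B1) 0 i = 0.
    have := mul_const1 (x *m B1); rewrite -mulmxA B1c mulmx0.
    by move=> /matrixP /(_ 0 0); rewrite [LHS]mxE [RHS]mxE eqxx mulr1n => <-.
  by rewrite add0r sum_qinv mulVf // gt_eqF.
rewrite simplex_rows mulmxBr -scalemxAr -scalemxAl scalerA mulfV ?gt_eqF // scale1r.
rewrite mulmxDl qinvV -mulmxA B1V mulmx1 -scalemxAl mulmxA mulmxDl -mulmxA B1c.
by rewrite mulmx0 add0r mul_const1 sum_qinv mul_scalar_mx scalerA mulVf ?gt_eqF // scale1r addrK.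
Qed.

Lemma facet_dot (x : 'rV[R]_d) i :
  \sum_l x 0 l * (row i facet) 0 l = - ((q i)%:R * (x *m B1) 0 i).
Proof.
rewrite mxE mulr_sumr -sumrN; apply: eq_bigr => l _.
by rewrite /facet !mxE; ring.
Qed.

Lemma facet_le1 (x : 'rV[R]_d) i :
  (\sum_l x 0 l * (row i facet) 0 l <= 1) = (0 <= (x *m B1) 0 i + qinv 0 i).
Proof.
rewrite facet_dot -(pmulr_rge0 (_ + _) (q_gt0R i)) mulrDr [qinv 0 i]mxE.
rewrite mulfV ?gt_eqF ?q_gt0R //; move: (_ * _) => a; apply/idP/idP; lra.
Qed.

(** At the origin all inequalities hold with the slack [1 / q i]. *)
Lemma simplex_interior : interior Q 0.
Proof.
pose qS : R := \sum_i (q i)%:R; pose bS : R := 1 + \sum_i \sum_l `|B1 l i|.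
have b0 : 0 < bS.
  by rewrite ltr_wpDr // sumr_ge0 // => i _; apply: sumr_ge0.
have q0 : 0 < qS.
  rewrite /qS (bigD1 0) //= ltr_wpDr ?q_gt0R // sumr_ge0 // => i _; exact: ltW (q_gt0R i).
have e0 : 0 < (qS * bS)^-1 by rewrite invr_gt0 mulr_gt0.
apply/nbhs_ballP; exists (qS * bS)^-1 => //= x [_ xb].
apply/simplex_halfspaces => i.
have xl l : `|x 0 l| <= (qS * bS)^-1.
  by have := xb 0 l; rewrite /ball /= mxE sub0r normrN => /ltW.
have : `|(x *m B1) 0 i| <= qS^-1.
  rewrite mxE; apply: le_trans (ler_norm_sum _ _ _) _.
  apply: (@le_trans _ _ ((qS * bS)^-1 * bS)); last first.
    by rewrite invfM -mulrA mulVf ?gt_eqF // mulr1.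
  apply: (@le_trans _ _ (\sum_l (qS * bS)^-1 * `|B1 l i|)).
    by apply: ler_sum => l _; rewrite normrM ler_wpM2r.
  rewrite -mulr_sumr ler_wpM2l ?(ltW e0) // /bS [in leRHS](bigD1 i) //=.
  rewrite addrCA lerDl addr_ge0 // sumr_ge0 // => j _; exact: sumr_ge0.
have : qS^-1 <= qinv 0 i.
  rewrite mxE lef_pV2 ?posrE ?q_gt0R // /qS (bigD1 i) //= lerDl.
  by apply: sumr_ge0.
by rewrite ler_norml => h /andP[h' _]; lra.
Qed.

(** A point of the dual is the combination of the facet normals whose coefficients
    are proportional to its slack at the opposite vertices. *)
Lemma dual_simplex : dual_polytope Q = hull facet.
Proof.
have [B1c B1V] := inv_homog; have r0 := r_gt0.
apply/seteqP; split=> [y yd|].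
  have yX j : 0 <= 1 - (X *m y^T) j 0.
    have := yd (row j X) (row_hull j); rewrite subr_ge0; apply: etrans.
    congr (_ <= _); rewrite mxE; apply: eq_bigr => l _.
    by rewrite [(row j X) _ _]mxE [y^T _ _]mxE.
  pose c : 'rV[R]_(1 + d) := \row_j (r%:R^-1 * qinv 0 j * (1 - (X *m y^T) j 0)).
  have qX : qinv *m X = 0.
    rewrite simplex_rows mulmxBr -scalemxAr qinvV mulmxA mul_const1 sum_qinv mul_scalar_mx.
    by rewrite subrr.
  apply/hullP; exists c.
    split=> [i|].
      by rewrite mxE mulr_ge0 // mulr_ge0 ?invr_ge0 ?(ltW r0) // mxE invr_ge0.
    have : (qinv *m X *m y^T) 0 0 = 0 by rewrite qX mul0mx mxE.
    rewrite -mulmxA mxE => qXy.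
    have -> : \sum_i c 0 i = r%:R^-1 * (\sum_i qinv 0 i - \sum_i qinv 0 i * (X *m y^T) i 0).
      by rewrite -sumrB mulr_sumr; apply: eq_bigr => i _; rewrite [LHS]mxE; ring.
    by rewrite qXy subr0 sum_qinv mulVf // gt_eqF.
  have -> : c *m facet = r%:R^-1 *: ((y *m X^T - const_mx 1) *m B1^T).
    apply/rowP => l; rewrite [LHS]mxE [RHS]mxE [X in _ = _ * X]mxE mulr_sumr.
    apply: eq_bigr => i _; rewrite [c _ _]mxE [facet _ _]mxE [qinv _ _]mxE.
    rewrite [B1^T _ _]mxE [(_ - const_mx 1) _ _]mxE [(- const_mx 1) _ _]mxE [const_mx 1 _ _]mxE.
    have -> : (y *m X^T) 0 i = (X *m y^T) i 0.
      have -> : y *m X^T = (X *m y^T)^T by rewrite trmx_mul trmxK.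
      by rewrite [LHS]mxE.
    have := gt_eqF (q_gt0R i); move: (_ i 0) (B1 l i) => a b qn.
    by field; rewrite qn gt_eqF.
  have cB : const_mx 1 *m B1^T = 0 :> 'rV[R]_d.
    by apply: trmx_inj; rewrite trmx_mul trmxK trmx_const B1c trmx0.
  rewrite mulmxBl cB subr0 -mulmxA -trmx_mul.
  have -> : B1 *m X = r%:R%:M.
    by rewrite simplex_rows mulmxBr -scalemxAr B1V mulmxA B1c mul0mx subr0 scalemx1.
  by rewrite tr_scalar_mx mul_mx_scalar scalerA mulVf ?gt_eqF // scale1r.
apply: conv_hull_subset.
  move=> y z t hy hz /andP[t0 t1] x Qx.
  have -> : \sum_i x 0 i * (t *: y + (1 - t) *: z) 0 i =
      t * (\sum_i x 0 i * y 0 i) + (1 - t) * (\sum_i x 0 i * z 0 i).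
    rewrite !mulr_sumr -big_split; apply: eq_bigr => i _ /=.
    by rewrite [X in _ * X]mxE [(t *: y) _ _]mxE [((1 - t) *: z) _ _]mxE; ring.
  by have := hy x Qx; have := hz x Qx; nra.
by move=> _ [i _ <-] x /simplex_halfspaces h; rewrite facet_le1.
Qed.

Lemma facet_integral : exists Z : 'M[int]_(1 + d, d), facet = map_mx intr Z.
Proof.
exists (\matrix_(i, l) Num.floor (facet i l)).
apply/matrixP => i l; rewrite [RHS]mxE [X in _ = X%:~R]mxE floorK // /facet mxE.
rewrite mulNr rpredN; have := q_int (delta_mx 0 (rshift 1 l)) i.
by rewrite /bary map_delta_mx -rowE [(row _ _) _ _]mxE [B1 _ _]mxE.
Qed.

(** The simplex is cut out by integral inequalities [<x, facet> <= 1] around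
    the lattice point with barycentric coordinates [1 / q i]. *)
Lemma gorenstein_of_inverse_coordinates : is_gorenstein (hull VR).
Proof.
have XZ : X = map_mx intr (affine_image V (r%:Z)%:M (- rsubmx w0)).
  by rewrite map_affine_image map_scalar_mx map_mxN.
exists r, Q; split.
- by rewrite -(ltr_nat R) r_gt0.
- split; first by rewrite /Q XZ; apply: hull_lattice_polytope.
    exact: simplex_interior.
  have [Z ZE] := facet_integral.
  by rewrite dual_simplex ZE; apply: hull_lattice_polytope.
exists 1%:M, (- rsubmx w0); split; first exact: unitmx1.
rewrite /Q /X -image_hull; apply/seteqP; split=> [_ [x Px <-]|_ [_ [x Px <-] <-]].
  exists (r%:R *: x); first by exists x.
  by rewrite /int_point map_mxN map_mx1 mulmx1 mul_mx_scalar.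
by exists x => //; rewrite /int_point map_mxN map_mx1 mulmx1 mul_mx_scalar.
Qed.

End Gorenstein.

(** * Realizing a code by a simplex *)

Section BlockMaps.

Lemma exists_block_map (s : nat) (sz : nat -> nat) :
  exists blk : 'I_(\sum_(j < s) sz j) -> nat,
    (forall i, (blk i < s)%N) /\
    forall j, (j < s)%N -> #|[pred i | blk i == j]| = sz j.
Proof.
elim: s => [|s [blk [blk_lt cblk]]].
  by exists (fun=> 0%N); split=> // i; have := ltn_ord i; rewrite [X in (_ < X)%N]big_ord0.
rewrite big_ord_recr /=.
exists (fun i => if fintype.split i is inl i' then blk i' else s).
have splitl n m (i : 'I_n) : fintype.split (lshift m i) = inl i by apply: (unsplitK (inl i)).
have splitr n m (i : 'I_m) : fintype.split (rshift n i) = inr i by apply: (unsplitK (inr i)).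
split=> [i|j js].
  by case: (fintype.split i) => // i'; apply: ltnW; rewrite ltnS.
rewrite -sum1_card big_split_ord /=.
rewrite (eq_bigl (fun i => blk i == j)) => [|i]; last by rewrite inE splitl.
rewrite [X in (_ + X)%N](eq_bigl (fun=> s == j)) => [|i]; last by rewrite inE splitr.
move: js; rewrite ltnS leq_eqVlt => /orP[/eqP ->|js].
  rewrite eqxx big_pred0 => [|i]; last by have := blk_lt i; case: ltngtP.
  by rewrite add0n sum1_card card_ord.
rewrite [X in (_ + X)%N]big_pred0 => [|i]; last by rewrite gtn_eqF.
by rewrite addn0 sum1_card cblk.
Qed.

Lemma exists_representatives n s (blk : 'I_n -> nat) (x : 'I_n) :
  (forall j, (j < s)%N -> (1 < #|[pred i | blk i == j]|)%N) ->
  exists rep : nat -> 'I_n, forall j, (j < s)%N -> blk (rep j) = j /\ rep j != x.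
Proof.
move=> c2; have h j : exists i : 'I_n, (j < s)%N -> blk i = j /\ i != x.
  have [js|] := boolP (j < s)%N; last by exists x.
  have : (0 < #|[pred i | (blk i == j) && (i != x)]|)%N.
    have := c2 j js; rewrite (cardD1 x) inE => lt.
    rewrite (eq_card (B := [predD1 [pred i | blk i == j] & x])); last first.
      by move=> i; rewrite !inE andbC.
    by rewrite -(ltn_add2l (blk x == j)) addn0; apply: leq_ltn_trans lt; case: (_ == _).
  by case/card_gt0P => i; rewrite inE => /andP[/eqP bi ix]; exists i.
by have [rep repP] := choice h; exists rep.
Qed.

End BlockMaps.

Section Realization.
Local Open Scope classical_set_scope.
Local Open Scope ring_scope.
Variables (R : realType) (v k s : nat) (M p : nat -> nat).
Hypothesis code : is_code v s M p.
Hypothesis k_gt0 : (0 < k)%N.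

Variables (d : nat) (blk : 'I_(1 + d) -> nat) (rep : nat -> 'I_(1 + d)).
Hypothesis blk_lt : forall i, (blk i < s)%N.
Hypothesis card_blk : forall j, (j < s)%N ->
  #|[pred i | blk i == j]| = block_size k s M p j.
Hypothesis blk_rep : forall j, (j < s)%N -> blk (rep j) = j.
Hypothesis rep_neq0 : forall j, (j < s)%N -> rep j != 0.

Definition is_rep i := i == rep (blk i).

Lemma is_rep_rep j : (j < s)%N -> is_rep (rep j).
Proof. by move=> js; rewrite /is_rep blk_rep. Qed.

Definition parent_coord (x : 'rV[R]_(1 + d)) (j : nat) : R :=
  if (p j < s)%N then x 0 (rep (p j)) else 0.

(** The barycentric coordinates that the lattice points are to have. *)
Definition block_lattice (x : 'rV[R]_(1 + d)) : Prop :=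
  (forall i, x 0 i - x 0 (rep (blk i)) \is a Num.int) /\
  (forall j, (j < s)%N ->
     (radix M j)%:R * x 0 (rep j) - parent_coord x j \is a Num.int).

(** The columns are the conditions that define the lattice, one for each coordinate. *)
Definition block_matrix : 'M[int]_(1 + d) := \matrix_(a, i)
  if is_rep i then (radix M (blk i))%:Z * (a == i)%:R
       - ((p (blk i) < s)%N && (a == rep (p (blk i))))%:R
  else (a == i)%:R - (a == rep (blk i))%:R.

Lemma mul_block_matrix (x : 'rV[R]_(1 + d)) i :
  (x *m map_mx intr block_matrix) 0 i =
  if is_rep i then (radix M (blk i))%:R * x 0 i - parent_coord x (blk i)
  else x 0 i - x 0 (rep (blk i)).
Proof.
have pick (i' : 'I_(1 + d)) : \sum_a x 0 a * (a == i')%:R = x 0 i'.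
  rewrite (bigD1 i') //= eqxx mulr1 big1 ?addr0 // => a /negPf ->.
  by rewrite mulr0.
rewrite mxE; case: ifP => ri.
  transitivity (\sum_a ((radix M (blk i))%:R * (x 0 a * (a == i)%:R) -
     x 0 a * ((p (blk i) < s)%N && (a == rep (p (blk i))))%:R)).
    apply: eq_bigr => a _; rewrite mxE mxE ri.
    rewrite intrB intrM -!pmulrn; case: (_ == i); case: (_ && _) => /=; ring.
  rewrite sumrB -mulr_sumr pick /parent_coord; congr (_ - _); case: ifP => _ /=.
    exact: pick.
  by rewrite big1 // => a _; rewrite mulr0.
transitivity (\sum_a (x 0 a * (a == i)%:R - x 0 a * (a == rep (blk i))%:R)).
  apply: eq_bigr => a _; rewrite mxE mxE ri.
  by rewrite intrB -mulrBr; case: (_ == i); case: (_ == _).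
by rewrite sumrB !pick.
Qed.

Lemma block_latticeP x :
  block_lattice x <-> forall i, (x *m map_mx intr block_matrix) 0 i \is a Num.int.
Proof.
split=> [[h1 h2] i|h].
  rewrite mul_block_matrix; case: ifP => // /eqP ri.
  by have := h2 _ (blk_lt i); rewrite -ri.
split=> [i|j js].
  have := h i; rewrite mul_block_matrix; case: ifP => // /eqP <- _.
  by rewrite subrr rpred0.
by have := h (rep j); rewrite mul_block_matrix is_rep_rep // blk_rep.
Qed.

Lemma block_matrix_unit : (map_mx intr block_matrix : 'M[R]_(1 + d)) \in unitmx.
Proof.
rewrite -row_free_unit; apply: inj_row_free => x x0.
have h i : (if is_rep i then (radix M (blk i))%:R * x 0 i - parent_coord x (blk i)
  else x 0 i - x 0 (rep (blk i))) = 0 by rewrite -mul_block_matrix x0 mxE.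
have r0 j : (j <= s)%N -> (j < s)%N -> x 0 (rep j) = 0.
  elim/(parent_ind code): j / => [|j js IH _]; first by rewrite ltnn.
  have := h (rep j); rewrite is_rep_rep // blk_rep // /parent_coord => /eqP.
  case: ifP => [ps|_].
    rewrite (IH ps) subr0 mulf_eq0 (negPf (radix_neq0 R code js)) /=.
    by move/eqP.
  by rewrite subr0 mulf_eq0 (negPf (radix_neq0 R code js)) /= => /eqP.
apply/rowP => i; rewrite [RHS]mxE; have := h i; case: ifP => [/eqP ->|_].
  by rewrite r0 // ltnW.
by rewrite r0 ?subr0 // ltnW.
Qed.

(** The heights of the lattice basis dual to the columns. *)
Definition block_heights : 'cV[int]_(1 + d) :=
  \col_i if is_rep i then (k * M (blk i))%:Z else 1.

Lemma sum_reps (G : nat -> int) :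
  \sum_(i | is_rep i) G (blk i) = \sum_(j < s) G j.
Proof.
rewrite (reindex_onto (fun j : 'I_s => rep j) (fun i => Ordinal (blk_lt i))) /=.
  apply: eq_big => [j|j _]; last by rewrite blk_rep.
  by rewrite is_rep_rep //=; apply/eqP/val_inj; rewrite /= blk_rep.
by move=> i /eqP.
Qed.

(** Below a representative the entries of the product telescope by the choice of the
    block sizes. *)
Lemma block_matrix_heights : block_matrix *m block_heights = const_mx 1.
Proof.
apply/matrixP => a z; rewrite ord1 [RHS]mxE mxE {z}.
transitivity (\sum_i ((a == i)%:R * (if is_rep i then (k * M (blk i).+1)%:Z else 1)
  - (if is_rep i then ((p (blk i) < s)%N && (a == rep (p (blk i))))%:R * (k * M (blk i))%:Z
     else (a == rep (blk i))%:R))).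
  apply: eq_bigr => i _; rewrite !mxE; case: ifP => _.
    rewrite (code_MS code (blk_lt i)); case: (a == i); case: (_ && _) => /=; lia.
  by rewrite mulr1 mulr1.
rewrite sumrB (bigD1 a) //= eqxx mul1r big1 ?addr0; last first.
  by move=> i /negPf; rewrite eq_sym => ->; rewrite mul0r.
rewrite (bigID is_rep) /=.
rewrite (eq_bigr (fun i => ((p (blk i) < s)%N && (a == rep (p (blk i))))%:R
   * (k * M (blk i))%:Z)); last by move=> i ->.
rewrite (sum_reps (fun j => ((p j < s)%N && (a == rep (p j)))%:R * (k * M j)%:Z)).
rewrite [X in _ - (_ + X)](eq_bigr (fun i => (a == rep (blk i))%:R)); last first.
  by move=> i /negPf ->.
have [ra|nra] := boolP (is_rep a); last first.
  rewrite !big1 ?addr0 ?subr0 // => i _.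
    case: eqP => // ai; case/negP: nra; rewrite ai; exact: is_rep_rep.
  case: ltnP => //= pi; first case: eqP => // ai; rewrite ?mul0r //.
  by case/negP: nra; rewrite ai; apply: is_rep_rep.
set j := blk a; have js : (j < s)%N by apply: blk_lt.
have aE : a = rep j by apply/eqP.
have repE l : (l < s)%N -> (a == rep l) = (l == j).
  move=> ls; apply/eqP/eqP => [e|->]; last exact: aE.
  by rewrite -(blk_rep ls) -e.
have -> : \sum_(l < s) ((p l < s)%N && (a == rep (p l)))%:R * (k * M l)%:Z =
    (k * \sum_(l < s | p l == j) M l)%N%:Z.
  rewrite [X in (k * X)%N]big_mkcond big_distrr /= -[RHS]natz natr_sum; apply: eq_bigr => l _.
  have -> : (p l < s)%N && (a == rep (p l)) = (p l == j).
    case: ltnP => [ps|sp] /=; first by rewrite repE.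
    by apply/esym/eqP => e; rewrite e leqNgt js in sp.
  by case: eqP => _; rewrite ?mul1r ?mul0r ?muln0 // natz.
have -> : \sum_(i | ~~ is_rep i) (a == rep (blk i))%:R = (block_size k s M p j)%:Z - 1.
  rewrite -(card_blk js) -sum1_card [in RHS](bigD1 a) /=; last by rewrite inE.
  rewrite PoszD addrC addKr -natz natr_sum big_mkcond [RHS]big_mkcond.
  apply: eq_bigr => i _; rewrite repE // inE.
  case: eqP => [bi|_] /=; last by case: ifP.
  by rewrite /is_rep bi -aE; case: (i == a).
have := parent_sum_lt code js; have := code_MS code js.
have := code_radix_gt1 code js; rewrite /block_size.
move: (\sum_(l < s | _) M l)%N (M j) (M j.+1) (radix M j) => S a1 b1 c1 h1 h2 h3.
have : (S <= b1)%N by nia.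
rewrite mulnBr => Sb; have := leq_mul (leqnn k) Sb; lia.
Qed.

Definition block_vertices : 'M[int]_(1 + d, d) := rsubmx block_matrix.

(** Replacing the first column by the combination of all columns with the heights
    as coefficients yields ones. The first height is 1, so this is unimodular. *)
Lemma block_homog : exists2 C : 'M[int]_(1 + d), C \in unitmx &
  homog block_vertices = block_matrix *m C.
Proof.
have h0 : block_heights 0 0 = 1.
  rewrite mxE; case: ifP => // /eqP e; have := rep_neq0 (blk_lt 0).
  by rewrite -e eqxx.
pose C : 'M[int]_(1 + d) := row_mx block_heights (col_mx 0 1%:M).
exists C.
  have -> : C = block_mx 1%:M 0 (dsubmx block_heights) 1%:M.
    rewrite /C block_mxEh; congr row_mx; rewrite -[LHS]vsubmxK; congr col_mx.
    apply/matrixP => i j; rewrite !ord1 [RHS]mxE eqxx -h0 mxE.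
    by congr (block_heights _ _); apply: val_inj.
  by rewrite unitmxE (@det_lblock _ 1 d) !det1 mulr1 unitr1.
rewrite /C mul_mx_row block_matrix_heights; congr row_mx.
by rewrite -[in RHS](hsubmxK block_matrix) mul_row_col mulmx0 add0r mulmx1.
Qed.

Lemma block_homog_unit : (map_mx intr (homog block_vertices) : 'M[R]_(1 + d)) \in unitmx.
Proof.
have [C uC ->] := block_homog; rewrite map_mxM unitmx_mul block_matrix_unit /=.
exact: map_intr_unitmx.
Qed.

Let A : 'M[int]_(1 + d) := homog block_vertices.

Lemma block_lattice_bary x :
  block_lattice x <-> exists w, bary R A w = x.
Proof.
have [C uC AE] := block_homog; have uA := block_homog_unit; split.
  move=> /block_latticeP h.
  pose z : 'rV[int]_(1 + d) := \row_i Num.floor ((x *m map_mx intr block_matrix) 0 i).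
  have zE : map_mx intr z = x *m map_mx intr block_matrix.
    by apply/rowP => i; rewrite [LHS]mxE [z _ _]mxE floorK.
  exists (z *m C); apply: (baryE uA).
  by rewrite /A AE map_mxM mulmxA -zE -map_mxM.
move=> [w <-]; apply/block_latticeP => i.
have -> : bary R A w *m map_mx intr block_matrix = map_mx intr (w *m invmx C).
  have -> : block_matrix = A *m invmx C by rewrite /A AE mulmxK.
  by rewrite map_mxM mulmxA baryK // map_mxM.
by rewrite mxE rpred_int_num.
Qed.

Definition block_family (N : nat) (i : 'I_(1 + d)) : R := colv R s M p (blk i) N.

Lemma block_family_lattice N :
  block_lattice (\row_i block_family N i).
Proof.
split=> [i|j js].
  by rewrite !mxE /block_family blk_rep // subrr rpred0.
rewrite mxE /block_family blk_rep // (radix_colv R code) //.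
have -> : parent_coord (\row_i block_family N i) j = colv R s M p (p j) N.
  rewrite /parent_coord; case: ifP => ps; first by rewrite mxE /block_family blk_rep.
  have -> : p j = s by have := parent_le code js; move: ps; lia.
  by rewrite colv_root.
by rewrite addrK nat_num_int.
Qed.

(** A box point of the lattice is recovered from its digits, the integers by which
    the relations between blocks and parents fail to be equalities. *)
Lemma block_box_family : box_family block_vertices v k block_family.
Proof.
have uA := block_homog_unit; split.
- by move=> N i Nv; apply: (colv_bound R code); apply: ltnW.
- move=> N Nv; have [w wE] := proj1 (block_lattice_bary _) (block_family_lattice N).
  have wi i : bary R A w 0 i = block_family N i by rewrite wE mxE.
  exists w => //; apply: (@intr_inj R); rewrite -(sum_bary uA) /=.
  rewrite (eq_bigr _ (fun i _ => wi i)) -pmulrn -(sum_block_colv R code) //.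
  rewrite (sum_by_block blk_lt (fun j => colv R s M p j N)).
  by apply: eq_bigr => j _; rewrite card_blk.
move=> w wb; have [h1 h2] : block_lattice (bary R A w).
  by apply/block_lattice_bary; exists w.
set x := bary R A w in h1 h2.
pose y j : R := if (j < s)%N then x 0 (rep j) else 0.
have yb j : 0 <= y j < 1 by rewrite /y; case: ifP => _; [apply: wb|rewrite lexx ltr01].
have dig j : exists e : nat, (j < s)%N ->
    (e < radix M j)%N /\ (radix M j)%:R * y j = e%:R + y (p j).
  have [js|] := boolP (j < s)%N; last by exists 0%N.
  have := h2 j js; rewrite -[parent_coord x j]/(y (p j)).
  have m0 := radix_gt0 R code js.
  have -> : x 0 (rep j) = y j by rewrite /y js.
  have /andP[a0 a1] := yb j; have /andP[b0 b1] := yb (p j).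
  move=> int; have : 0 <= (radix M j)%:R * y j - y (p j).
    by apply: int_num_ge0 int _; have := mulr_ge0 (ltW m0) a0; lra.
  move: int => /intrP[[e|e] eE]; last by rewrite eE ler0z.
  move=> _; exists e => _; split; last by rewrite [e%:R]pmulrn -eE subrK.
  rewrite -(ltr_nat R) [e%:R]pmulrn -eE.
  have : (radix M j)%:R * y j < (radix M j)%:R by rewrite gtr_pMr.
  by move: b0; lra.
have [D DP] := choice dig.
have ys : y s = 0 by rewrite /y ltnn.
have Dlt j : (j < s)%N -> (D j < radix M j)%N by move=> /DP[].
have Drel j : (j < s)%N -> (radix M j)%:R * y j = (D j)%:R + y (p j) by move=> /DP[].
exists (\sum_(l < s) D l * M l)%N.
  by have [_ <- _ _] := code; apply: (mixed_radix_lt code).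
move=> i; rewrite /block_family (colv_of_digits code ys Dlt Drel) ?(ltnW (blk_lt i)) //.
rewrite /y blk_lt; apply/eqP; rewrite -subr_eq0; apply/eqP/int_num_eq0 => //.
by have := wb i; have := wb (rep (blk i)); rewrite -/x; lra.
Qed.

(** The coordinates [1 / n], with [n] the product of the radices on the way to the
    root, satisfy the lattice relations, and [n] clears all denominators. *)
Lemma block_gorenstein : is_gorenstein (hull (map_mx intr block_vertices : 'M[R]_(1 + d, d))).
Proof.
(* The product of the radices from a block to the root. *)
pose nn := root_fold s p 1%N (fun j n => radix M j * n)%N.
have nns : nn s = 1%N by apply: root_fold_root.
have nnE j : (j < s)%N -> nn j = (radix M j * nn (p j))%N.
  by move=> js; rewrite /nn (root_fold_step code).
have nn0 j : (j <= s)%N -> (0 < nn j)%N.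
  elim/(parent_ind code): j / => [|j js IH]; first by rewrite nns.
  by rewrite nnE // muln_gt0 IH andbT; have := code_radix_gt1 code js; lia.
have nnR j : (j <= s)%N -> (nn j)%:R != 0 :> R.
  by move=> js; rewrite pnatr_eq0 -lt0n nn0.
have [w0 w0E] : exists w, bary R A w = \row_i (nn (blk i))%:R^-1.
  apply/block_lattice_bary; split=> [i|j js].
    by rewrite !mxE blk_rep // subrr rpred0.
  rewrite mxE blk_rep // nnE // natrM invfM mulrA mulfV ?(radix_neq0 R code js) //.
  rewrite mul1r /parent_coord; case: ifP => ps.
    by rewrite mxE blk_rep // subrr rpred0.
  have -> : p j = s by have := parent_le code js; move: ps; lia.
  by rewrite nns invr1 subr0 rpred1.
apply: (@gorenstein_of_inverse_coordinates R d block_vertices block_homog_unit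
  (fun i => nn (blk i)) w0).
- by move=> i; apply/nn0/ltnW.
- move=> w i; have [h1 h2] : block_lattice (bary R A w).
    by apply/block_lattice_bary; exists w.
  rewrite -/A; set x := bary R A w in h1 h2 *.
  have rint j : (j <= s)%N -> (j < s)%N -> (nn j)%:R * x 0 (rep j) \is a Num.int.
    elim/(parent_ind code): j / => [|j js IH _]; first by rewrite ltnn.
    have -> : (nn j)%:R * x 0 (rep j) = (nn (p j))%:R *
        ((radix M j)%:R * x 0 (rep j) - parent_coord x j)
        + (nn (p j))%:R * parent_coord x j by rewrite nnE // natrM; ring.
    apply: rpredD; first by apply: rpredM; [exact: nat_num_int|exact: h2].
    rewrite /parent_coord.
    by case: ifP => [/IH //|_]; rewrite mulr0 rpred0.
  have -> : (nn (blk i))%:R * x 0 i = (nn (blk i))%:R * (x 0 i - x 0 (rep (blk i)))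
      + (nn (blk i))%:R * x 0 (rep (blk i)) by ring.
  apply: rpredD; last by apply: rint => //; apply: ltnW.
  by apply: rpredM; [exact: nat_num_int|exact: h1].
by move=> i; rewrite -/A w0E mxE.
Qed.

(** The box point [M j] has the coordinate [1 / radix M j] in the block [j]. *)
Lemma block_not_pyramid :
  ~ is_lattice_pyramid (hull (map_mx intr block_vertices : 'M[R]_(1 + d, d))).
Proof.
move=> /(pyramid_integral_column block_homog_unit)[i int].
have js := blk_lt i; have Mv : (M (blk i) < v)%N.
  by have [_ <- _ _] := code; apply: (code_M_lt code).
have [_ Fw _] := block_box_family; have [w _ wE] := Fw _ Mv.
have := int w; rewrite -/A wE => iF.
have /eqP := colv_M_neq0 R code js; apply.
apply: int_num_eq0 iF _; have := colv_bound R code (M (blk i)) (ltnW js).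
by rewrite /block_family; lra.
Qed.

End Realization.

Section RealizationTheorem.
Local Open Scope classical_set_scope.
Local Open Scope ring_scope.
Variable R : realType.

Definition simplex_has_code v k s M p d (P : set 'rV[R]_d) : Prop :=
  exists (V : 'M[int]_(1 + d, d)) (F : nat -> 'I_(1 + d) -> R) blk,
    [/\ (map_mx intr (homog V) : 'M[R]_(1 + d)) \in unitmx,
        P = hull (map_mx intr V), box_family V v k F & has_code v F s M p blk].

Lemma code_realization v k s M p : is_code v s M p -> (0 < k)%N -> (1 < v)%N ->
  exists d (P : set 'rV[R]_d), admissible v k P /\ simplex_has_code v k s M p P.
Proof.
move=> code k0 v1; have [blk [blk_lt cblk]] := exists_block_map s (block_size k s M p).
have s0 : (0 < s)%N.
  by case: s code {blk blk_lt cblk} => // -[M0 Ms _ _]; move: v1; rewrite -Ms M0.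
have n2 : (1 < \sum_(j < s) block_size k s M p j)%N.
  rewrite (bigD1 (Ordinal s0)) //=; have := block_size_ge code k s0; lia.
move: blk blk_lt cblk; move: (\sum_(j < s) _)%N n2 => n n2.
have [d ->] : exists d, n = (1 + d)%N by exists n.-1; lia.
move=> blk blk_lt cblk.
have [|rep repP] := @exists_representatives _ s blk 0.
  by move=> j js; rewrite cblk //; have := block_size_ge code k js; lia.
have blk_rep j : (j < s)%N -> blk (rep j) = j by move=> /repP[].
have rep_neq0 j : (j < s)%N -> rep j != 0 by move=> /repP[].
pose V := block_vertices s M p blk rep.
have uA := block_homog_unit R code k0 blk_lt cblk blk_rep rep_neq0.
have bf := block_box_family R code k0 blk_lt cblk blk_rep rep_neq0.
exists d, (hull (map_mx intr V)); split; last first.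
  exists V, (block_family R s M p blk), blk; split=> //; split=> //.
  by move=> j js; exists (rep j); apply: blk_rep.
split.
- by apply/lattice_simplexP; exists V => //; rewrite -map_homog.
- exact: (block_gorenstein R code k0 blk_lt cblk blk_rep rep_neq0).
- exact: (block_not_pyramid code k0 blk_lt cblk blk_rep rep_neq0).
- by apply: box_family_hstar bf => //; apply: ltnW.
Qed.

End RealizationTheorem.

(** * Codes classify admissible simplices *)

Section CodeOfSimplex.
Local Open Scope classical_set_scope.
Local Open Scope ring_scope.
Variable R : realType.

(** A coordinate that vanishes at all box points would make the simplex a pyramid. *)
Lemma admissible_has_code v k d (P : set 'rV[R]_d) :
  (0 < k)%N -> (1 < v)%N -> admissible v k P ->
  exists s M p, simplex_has_code v k s M p P.
Proof.
move=> k0 v1 [/lattice_simplexP[V uV PE] _ npyr hst].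
have uA : (map_mx intr (homog V) : 'M[R]_(1 + d)) \in unitmx by rewrite map_homog.
rewrite PE in npyr hst; have [F bf] := hstar_box_family uA k0 hst.
have [Fb Fw Fall] := bf.
have sys : box_system v k F.
  split=> //.
  - by move=> N Nv; apply: (box_family_height uA bf).
  - by move=> N N' Nv Nv'; apply: (box_family_closed uA bf).
  move=> i; apply: contrapT => no; apply: npyr.
  apply: (integral_column_pyramid (i := i) uA).
    rewrite lt0n; apply/eqP => d0; subst d.
    have := box_family_height uA bf v1; rewrite muln1 big_ord_recl big_ord0 addr0.
    have := Fb 1%N ord0 v1; have : 1 <= k%:R :> R by rewrite ler1n.
    by lra.
  move=> w; have [b bb [a bE]] := box_reduce uA w.
  have [t tv tE] := Fall b bb.
  have -> : bary R (homog V) w 0 i = F t i + (a 0 i)%:~R.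
    by rewrite bE mxE tE [X in _ + X]mxE.
  have -> : F t i = 0 by apply/eqP; apply: contrapT => /negP nz; apply: no; exists t.
  by rewrite add0r rpred_int_num.
have [s [M [p [blk hc]]]] := box_system_code k0 (ltnW v1) sys.
by exists s, M, p, V, F, blk; split.
Qed.

Lemma simplex_code v k s M p d (P : set 'rV[R]_d) :
  simplex_has_code v k s M p P -> is_code v s M p.
Proof. by move=> [V [F [blk [_ _ _ [code _ _ _]]]]]. Qed.

Lemma homog_affine_image n d (V : 'M[int]_(n, d)) U w :
  homog (affine_image V U w) = homog V *m block_mx 1%:M w 0 U.
Proof.
rewrite /homog /affine_image mul_row_block mulmx1 mulmx0 addr0.
by rewrite [V *m U + _]addrC.
Qed.

(** A unimodular map extends to the cone, where it preserves heights and
    barycentric coordinates. *)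
Lemma simplex_has_code_equiv v k s M p d (P Q : set 'rV[R]_d) :
  unimod_equiv P Q -> simplex_has_code v k s M p P -> simplex_has_code v k s M p Q.
Proof.
move=> [U [w [uU ->]]] [V [F [blk [uA -> [Fb Fw Fall] hc]]]].
pose C : 'M[int]_(1 + d) := block_mx 1%:M w 0 U.
have uC : C \in unitmx by rewrite unitmxE (@det_ublock _ 1 d) det1 mul1r -unitmxE.
have AE := homog_affine_image V U w; rewrite -/C in AE.
have uA' : (map_mx intr (homog (affine_image V U w)) : 'M[R]_(1 + d)) \in unitmx.
  by rewrite AE map_mxM unitmx_mul uA map_intr_unitmx.
have baryC z : bary R (homog (affine_image V U w)) (z *m C) = bary R (homog V) z.
  by apply: (baryE uA'); rewrite AE !map_mxM mulmxA baryK.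
have C0 (z : 'rV[int]_(1 + d)) : (z *m C) 0 0 = z 0 0.
  rewrite -[z]hsubmxK /C mul_row_block mulmx1 mulmx0 addr0.
  by rewrite !mxE; case: splitP => // j _.
exists (affine_image V U w), F, blk; split=> //.
  by rewrite /int_point image_hull -map_affine_image.
split=> //.
- move=> N Nv; have [z z0 zE] := Fw N Nv.
  by exists (z *m C); rewrite ?C0 // => i; rewrite baryC.
move=> z zb; have [|N Nv NE] := Fall (z *m invmx C).
  by move=> i; rewrite -baryC mulmxKV.
by exists N => // i; rewrite -NE -baryC mulmxKV.
Qed.

Lemma perm_of_fibres n (f g : 'I_n -> nat) :
  (forall j, #|[pred i | f i == j]| = #|[pred i | g i == j]|) ->
  exists sigma : 'S_n, forall i, g (sigma i) = f i.
Proof.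
move=> h; have /tuple_permP[sigma sE] : perm_eq [tuple f i | i < n] [tuple g i | i < n].
  apply/allP => j _ /=; rewrite !count_map; apply/eqP.
  have e (q : 'I_n -> nat) : count (preim q (pred1 j)) (enum 'I_n) = #|[pred i | q i == j]|.
    by rewrite -sum1_count -sum1_card big_enum_cond; apply: eq_bigl => i; rewrite inE.
  by have := h j; rewrite -!e enumT.
exists sigma => i; have := congr1 (fun t => nth 0%N t i) sE.
rewrite (nth_map i) ?size_enum_ord // nth_ord_enum => ->.
by rewrite -[X in nth _ _ X]/(nat_of_ord i) (nth_map i) ?size_enum_ord // nth_ord_enum tnth_mktuple.
Qed.

(** The matrix relating two simplices whose lattice points have the same barycentric
    coordinates is integral with integral inverse, and it preserves heights. *)
Lemma lattice_matrix_unimodular d (V W : 'M[int]_(1 + d, d)) :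
  (map_mx intr (homog V) : 'M[R]_(1 + d)) \in unitmx ->
  (map_mx intr (homog W) : 'M[R]_(1 + d)) \in unitmx ->
  (forall w, exists w', bary R (homog V) w = bary R (homog W) w') ->
  (forall w, exists w', bary R (homog W) w = bary R (homog V) w') ->
  exists U w, U \in unitmx /\ W = affine_image V U w.
Proof.
move=> uV uW VW WV.
have trans (A B : 'M[int]_(1 + d)) : (map_mx intr A : 'M[R]_(1 + d)) \in unitmx ->
    (map_mx intr B : 'M[R]_(1 + d)) \in unitmx ->
    (forall w, exists w', bary R A w = bary R B w') -> exists C, B = A *m C.
  move=> uA uB AB; have [f fE] := choice AB.
  exists (\matrix_l f (delta_mx 0 l)).
  apply: (@map_intr_mx_inj R); rewrite map_mxM -[LHS]mul1mx -(mulmxV uA) -mulmxA; congr (_ *m _).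
  apply/row_matrixP => l; rewrite row_mul -map_row rowK.
  by rewrite -(baryK uB (f _)) -fE /bary map_delta_mx -rowE.
have [C CE] := trans _ _ uV uW VW; have [D DE] := trans _ _ uW uV WV.
have uC : C \in unitmx.
  have CD : C *m D = 1%:M.
    have e : map_mx intr (homog V) *m map_mx intr (C *m D) = map_mx intr (homog V) :> 'M[R]_(1 + d).
      by rewrite -map_mxM mulmxA -CE -DE.
    have : map_mx intr (C *m D) = 1%:M :> 'M[R]_(1 + d).
      by rewrite -(mulKmx uV (map_mx _ (C *m D))) e mulVmx.
    by move=> e'; apply: (@map_intr_mx_inj R); rewrite e' map_mx1.
  by have [] := mulmx1_unit CD.
have C0 : lsubmx C = col_mx 1%:M 0.
  have e : homog V *m lsubmx C = homog V *m col_mx 1%:M 0.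
    have := congr1 lsubmx CE; rewrite -[C in X in _ = X -> _]hsubmxK mul_mx_row.
    by rewrite /homog !row_mxKl mul_row_col mulmx1 mulmx0 addr0 => <-.
  have e' : map_mx intr (lsubmx C) = map_mx intr (col_mx 1%:M 0) :> 'M[R]_(1 + d, 1).
    rewrite -(mulKmx uV (map_mx _ (lsubmx C))) -map_mxM e map_mxM.
    by rewrite mulKmx.
  exact: map_intr_mx_inj e'.
have Cblk : C = block_mx 1%:M (usubmx (rsubmx C)) 0 (dsubmx (rsubmx C)).
  by rewrite block_mxEh -C0 vsubmxK hsubmxK.
exists (dsubmx (rsubmx C)), (usubmx (rsubmx C)); split.
  move: uC; rewrite !unitmxE.
  by rewrite {1}Cblk (@det_ublock _ 1 d) det1 mul1r.
have := CE; rewrite [X in _ *m X]Cblk -homog_affine_image /homog => /eq_row_mx[_].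
by [].
Qed.

(** Equal block sizes allow a matching of the vertices for which the box points have
    the same barycentric coordinates. *)
Lemma same_code_equiv v k s M p d (P Q : set 'rV[R]_d) :
  simplex_has_code v k s M p P -> simplex_has_code v k s M p Q -> unimod_equiv P Q.
Proof.
move=> [V [F [blk [uV -> bf [code blk_lt surj FE]]]]].
move=> [W [G [blk' [uW -> bf' [_ blk_lt' surj' GE]]]]].
have card (X : 'M[int]_(1 + d, d)) (H : nat -> 'I_(1 + d) -> R) b :
    (map_mx intr (homog X) : 'M[R]_(1 + d)) \in unitmx -> box_family X v k H ->
    (forall i, (b i < s)%N) -> (forall N i, (N < v)%N -> H N i = colv R s M p (b i) N) ->
    forall j, (j < s)%N -> #|[pred i | b i == j]| = block_size k s M p j.
  move=> uX bX b_lt HE; apply: (card_block (R := R) code b_lt) => N Nv.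
  rewrite -(box_family_height uX bX Nv); apply: eq_bigr => i _.
  by rewrite HE.
have [sigma sE] : exists sigma : 'S_(1 + d), forall i, blk' (sigma i) = blk i.
  apply: perm_of_fibres => j; have [js|sj] := ltnP j s.
    by rewrite (card V F blk) // (card W G blk').
  by rewrite !eq_card0 // => i; rewrite inE; apply/negP => /eqP e;
    [have := blk_lt' i|have := blk_lt i]; rewrite e ltnNge sj.
pose W' := row_perm sigma W.
have W'E : homog W' = perm_mx sigma *m homog W.
  rewrite -row_permE; apply/matrixP => i j; rewrite !mxE.
  by case: splitP => q _; rewrite ?mxE.
have uW' : (map_mx intr (homog W') : 'M[R]_(1 + d)) \in unitmx.
  by rewrite W'E map_mxM unitmx_mul uW map_intr_unitmx // unitmx_perm.
have baryW w i : bary R (homog W') w 0 i = bary R (homog W) w 0 (sigma i).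
  have -> : bary R (homog W) w = bary R (homog W') w *m perm_mx sigma.
    apply: (baryE uW).
    have <- : map_mx intr (perm_mx sigma) = perm_mx sigma :> 'M[R]_(1 + d).
      by rewrite map_perm_mx.
    by rewrite -mulmxA -map_mxM -W'E baryK.
  rewrite -[in RHS](invgK sigma) -col_permE.
  by rewrite [RHS]mxE invgK permK.
have hullW : hull (map_mx intr W) = hull (map_mx intr W') :> set 'rV[R]_d.
  apply: eq_hull => i.
    exists ((sigma^-1)%g i); apply/rowP => j; rewrite !mxE permKV //.
  by exists (sigma i); apply/rowP => j; rewrite !mxE.
have [Fb Fw Fall] := bf; have [Gb Gw Gall] := bf'.
have [|| U [w [uU WE]]] := @lattice_matrix_unimodular d V W' uV uW'.
- move=> w; have [b bb [a bE]] := box_reduce uV w.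
  have [t tv tE] := Fall b bb; have [z _ zE] := Gw t tv.
  exists (z + a *m homog W'); rewrite baryD bary_mul // bE; congr (_ + _).
  by apply/rowP => i; rewrite baryW zE tE FE // GE // sE.
- move=> w; have [b bb [a bE]] := box_reduce uW' w.
  have bb' : in_box R (homog W) b.
    by move=> i; have := bb ((sigma^-1)%g i); rewrite baryW permKV.
  have [t tv tE] := Gall b bb'; have [z _ zE] := Fw t tv.
  exists (z + a *m homog V); rewrite baryD bary_mul // bE; congr (_ + _).
  by apply/rowP => i; rewrite baryW zE tE FE // GE // sE.
exists U, w; split=> //.
by rewrite hullW WE map_affine_image -image_hull.
Qed.

Lemma code_dimension v k s M p d (P : set 'rV[R]_d) :
  simplex_has_code v k s M p P -> (1 + d)%N = (\sum_(j < s) block_size k s M p j)%N.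
Proof.
move=> [V [F [blk [uV _ bf [code blk_lt _ FE]]]]].
have cb := card_block (R := R) code blk_lt (k := k).
apply/eqP; rewrite -(eqr_nat R) natr_sum.
have <- : \sum_(i < 1 + d) (1 : R) = (1 + d)%:R by rewrite sumr_const card_ord.
rewrite (sum_by_block blk_lt (fun=> 1 : R)); apply/eqP; apply: eq_bigr => j _.
rewrite mulr1 cb // => N Nv; rewrite -(box_family_height uV bf Nv).
by apply: eq_bigr => i _; rewrite FE.
Qed.

Lemma same_code_class v k s M p d e (P : set 'rV[R]_d) (Q : set 'rV[R]_e) :
  simplex_has_code v k s M p P -> simplex_has_code v k s M p Q ->
  unimod_class P = unimod_class Q.
Proof.
move=> hP hQ; have := code_dimension hP; rewrite -(code_dimension hQ).
move=> /eqP; rewrite eqn_add2l => /eqP de; subst e.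
by apply: unimod_class_eqP; apply: same_code_equiv hP hQ.
Qed.

(** The vertices are determined up to order, hence so is the set of columns. *)
Lemma simplex_code_unique v k s M p s' M' p' d (P : set 'rV[R]_d) :
  (0 < k)%N -> simplex_has_code v k s M p P -> simplex_has_code v k s' M' p' P ->
  [/\ s = s', forall j, (j <= s)%N -> M j = M' j
    & forall j, (j < s)%N -> p j = p' j].
Proof.
move=> k0 [V [F [blk [uV PV bf [code blk_lt surj FE]]]]].
move=> [W [G [blk' [uW PW bf' [code' blk_lt' surj' GE]]]]].
have hVW : hull (map_mx intr V) = hull (map_mx intr W) :> set 'rV[R]_d by rewrite -PV PW.
have [||sigma sE] := hull_rows_perm _ _ hVW; rewrite -?map_homog //.
have rowE' i : row i (homog W) = row (sigma i) (homog V).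
  apply/rowP => j; rewrite !mxE; case: splitP => q _; rewrite ?mxE //.
  by have /rowP/(_ q) := sE i; rewrite !mxE => /intr_inj.
have s_inj : injective sigma.
  move=> i i' e; have : row i (homog W) = row i' (homog W) by rewrite !rowE' e.
  move=> /(congr1 (bary R (homog W))); rewrite !bary_row // => /rowP /(_ i).
  rewrite !mxE !eqxx /=; case: eqP => // _ /eqP; by rewrite oner_eq0.
have baryE' w i : bary R (homog V) w 0 (sigma i) = bary R (homog W) w 0 i.
  have -> : bary R (homog V) w = \sum_l bary R (homog W) w 0 l *: delta_mx 0 (sigma l).
    apply: (baryE uV); rewrite -(baryK uW) [RHS]mulmx_sum_row mulmx_suml.
    apply: eq_bigr => l _; rewrite -scalemxAl -rowE; congr (_ *: _).
    by rewrite -!map_row rowE'.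
  rewrite summxE (bigD1 i) //= big1 => [|l li].
    by rewrite mxE [X in _ * X]mxE !eqxx mulr1 addr0.
  by rewrite mxE [X in _ * X]mxE (inj_eq s_inj) eq_sym (negPf li) andbF mulr0.
have [_ Fw _] := bf; have [_ _ Gall] := bf'.
have [Fb _ _] := bf.
have FG N i : (N < v)%N -> F N (sigma i) = G N i.
  move=> Nv; have [w w0 wE] := Fw N Nv.
  have wb : in_box R (homog W) w by move=> l; rewrite -baryE' wE; apply: Fb.
  have [N' Nv' NE] := Gall w wb.
  have NN : N' = N.
    have := sum_bary uW w; rewrite (eq_bigr _ (fun l _ => NE l)).
    rewrite (box_family_height uW bf' Nv') w0 -pmulrn => /eqP.
    by rewrite eqr_nat eqn_pmul2l // => /eqP.
  by rewrite NN in NE; rewrite -(NE i) -baryE' wE.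
apply: (code_unique (R := R) code code').
- move=> j js; have [i bi] := surj j js; exists (blk' (invF s_inj i)) => // N Nv.
  by rewrite -bi -FE // -GE // -FG // f_invF.
- move=> j' js'; have [i bi] := surj' j' js'; exists (blk (sigma i)) => // N Nv.
  by rewrite -bi -FE // -GE // -FG.
Qed.

End CodeOfSimplex.

(** * Counting codes *)

Section FiniteCodes.
Local Open Scope nat_scope.
Variable v : nat.

Definition chain_fun s (c : {ffun 'I_s.+1 -> divlat v}) (j : nat) : nat :=
  ssval (c (inord j)).

Definition parent_fun s (q : {ffun 'I_s -> 'I_s.+1}) (j : nat) : nat :=
  if insub j is Some i then q i : nat else s.

Definition is_parent s (q : {ffun 'I_s -> 'I_s.+1}) : bool :=
  [forall i : 'I_s, i < q i].

Definition code_at s : finType :=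
  {x : {ffun 'I_s.+1 -> divlat v} * {ffun 'I_s -> 'I_s.+1} |
     is_strict_chain x.1 && is_parent x.2}.

Definition finite_code : finType := {s : 'I_v.+1 & code_at s}.

Lemma parent_funE s (q : {ffun 'I_s -> 'I_s.+1}) (i : 'I_s) : parent_fun q i = q i.
Proof. by rewrite /parent_fun valK. Qed.

Lemma chain_funE s (c : {ffun 'I_s.+1 -> divlat v}) (i : 'I_s.+1) :
  chain_fun c i = ssval (c i).
Proof. by rewrite /chain_fun inord_val. Qed.

Hypothesis v_gt0 : 0 < v.

Lemma code_at_is_code s (x : code_at s) :
  is_code v s (chain_fun (val x).1) (parent_fun (val x).2).
Proof.
case: x => -[c q] /= /andP[/and3P[/eqP c0 /eqP cs /forallP cstep] /forallP qp].
split=> [||j js|j js].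
- by rewrite -c0 -[0]/(val (@ord0 s)) chain_funE.
- by rewrite -[RHS]cs -[X in chain_fun _ X]/(val (@ord_max s)) chain_funE.
- have := cstep (Ordinal js); rewrite /divlat_le -!chain_funE /= /bump leq0n add1n.
  move=> /andP[dv ne]; split=> //; rewrite ltn_neqAle; apply/andP; split; last first.
    apply: dvdn_leq dv; apply: (dvdn_gt0 v_gt0).
    by rewrite dvdn_divisors //; apply: ssvalP.
  apply: contra ne => /eqP e; apply/eqP/val_inj.
  by rewrite -[LHS]chain_funE -[RHS]chain_funE /= /bump leq0n add1n e.
rewrite -[j]/(val (Ordinal js)) parent_funE qp /=.
by rewrite -ltnS.
Qed.

Lemma code_at_inj s (x y : code_at s) :
  (forall j, j <= s -> chain_fun (val x).1 j = chain_fun (val y).1 j) ->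
  (forall j, j < s -> parent_fun (val x).2 j = parent_fun (val y).2 j) -> x = y.
Proof.
move=> hM hp; apply: val_inj; case: (val x) (val y) hM hp => [c q] [c' q'] /= hM hp.
congr pair; apply/ffunP => i; apply: val_inj.
  by rewrite -[LHS]chain_funE -[RHS]chain_funE hM // -ltnS.
by rewrite -[LHS]parent_funE -[RHS]parent_funE hp.
Qed.

(** The members of the chain increase strictly. *)
Lemma code_length_lt s M p : is_code v s M p -> s < v.
Proof.
move=> code; have [_ <- _ _] := code.
suff H j : j <= s -> j < M j by apply: H.
elim: j => [_|j IH js]; first by rewrite (code_M_gt0 code).
by apply: leq_ltn_trans (IH (ltnW js)) (code_M_lt code (ltnSn j) js).
Qed.

Lemma code_at_of_code s M p : is_code v s M p ->
  exists x : code_at s, (forall j, j <= s -> chain_fun (val x).1 j = M j) /\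
    (forall j, j < s -> parent_fun (val x).2 j = p j).
Proof.
move=> code; have [M0 Ms step pp] := code.
have Mdiv (j : 'I_s.+1) : M j \in divisors v.
  by rewrite -dvdn_divisors // -[X in _ %| X]Ms (code_M_dvd code) // -ltnS.
pose c := [ffun j : 'I_s.+1 => SeqSub (Mdiv j) : divlat v].
pose q := [ffun j : 'I_s => inord (p j) : 'I_s.+1].
have qE (j : 'I_s) : q j = p j :> nat.
  by rewrite ffunE inordK // ltnS; have /andP[] := pp j (ltn_ord j).
have cE (j : 'I_s.+1) : ssval (c j) = M j by rewrite ffunE.
have ok : is_strict_chain c && is_parent q.
  apply/andP; split; last by apply/forallP => j; rewrite qE; have /andP[] := pp j (ltn_ord j).
  apply/and3P; split; rewrite ?cE ?M0 ?Ms //.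
  apply/forallP => j; have [dv lt] := step j (ltn_ord j).
  rewrite /divlat_le !cE /= /bump leq0n add1n dv /=.
  apply: contraTneq lt => /(congr1 (@ssval _ _)).
  by rewrite !cE /= /bump leq0n add1n => ->; rewrite ltnn.
exists (exist _ (c, q) ok); split=> j js /=.
  by rewrite -[j]/(val (Ordinal (js : j < s.+1))) chain_funE cE.
by rewrite -[j]/(val (Ordinal js)) parent_funE qE.
Qed.

Lemma card_ord_gt s (i : nat) : i <= s -> #|[pred j : 'I_s.+1 | i < j]| = s - i.
Proof.
move=> is_; rewrite -sum1_card -(big_mkord (fun j => i < j) (fun=> 1)).
rewrite (big_cat_nat (n := i.+1)) //= big_nat_cond big_pred0 => [|j]; last first.
  by apply/negP => /andP[/andP[_ h1] h2]; rewrite ltnNge -ltnS h1 in h2.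
rewrite add0n big_nat_cond (eq_bigl (fun j => (i < j < s.+1) && true)) => [|j]; last first.
  by case: (i < j); rewrite ?andbT ?andbF.
by rewrite -big_nat_cond sum_nat_const_nat muln1 subSS.
Qed.

(** The [i]-th block has [s - i] possible parents. *)
Lemma card_parents s : #|[pred q | @is_parent s q]| = s`!.
Proof.
rewrite (eq_card (B := family (fun i : 'I_s => [pred j : 'I_s.+1 | i < j]))); last first.
  by move=> q; rewrite inE.
rewrite card_family foldrE big_map big_enum /=.
rewrite (eq_bigr (fun i : 'I_s => s - i)) => [|i _]; last first.
  by rewrite card_ord_gt // ltnW.
elim: s => [|s IH]; first by rewrite big_ord0.
by rewrite big_ord_recl /= subn0 factS -IH.
Qed.

Lemma card_finite_code : #|finite_code| = \sum_(s < v.+1) num_chains v s * s`!.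
Proof.
rewrite card_tagged sumnE big_map big_enum /=; apply: eq_bigr => s _.
rewrite card_sig -card_parents /num_chains -cardX.
by apply: eq_card => -[c q]; rewrite !inE.
Qed.

Lemma num_chains0 : 1 < v -> num_chains v 0 = 0.
Proof.
move=> v1; apply: eq_card0 => c; rewrite inE; apply/negP => /and3P[/eqP h0 /eqP h1 _].
have : ord_max = ord0 :> 'I_1 by apply: val_inj.
by move=> e; move: v1; rewrite -h1 e h0.
Qed.

Lemma num_chains_big s : v < s -> num_chains v s = 0.
Proof.
move=> vs; apply: eq_card0 => c; rewrite inE; apply/negP => chain.
have ok : is_strict_chain c && is_parent [ffun i : 'I_s => ord_max : 'I_s.+1].
  by rewrite chain; apply/forallP => i; rewrite ffunE.
have := code_length_lt (code_at_is_code (exist _ (c, _) ok : code_at s)).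
by rewrite ltnNge ltnW.
Qed.

Lemma sum_num_chains : 1 < v ->
  \big[addn/0]_(s \in [set s : nat | 1 <= s]) (num_chains v s * s`!) = #|finite_code|.
Proof.
move=> v1; rewrite card_finite_code.
rewrite (@fsbigE _ _ _ _ _ (iota 1 v)); last 3 first.
- exact: iota_uniq.
- by move=> s /=; rewrite mem_iota => /andP[].
- move=> s /= s1; rewrite mem_iota s1 /= add1n ltnS -ltnNge => vs.
  by rewrite num_chains_big.
rewrite big_ord_recl num_chains0 // mul0n add0n.
have -> : iota 1 v = index_iota 1 v.+1 by rewrite /index_iota subSS subn0.
rewrite big_mkcond /= big_add1 /= big_mkord; apply: eq_bigr => s _.
by rewrite mem_set.
Qed.

End FiniteCodes.

Section DivisorLattice.

(** The bottom and the top of the divisor lattice are characterized by the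
    order alone. *)
Lemma num_chains_iso v v' s : 0 < v -> 0 < v' -> divlat_iso v v' ->
  num_chains v s = num_chains v' s.
Proof.
move=> v0 v0' [f [g fK gK] fle].
have f_inj : injective f := can_inj fK.
have dv (w : nat) (w0 : 0 < w) (x : divlat w) : ssval x %| w.
  by rewrite dvdn_divisors //; apply: ssvalP.
have gle a b : divlat_le (g a) (g b) = divlat_le a b by rewrite -fle !gK.
have bot (w w' : nat) (w0 : 0 < w) (w0' : 0 < w') (h : divlat w -> divlat w')
    (h' : divlat w' -> divlat w) : cancel h' h ->
    (forall a b, divlat_le (h a) (h b) = divlat_le a b) ->
    forall x, ssval x = 1 -> ssval (h x) = 1.
  move=> hK hle x x1; apply/eqP; rewrite -dvdn1.
  have m1 : 1 \in divisors w' by rewrite -dvdn_divisors ?dvd1n.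
  have := hle x (h' (SeqSub m1)); rewrite hK /divlat_le /= x1 dvd1n.
  by [].
have top (w w' : nat) (w0 : 0 < w) (w0' : 0 < w') (h : divlat w -> divlat w')
    (h' : divlat w' -> divlat w) : cancel h' h ->
    (forall a b, divlat_le (h a) (h b) = divlat_le a b) ->
    forall x, ssval x = w -> ssval (h x) = w'.
  move=> hK hle x xw; apply/eqP; rewrite eqn_dvd dv //=.
  have m1 : w' \in divisors w' by rewrite -dvdn_divisors.
  have := hle (h' (SeqSub m1)) x; rewrite hK /divlat_le /= xw => ->.
  exact: dv.
have chain (c : {ffun 'I_s.+1 -> divlat v}) :
    is_strict_chain [ffun i => f (c i)] = is_strict_chain c.
  rewrite /is_strict_chain !ffunE; congr [&& _, _ & _].
  - apply/eqP/eqP; last exact: (bot _ _ v0 v0' f g gK fle).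
    by move=> h; rewrite -[c ord0]fK; apply: (bot _ _ v0' v0 g f fK gle).
  - apply/eqP/eqP; last exact: (top _ _ v0 v0' f g gK fle).
    by move=> h; rewrite -[c ord_max]fK; apply: (top _ _ v0' v0 g f fK gle).
  by apply: eq_forallb => i; rewrite !ffunE fle (inj_eq f_inj).
rewrite /num_chains.
pose lift_f (c : {ffun 'I_s.+1 -> divlat v}) : {ffun 'I_s.+1 -> divlat v'} :=
  [ffun i => f (c i)].
have lift_inj : injective lift_f.
  move=> c c' /ffunP e; apply/ffunP => i; apply: f_inj.
  by have := e i; rewrite !ffunE.
rewrite -(fintype.card_image lift_inj); apply: eq_card => c'.
rewrite [RHS]inE; apply/fintype.imageP/idP => [[c cc ->]|c'c].
  by rewrite chain; move: cc; rewrite inE.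
exists [ffun i => g (c' i)].
  rewrite inE -chain; move: c'c; congr is_true; congr is_strict_chain.
  by apply/ffunP => i; rewrite !ffunE gK.
by apply/ffunP => i; rewrite !ffunE gK.
Qed.

End DivisorLattice.

Section ClassCount.
Local Open Scope classical_set_scope.
Variables (R : realType) (v k : nat).
Hypotheses (k_gt0 : (0 < k)%N) (v_gt1 : (1 < v)%N).

Lemma simplex_has_code_ext s M p M' p' d (P : set 'rV[R]_d) :
  (forall j, (j <= s)%N -> M j = M' j) -> (forall j, (j < s)%N -> p j = p' j) ->
  simplex_has_code v k s M p P -> simplex_has_code v k s M' p' P.
Proof.
move=> eM ep [V [F [blk [uA PE bf [code blk_lt surj FE]]]]].
have code' : is_code v s M' p'.
  have [M0 Ms step pp] := code; split=> [||j js|j js].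
  - by rewrite -eM.
  - by rewrite -eM.
  - by rewrite -!eM ?(ltnW js) //; apply: step.
  - by rewrite -ep //; apply: pp.
exists V, F, blk; split=> //; split=> // N i Nv; rewrite FE //.
have := ltnW (blk_lt i); elim/(parent_ind code): (blk i) / => [|j js IH].
  by rewrite !colv_root.
rewrite (colv_step R code) // (colv_step R code') // /radix /digit -!eM ?(ltnW js) //.
by rewrite IH ep.
Qed.

Lemma card_gorenstein_classes :
  (gorenstein_classes R v k #= `I_#|finite_code v|)%card.
Proof.
pose hasc (x : finite_code v) d (P : set 'rV[R]_d) :=
  simplex_has_code v k (tag x) (chain_fun (val (tagged x)).1)
    (parent_fun (val (tagged x)).2) P.
have ex (x : finite_code v) : exists y : {d : nat & set 'rV[R]_d},
    admissible v k (projT2 y) /\ hasc x _ (projT2 y).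
  have [d [P [adm hc]]] := code_realization R (code_at_is_code (ltnW v_gt1) (tagged x)) k_gt0 v_gt1.
  by exists (existT _ d P).
have [Y YP] := choice ex.
pose Phi x : set {d : nat & set 'rV[R]_d} := unimod_class (projT2 (Y x)).
have -> : gorenstein_classes R v k = Phi @` [set: finite_code v].
  apply/seteqP; split=> [C [d [P [adm ->]]]|_ [x _ <-]]; last first.
    by exists (projT1 (Y x)), (projT2 (Y x)); split=> //; case: (YP x).
  have [s [M [p hc]]] := admissible_has_code k_gt0 v_gt1 adm.
  have code := simplex_code hc.
  have [y [yM yp]] := code_at_of_code (ltnW v_gt1) code.
  have sv : (s < v.+1)%N by rewrite ltnS ltnW //; apply: code_length_lt code.
  pose x : finite_code v := Tagged (fun s : 'I_v.+1 => code_at v s) (y : code_at v (Ordinal sv)).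
  exists x => //; apply: (same_code_class (proj2 (YP x))).
  by apply: simplex_has_code_ext hc => j js; rewrite ?yM ?yp.
have Phi_inj : injective Phi.
  move=> x x' e.
  have hc : hasc x _ (projT2 (Y x')).
    have := @unimod_class_invariant R (hasc x) _ _ _ _ _ e (proj2 (YP x)).
    by apply=> c A B; apply: simplex_has_code_equiv.
  have [] := simplex_code_unique k_gt0 hc (proj2 (YP x')).
  case: x x' {e hc} => [s y] [s' y'] /= es; have {}es : s = s' by apply: val_inj.
  by subst s' => hM hp; congr (Tagged _ _); apply: code_at_inj.
apply: card_eq_trans (inj_card_eq _) _ => [x x' _ _|]; first exact: Phi_inj.
have <- : enum_val @` [set: 'I_#|finite_code v|] = [set: finite_code v].
  by apply/seteqP; split=> // x _; exists (enum_rank x); rewrite ?enum_rankK.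
apply: card_eq_trans (inj_card_eq _) _ => [i j _ _|]; first exact: enum_val_inj.
by rewrite card_eq_sym; apply: card_II.
Qed.

End ClassCount.

Local Open Scope classical_set_scope.
Local Open Scope card_scope.

Theorem theorem1p2 (R : realType) (v k : nat) (hk : (1 <= k)%N) (hv : (2 <= v)%N) :
  (gorenstein_classes R v k
     #= `I_(\big[addn/0%N]_(s \in [set s : nat | (1 <= s)%N])
              (num_chains v s * s`!)%N)) /\
  (forall v' k' : nat, (2 <= v')%N -> (1 <= k')%N -> divlat_iso v v' ->
     gorenstein_classes R v k #= gorenstein_classes R v' k').
Proof.
have count v1 k1 : (2 <= v1)%N -> (1 <= k1)%N -> gorenstein_classes R v1 k1
    #= `I_(\big[addn/0%N]_(s \in [set s : nat | (1 <= s)%N])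
         (num_chains v1 s * s`!)%N).
  by move=> hv1 hk1; rewrite sum_num_chains ?(ltnW hv1) //; apply: card_gorenstein_classes.
split=> [|v' k' hv' hk' iso]; first exact: count.
apply: card_eq_trans (count v k hv hk) _; rewrite card_eq_sym.
apply: card_eq_trans (count v' k' hv' hk') _.
rewrite (eq_fsbigr (op := addn) (fun s => (num_chains v s * s`!)%N)).
  exact: card_eqxx.
by move=> s _; rewrite (num_chains_iso s (ltnW hv) (ltnW hv') iso).
Qed.
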